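(* Let $(W,H,\mu_W)$ be an abstract Wiener space, let $x$ be a random variable with law $\mu_X$ satisfying the standing assumptions listed in the context, independent of the Wiener noise $w$, and for a real parameter $\rho$ let $y=\rho x+w$. Let $I(X;Y)$ be the mutual information between $x$ and $y$ and $\overline{\overline{x}}=E(x\mid y)$ (both depending on $\rho$). Then $$\frac{dI(X;Y)}{d\rho}=\rho\,E\bigl(|x|_H^2-|\overline{\overline{x}}|_H^2\bigr)=\rho\,E|x-\overline{\overline{x}}|_H^2 .$$
   Context: Abstract Wiener space: $W$ is a separable Banach space, $H$ (the Cameron-Martin space) is a Hilbert space densely and continuously embedded in $W$, the dual $W^*$ is densely and continuously embedded in $H$ (so $W^*\subset H\subset W$), and $\mu_W$ is the probability measure on $W$ such that for every $e\in W^*$ the random variable $\delta e:=\langle w,e\rangle$ is $N(0,|e|_H^2)$. Channel: $x$ is an $H$-valued random variable with law $\mu_X$ (not depending on $\rho$); $(x,w)$ lives on $H\times W$ with the product measure $\mu_X\times\mu_W$ (so $x$ and $w$ are independent), and $y=\rho x+w$, where $x$ is identified with its image in $W$. Standing assumptions on $x$: $x$ takes values in $W^*$, and $\exp(\alpha(x,h)_H)\in L^1(\mu_X)$ for all $\alpha\in\mathbb{R}$ and all $h\in W^*$. Notation: $E$ is expectation with respect to $\mu_X\times\mu_W$; $\mu_Y$ is the law of $y$ on $W$ and $\mu_{X,Y}$ the joint law of $(x,y)$. The mutual information is $I(X;Y)=\int\log\frac{d\mu_{X,Y}}{d(\mu_X\times\mu_Y)}(x,y)\,\mu_{X,Y}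(dx,dy)$.
   Formalization: The formal statement adds the hypothesis that E|x|_H^2 is finite; it does not follow from the standing assumptions, without it I(X;Y) can be infinite, and at rho = 0 the expectation E(|x|_H^2 - |E(x|y)|_H^2) is infinite or undefined. *)

(* Defs.v *)
From HB Require Import structures.
From mathcomp Require Import all_boot all_order all_algebra sesquilinear lra.
From mathcomp Require Import all_classical all_reals all_analysis.
Import Order.TTheory GRing.Theory Num.Theory.
Import numFieldNormedType.Exports.

Set Implicit Arguments.
Unset Strict Implicit.
Unset Printing Implicit Defensive.

Local Open Scope classical_set_scope.
Local Open Scope ring_scope.
Local Open Scope charge_scope.

Notation borel T := (g_sigma_algebraType (@open T)).

Definition separable (T : topologicalType) :=
  exists2 D : set T, countable D & dense D.

Record dual (R : realType) (W : normedModType R) := Dual {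
  dual_fun :> {linear W -> R^o};
  dual_continuous : continuous dual_fun }.

(* N(m, s ^+ 2); the library's normal_prob m 0 is the uniform law on [0, 1],
   not the Dirac mass at m. *)
Definition gaussian_law (R : realType) (m s : R) : set R -> \bar R :=
  if s == 0 then \d_m else normal_prob m s.

Record abstract_wiener_space (R : realType) := AbstractWienerSpace {
  wiener : completeNormedModType R;
  wiener_separable : separable wiener;
  cameron_martin : completeNormedModType R;
  inner : {dot cameron_martin for idfun};
  norm_innerE : forall h : cameron_martin, `|h| ^+ 2 = inner h h;
  embed : {linear cameron_martin -> wiener};
  embed_inj : injective embed;
  embed_continuous : continuous embed;
  embed_dense : dense (range embed);
  (* The inclusion of W^* in H: the element of H identified with e represents
     the restriction of e to H. *)
  dual_embed : dual wiener -> cameron_martin;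
  dual_embedE : forall (e : dual wiener) (h : cameron_martin),
    inner h (dual_embed e) = e (embed h);
  dual_embed_dense : dense (range dual_embed);
  (* Continuity for the operator norm of W^*, which is the least admissible M. *)
  dual_embed_bounded : exists C : R, forall (e : dual wiener) (M : R), 0 <= M ->
    (forall w : wiener, `|e w| <= M * `|w|) -> `|dual_embed e| <= C * M;
  wiener_measure : probability (borel wiener) R;
  wiener_gaussian : forall (e : dual wiener) (A : set R), measurable A ->
    wiener_measure [set w | A (e w)] = gaussian_law 0 `|dual_embed e| A }.

Arguments dual_embed {R} _ _.

Section measurability.
Context {R : realType}.

Lemma continuous_borel_measurable (T U : ptopologicalType) (f : T -> U) :
  continuous f -> measurable_fun [set: borel T] (f : borel T -> borel U).
Proof.
move=> /continuousP cf.
apply: (@measurability _ _ _ (borel U) _ _ (@open U)) => //.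
move=> _ [B oB <-]; rewrite setTI.
by apply: sub_sigma_algebra; exact: cf.
Qed.

Lemma separable_borel_add (V : normedModType R) : separable V ->
  measurable_fun [set: borel V * borel V]
    ((fun z => (z.1 : V) + z.2) : borel V * borel V -> borel V).
Proof.
move=> [D cD dD].
apply: (@measurability _ _ _ (borel V) _ _ (@open V)) => //.
move=> _ [U oU <-]; rewrite setTI.
pose C : set (V * V * nat) :=
  [set q | [/\ D q.1.1, D q.1.2 & forall a b,
     ball q.1.1 q.2.+1%:R^-1 a -> ball q.1.2 q.2.+1%:R^-1 b -> U (a + b)]].
have cC : countable C.
  apply: (@sub_countable _ _ C ((D `*` D) `*` [set: nat])).
    by apply: subset_card_le => -[[a b] n] [].
  by apply: countableX => //; exact: countableX.
have -> : (fun z : borel V * borel V => (z.1 : V) + z.2) @^-1` U =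
   \bigcup_(q in C) ((ball q.1.1 q.2.+1%:R^-1 : set (borel V)) `*`
                     (ball q.1.2 q.2.+1%:R^-1 : set (borel V))).
  apply/seteqP; split=> [[u v] /= Uuv|[u v] [[[a b] n] /= [_ _ h]] [ua vb]];
    last exact: h.
  have /nbhs_ballP[e /= e0 he] : nbhs (u + v : V) U by exact: open_nbhs_nbhs.
  have [n nge] : exists n : nat, n.+1%:R^-1 < e / 4.
    have e4 : 0 < e / 4 by rewrite divr_gt0.
    exists (Num.truncn (e / 4)^-1); rewrite invf_plt ?posrE//.
    exact: truncnS_gt.
  have pick (w : V) : exists2 a, D a & ball a n.+1%:R^-1 w.
    have [| |a [wa Da]] := dD (ball w n.+1%:R^-1).
    - by exists w; exact: ballxx.
    - exact: ball_open.
    - by exists a => //; exact: ball_sym.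
  have [a Da ua] := pick u; have [b Db vb] := pick v.
  exists (a, b, n) => //; split => //= a' b' aa' bb'.
  apply: he; move: ua vb aa' bb'; rewrite -!ball_normE /= => ua vb aa' bb'.
  have -> : u + v - (a' + b') = (u - a) + (a - a') + ((v - b) + (b - b')).
    by rewrite !subrKA opprD addrACA.
  apply: (le_lt_trans (ler_normD _ _)).
  have e4E : e = (e / 4 + e / 4) + (e / 4 + e / 4) by lra.
  rewrite e4E; apply: ltrD; apply: (le_lt_trans (ler_normD _ _)); apply: ltrD;
    by apply: lt_trans nge => //; rewrite distrC.
have mX q : measurable ((ball q.1.1 q.2.+1%:R^-1 : set (borel V)) `*`
                          (ball q.1.2 q.2.+1%:R^-1 : set (borel V))).
  by apply: measurableX; apply: sub_sigma_algebra; exact: ball_open.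
have [->|/unsquash f] := pfcard_geP cC; first by rewrite bigcup_set0.
rewrite -(image_eq f) bigcup_image.
by apply: bigcup_measurable => k _; exact: mX.
Qed.

End measurability.

Section mutual_information.
Context {R : realType} {d dX dY : measure_display} {T : measurableType d}.
Context {TX : measurableType dX} {TY : measurableType dY}.
Context (P : probability T R) (X : {RV P >-> TX}) (Y : {RV P >-> TY}).

Definition RV_pair (t : T) : TX * TY := (X t, Y t).

Lemma measurable_RV_pair : measurable_fun [set: T] RV_pair.
Proof. by apply: measurable_fun_pair. Qed.

HB.instance Definition _ :=
  isMeasurableFun.Build _ _ _ _ RV_pair measurable_RV_pair.

(* If the joint law is not dominated by the product law, the library's
   Radon-Nikodym derivative is constantly -oo, and so is this integral: a finite
   value entails absolute continuity. *)
Definition mutual_information : \bar R :=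
  let PXY : probability (TX * TY)%type R := distribution P RV_pair in
  let PX_PY : probability (TX * TY)%type R :=
    (distribution P X \x distribution P Y)%E in
  (\int[PXY]_z lne ('d (charge_of_finite_measure PXY) '/d PX_PY z))%E.

End mutual_information.
Arguments mutual_information {R d dX dY T TX TY} P X Y.

(* xhat is a version of E(X | Y) for an integrable H-valued X, characterized by
   (xhat, h) = E((X, h) | Y) for all h in H. *)
Definition is_cond_expectation (R : realType) (H : completeNormedModType R)
    (ip : {dot H for idfun}) (d dY : measure_display) (T : measurableType d)
    (TY : measurableType dY) (P : probability T R) (X : T -> H) (Y : T -> TY)
    (xhat : T -> H) :=
  [/\ forall B : set (borel H), measurable B ->
        g_sigma_algebra_preimage Y (xhat @^-1` B),
      P.-integrable [set: T] (fun t => `|xhat t|%:E) &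
      forall (h : H) (A : set T), g_sigma_algebra_preimage Y A ->
        (\int[P]_(t in A) (ip (xhat t) h)%:E =
         \int[P]_(t in A) (ip (X t) h)%:E)%E].

Section gaussian_channel.
Context {R : realType} (S : abstract_wiener_space R).
Local Notation W := (wiener S).
Local Notation H := (cameron_martin S).

Definition input (z : borel H * borel W) : borel H := z.1.

HB.instance Definition _ :=
  isMeasurableFun.Build _ _ _ _ input measurable_fst.

Definition output (rho : R) (z : borel H * borel W) : borel W :=
  rho *: embed S z.1 + z.2.

Lemma measurable_output rho :
  measurable_fun [set: borel H * borel W] (output rho).
Proof.
have mscale : measurable_fun [set: borel H]
    ((fun h : H => rho *: embed S h) : borel H -> borel W).
  apply: continuous_borel_measurable => h.
  by apply: cvgZl_tmp; exact: embed_continuous.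
pose g (z : borel H * borel W) : borel W * borel W :=
  (rho *: embed S z.1, z.2).
have mg : measurable_fun [set: borel H * borel W] g.
  by apply: measurable_fun_pair => //; exact: (measurableT_comp mscale).
exact: (measurableT_comp (separable_borel_add (@wiener_separable _ S)) mg).
Qed.

HB.instance Definition _ rho :=
  isMeasurableFun.Build _ _ _ _ (output rho) (measurable_output rho).

Definition channel_prob (muX : probability (borel H) R) :
  probability (borel H * borel W)%type R := (muX \x wiener_measure S)%E.

End gaussian_channel.
Arguments input {R} S z.
Arguments output {R} S rho z.

(* Main.v *)
Require Import Defs.
From HB Require Import structures.
From mathcomp Require Import all_boot all_order all_algebra sesquilinear.
From mathcomp Require Import all_classical all_reals all_analysis.
From mathcomp Require Import measurable_realfun ring lra.
Import Order.TTheory GRing.Theory Num.Theory.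
Import numFieldNormedType.Exports.

(* By the Cameron-Martin theorem, the law of y = rho x + w has density
   q(w) = E exp (rho <w, x> - rho^2 |x|^2 / 2) with respect to the law of w, so
   that I(X; Y) = rho^2 E |x|^2 / 2 - D(rho) with D(rho) = E log q(y).  Going
   from rho to r' multiplies the likelihood of x by exp (rho (r' - rho) (x, x')),
   where x' is the true input; Jensen's inequality given y, followed by Gibbs'
   inequality, therefore yields
     D(r') >= D(rho) + rho (r' - rho) G(rho),   G(rho) = E (x, x'),
   for x and x' independent replicas given y.  As G is continuous, these lower
   bounds alone make D differentiable with derivative rho G(rho), without any
   differentiation under the integral sign.  Expanding along a Parseval sequence
   of H identifies G(rho) with E |E(x | y)|^2. *)

(** The pairing of w with x makes direct sense only for x in the dual of W, and its joint
    measurability in (x, w) is not automatic. Hence a fixed measurable version [pairing], and a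
    Cameron-Martin formula applied to one input at a time under Fubini. That formula is obtained by
    comparing Laplace transforms, so it rests on a uniqueness theorem for measures on W, which needs
    enough functionals: this is why the development starts with Hahn-Banach.

    In the lower bound for D the outputs y and y' at the two rates are built from the same (x, w),
    so y' - y is (r' - rho) x. Jensen compares q_rho(y') with q_rho(y); since y' has density q_r',
    Gibbs then replaces E log q_rho(y') by the larger E log q_r'(y').

    No majorant of (x, x') times the replica density, uniform in the rate, is at hand, so continuity
    of G is not a plain dominated convergence. It is derived from a total variation estimate by
    truncating the nonnegative functions |x + x'|^2 and |x - x'|^2. *)

Set Implicit Arguments.
Unset Strict Implicit.
Unset Printing Implicit Defensive.

Local Open Scope classical_set_scope.
Local Open Scope ring_scope.

(** * Norming functionals *)

Section hahn_banach.
Context {R : realType} {V : lmodType R}.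
Implicit Types (p q : V -> R) (x y : V).

(** One inequality in the homogeneity is enough: applied to the inverse scalar it yields the other
    ([sublinearZ]), and it is the easier one to check for infima. *)
Definition sublinear p :=
  (forall x y, p (x + y) <= p x + p y) /\
  (forall (c : R) x, 0 <= c -> p (c *: x) <= c * p x).

Lemma sublinear_opp p x : sublinear p -> - p (- x) <= p x.
Proof.
move=> [pD pZ]; have := pD x (- x); rewrite subrr.
have := pD 0 0; rewrite addr0; lra.
Qed.

Lemma sublinear0 p : sublinear p -> p 0 = 0.
Proof.
move=> [pD pZ]; have := pD 0 0; have := pZ 0 0 (lexx _).
rewrite addr0 scale0r mul0r => ? ?; lra.
Qed.

Lemma sublinearZ p (c : R) x : sublinear p -> 0 <= c -> p (c *: x) = c * p x.
Proof.
move=> sp; rewrite le_eqVlt => /predU1P[<-|c0].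
  by rewrite scale0r mul0r sublinear0.
apply/eqP; rewrite eq_le; apply/andP; split; first exact: sp.2 _ _ (ltW c0).
rewrite -ler_pdivlMl//.
have := sp.2 c^-1 (c *: x); rewrite scalerA mulVf ?gt_eqF// scale1r.
by apply; rewrite invr_ge0 ltW.
Qed.

(** Zorn's lemma for the reversed pointwise order. The pointwise infimum of a chain is finite
    because every member satisfies - p0 (- x) <= p x. *)
Lemma exists_minimal_sublinear p0 : sublinear p0 ->
  exists p, [/\ sublinear p, forall x, p x <= p0 x &
    forall q, sublinear q -> (forall x, q x <= p x) -> p = q].
Proof.
move=> s0; pose T := {p | sublinear p /\ forall x, p x <= p0 x}.
pose r (s t : T) := `[< forall x, sval t x <= sval s x >].
have [||A tA|[p [sp pp0]] pmin] := @ZL_preorder T (exist _ p0 (conj s0 (fun=> lexx _))) r.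
- by move=> t; apply/asboolP.
- move=> a b c /asboolP ab /asboolP bc; apply/asboolP => x.
  exact: le_trans (ab x).
- have [A0|/set0P[t0 At0]] := eqVneq A set0.
    by exists (exist _ p0 (conj s0 (fun=> lexx _))) => s; rewrite A0.
  pose q x := inf [set sval t x | t in A].
  have lbq x : has_lbound [set sval t x | t in A].
    exists (- p0 (- x)) => _ [[p [sp pp0]] _ <-] /=.
    by apply: le_trans (sublinear_opp _ sp); rewrite lerN2.
  have n0 x : [set sval t x | t in A] !=set0 by exists (sval t0 x), t0.
  have qle t x : A t -> q x <= sval t x by move=> At; apply: ge_inf => //; exists t.
  have leq x (a : R) : (forall t, A t -> a <= sval t x) -> a <= q x.
    by move=> h; apply: lb_le_inf => // _ [t At <-]; exact: h.
  have sq : sublinear q.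
    split=> [x y|c x c0].
      rewrite -lerBlDr; apply: (leq x) => t1 At1; rewrite lerBlDr -lerBlDl.
      apply: (leq y) => t2 At2; rewrite lerBlDl.
      (* Totality of the chain enters here: the smaller of t1 and t2 bounds the infimum at x + y and
         lies below both. *)
      have [/asboolP h|/asboolP h] := tA _ _ At1 At2.
        apply: le_trans (qle t2 _ At2) _.
        by apply: (le_trans ((svalP t2).1.1 x y)); rewrite lerD2r.
      apply: le_trans (qle t1 _ At1) _.
      by apply: (le_trans ((svalP t1).1.1 x y)); rewrite lerD2l.
    move: c0; rewrite le_eqVlt => /predU1P[<-|c0].
      rewrite mul0r scale0r; apply: le_trans (qle _ _ At0) _.
      by rewrite (sublinear0 (svalP t0).1).
    rewrite -ler_pdivrMl//; apply: leq => t At; rewrite ler_pdivrMl//.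
    apply: le_trans (qle _ _ At) _; exact: (svalP t).1.2 _ _ (ltW c0).
  have qp0 x : q x <= p0 x by apply: le_trans (qle _ _ At0) _; exact: (svalP t0).2.
  exists (exist _ q (conj sq qp0)) => t At; apply/asboolP => x; exact: qle.
- exists p; split => // q sq qp.
  have qp0 x : q x <= p0 x by exact: le_trans (qp x) (pp0 x).
  apply/funext => x; apply/eqP; rewrite eq_le qp andbT.
  by have /asboolP := pmin (exist _ q (conj sq qp0)) (introT (asboolP _) qp); exact.
Qed.

(** For sublinear p, this is the largest sublinear functional below p whose value at - x is at most
    - p x. *)
Definition sublinear_shift p x y :=
  inf [set p (y + t *: x) - t * p x | t in [set t | 0 <= t]].

(** The infimum is at least - p (- y). The values t = 0 and t = 1 give the two bounds, and
    parameters t1 and t2 for two points combine into t1 + t2 for their sum. *)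
Lemma sublinear_shiftP p x : sublinear p ->
  [/\ sublinear (sublinear_shift p x),
      forall y, sublinear_shift p x y <= p y &
      sublinear_shift p x (- x) <= - p x].
Proof.
move=> sp; set q := sublinear_shift p x.
have lbq y : has_lbound [set p (y + t *: x) - t * p x | t in [set t | 0 <= t]].
  exists (- p (- y)) => _ [t /= t0 <-].
  have := sp.1 (y + t *: x) (- y); rewrite addrAC subrr add0r sublinearZ//; lra.
have n0 y : [set p (y + t *: x) - t * p x | t in [set t | 0 <= t]] !=set0.
  by exists (p (y + 0 *: x) - 0 * p x), 0 => /=.
have qle t y : 0 <= t -> q y <= p (y + t *: x) - t * p x.
  by move=> t0; apply: ge_inf => //; exists t.
have leq y (a : R) : (forall t, 0 <= t -> a <= p (y + t *: x) - t * p x) -> a <= q y.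
  by move=> h; apply: lb_le_inf => // _ [t t0 <-]; exact: h.
split.
- split=> [y z|c y c0].
    rewrite -lerBlDr; apply: (leq y) => t1 t10; rewrite lerBlDr -lerBlDl.
    apply: (leq z) => t2 t20; rewrite lerBlDl.
    apply: (le_trans (qle (t1 + t2) _ (addr_ge0 t10 t20))).
    have := sp.1 (y + t1 *: x) (z + t2 *: x).
    rewrite addrACA -scalerDl mulrDl; lra.
  move: c0; rewrite le_eqVlt => /predU1P[<-|c0].
    rewrite mul0r scale0r; apply: (le_trans (qle 0 _ (lexx _))).
    by rewrite scale0r addr0 mul0r subr0 sublinear0.
  rewrite -ler_pdivrMl//; apply: leq => t t0; rewrite ler_pdivrMl//.
  apply: (le_trans (qle (c * t) _ (mulr_ge0 (ltW c0) t0))).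
  by rewrite -scalerA -scalerDr sublinearZ ?(ltW c0)// mulrBr mulrA.
- by move=> y; apply: (le_trans (qle 0 _ (lexx _))); rewrite scale0r addr0 mul0r subr0.
- apply: (le_trans (qle 1 _ ler01)).
  by rewrite scale1r addNr mul1r sublinear0// sub0r.
Qed.

(* A minimal sublinear functional p is odd, since it coincides with each
   sublinear_shift p x; a sublinear odd functional is linear. *)
Lemma exists_linear_le_sublinear p0 x0 : sublinear p0 ->
  exists f : {linear V -> R^o},
    (forall x, f x <= p0 x) /\ p0 x0 <= f x0.
Proof.
(* Shifting at x0 before minimizing forces p (- x0) <= - p0 x0, which becomes the lower bound at x0
   once p is odd. *)
move=> s0; have [s1 le1 leN] := sublinear_shiftP x0 s0.
have [p [sp pp1 pmin]] := exists_minimal_sublinear s1.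
have pN x : p (- x) = - p x.
  have [sq qp qN] := sublinear_shiftP x sp.
  apply/eqP; rewrite eq_le {1}(pmin _ sq qp) qN/=.
  by rewrite lerNl; exact: sublinear_opp.
have pD x y : p (x + y) = p x + p y.
  apply/eqP; rewrite eq_le sp.1/=.
  have := sp.1 (x + y) (- y); rewrite addrK pN; lra.
have pZ (c : R) x : p (c *: x) = c * p x.
  have [c0|/ltW c0] := leP 0 c; first exact: sublinearZ.
  by rewrite -[c]opprK scaleNr pN sublinearZ ?oppr_ge0// [RHS]mulNr.
have lin : linear (p : V -> R^o) by move=> c x y; rewrite pD pZ.
pose f : {linear V -> R^o} :=
  HB.pack (p : V -> R^o) (GRing.isLinear.Build R V R^o *:%R p lin).
exists f; split=> [x /=|/=]; first exact: le_trans (pp1 x) (le1 x).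
have := le_trans (pp1 (- x0)) leN; rewrite pN; lra.
Qed.

End hahn_banach.

Section norming_functional.
Context {R : realType} {V : normedModType R}.

Lemma exists_norming_functional (v : V) :
  exists f : dual V, (forall x, `|f x| <= `|x|) /\ f v = `|v|.
Proof.
have [|f [fle fv]] := @exists_linear_le_sublinear R V (fun x => `|x|) v.
  by split=> [x y|c x c0]; rewrite ?ler_normD// normrZ ger0_norm.
have fabs x : `|f x| <= `|x|.
  rewrite ler_norml fle andbT lerNl -linearN.
  by apply: le_trans (fle _) _; rewrite normrN.
have cf : continuous f.
  apply: bounded_linear_continuous; apply/ex_bound.
  by exists 1; apply/nbhs_ballP; exists 1 => //= x; rewrite -ball_normE/= sub0r normrN => /ltW;
    exact: le_trans.
by exists (Dual cf); split => //=; apply/eqP; rewrite eq_le fv fle.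
Qed.

End norming_functional.

(** * Countably many functionals determine the norm and the Borel sets *)

Section dual_generates_borel.
Context {R : realType} {V : normedModType R}.
Hypothesis sepV : separable V.

(** Take f_n norming the n-th point of a dense sequence. If |v - d_n| < e / 2, then f_n v >= |d_n| -
    |v - d_n| > |v| - e, so f_n almost norms v too. *)
Lemma exists_norming_sequence : exists f : nat -> dual V, forall v,
  (forall n, f n v <= `|v|) /\ forall e, 0 < e -> exists n, `|v| - e < f n v.
Proof.
have [D cD dD] := sepV.
have [d Dd] : exists d : nat -> V, D `<=` range d.
  have /pfcard_geP[D0|/unsquash d] := cD; last by exists d; rewrite (image_eq d).
  have [| |x [_]] := dD setT; [by exists 0|exact: openT|by rewrite D0].
have /choice[f fP] : forall n, exists f : dual V,
    (forall x, `|f x| <= `|x|) /\ f (d n) = `|d n|.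
  by move=> n; exact: exists_norming_functional.
exists f => v; split=> [n|e e0]; first exact: le_trans (ler_norm _) ((fP n).1 v).
have e2 : 0 < e / 2 by rewrite divr_gt0.
have [| |x [vx Dx]] := dD (ball v (e / 2)).
- by exists v; exact: ballxx.
- exact: ball_open.
have [n _ nx] := Dd x Dx; exists n.
move: vx; rewrite -ball_normE/= -nx => vd.
have := (fP n).1 (v - d n); rewrite linearB/= (fP n).2 ler_norml => /andP[+ _].
have := ler_normD (v - d n) (d n); rewrite subrK.
move: vd; lra.
Qed.

(* Every ball is a countable intersection of half-spaces {f_n (w - v) <= r}. *)
Lemma dual_generates_borel (G : set (set V)) :
    sigma_algebra setT G ->
    (forall (f : dual V) (a : R), G [set w | a <= f w]) ->
  forall A : set (borel V), measurable A -> G A.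
Proof.
move=> sG Gf.
have [f fP] := exists_norming_sequence.
have GC A : G A -> G (~` A) by move=> GA; rewrite -setTD; case: sG => _ h _; exact: h.
have GU (F : nat -> set V) : (forall n, G (F n)) -> G (\bigcup_n F n).
  by case: sG => _ _; exact.
have Gcb v (r : R) : G [set w | `|w - v| <= r].
  rewrite (_ : [set w | _] = ~` \bigcup_n [set w | r < f n w - f n v]).
    apply/GC/GU => n.
    rewrite (_ : [set w | _] = \bigcup_k [set w | r + f n v + k.+1%:R^-1 <= f n w]).
      by apply: GU => k; exact: Gf.
    apply/seteqP; split=> [w /= rw|w [k _] /=]; last first.
      have : 0 < k.+1%:R^-1 :> R by rewrite invr_gt0.
      by move: (k.+1%:R^-1) => c /= c0 ?; lra.
    have [|k kP] := ltr_add_invr (_ : r + f n v < f n w); first by lra.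
    by exists k => //=; exact: ltW.
  apply/seteqP; split=> [w /= wr [n _ /=]|w /= wr].
    have := (fP (w - v)).1 n; rewrite linearB/=; lra.
  rewrite leNgt; apply/negP => rw; apply: wr.
  have [|n] := (fP (w - v)).2 (`|w - v| - r); first by lra.
  by rewrite linearB/= => rn; exists n => //=; lra.
have Gb v (r : R) : G [set w | `|w - v| < r].
  rewrite (_ : [set w | _] = \bigcup_k [set w | `|w - v| <= r - k.+1%:R^-1]).
    by apply: GU => k; exact: Gcb.
  apply/seteqP; split=> [w /= wr|w [k _] /=].
    have [k kP] := ltr_add_invr wr; exists k => //=.
    by move: (k.+1%:R^-1) kP => c ?; lra.
  have : 0 < k.+1%:R^-1 :> R by rewrite invr_gt0.
      by move: (k.+1%:R^-1) => c /= c0 ?; lra.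
apply: smallest_sub => // U oU.
have [D cD dD] := sepV.
pose C : set (V * nat) := [set q | D q.1 /\ [set w | `|w - q.1| < q.2.+1%:R^-1] `<=` U].
have cC : countable C.
  apply: (@sub_countable _ _ C (D `*` [set: nat])).
    by apply: subset_card_le => -[a n] [].
  exact: countableX.
have -> : U = \bigcup_(q in C) [set w | `|w - q.1| < q.2.+1%:R^-1].
  apply/seteqP; split=> [u Uu|u [q [_ h]]]; last exact: h.
  have /nbhs_ballP[e /= e0 he] : nbhs u U by exact: open_nbhs_nbhs.
  have [|n nge] := ltr_add_invr (_ : 0 < e / 2); first by rewrite divr_gt0.
  have [| |a [ua Da]] := dD (ball u n.+1%:R^-1).
  - by exists u; exact: ballxx.
  - exact: ball_open.
  exists (a, n); last by move: ua; rewrite -ball_normE.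
  split=> // w /= wa; apply: he; move: ua; rewrite -!ball_normE/= => ua.
  have := ler_distD a u w; rewrite (distrC a w).
  by move: (n.+1%:R^-1) nge ua wa => c; lra.
have [->|/unsquash g] := pfcard_geP cC.
  rewrite bigcup_set0; have := GC _ (Gcb 0 (-1)); have := Gcb 0 (-1).
  by case: sG.
rewrite -(image_eq g) bigcup_image.
apply: (GU (fun k => [set w | `|w - (g k).1| < (g k).2.+1%:R^-1])) => k; exact: Gb.
Qed.

End dual_generates_borel.

(** * Parseval sequences *)

Section inner_product.
Context {R : realType} {H : completeNormedModType R} (ip : {dot H for idfun}).
Hypothesis normE : forall h : H, `|h| ^+ 2 = ip h h.
Implicit Types (h k : H).

Lemma ipC h k : ip h k = ip k h.
Proof. by have := hermC ip h k; rewrite expr0 mul1r. Qed.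

Lemma ipDl h1 h2 k : ip (h1 + h2) k = ip h1 k + ip h2 k.
Proof. exact: linearDl. Qed.

Lemma ipZl (a : R) h k : ip (a *: h) k = a * ip h k.
Proof. exact: linearZl_LR. Qed.

Lemma ipNl h k : ip (- h) k = - ip h k.
Proof. exact: linearNl. Qed.

Lemma ip0l k : ip 0 k = 0.
Proof. exact: linear0l. Qed.

Lemma ipBl h1 h2 k : ip (h1 - h2) k = ip h1 k - ip h2 k.
Proof. by rewrite ipDl ipNl. Qed.

Lemma ipBr h k1 k2 : ip h (k1 - k2) = ip h k1 - ip h k2.
Proof. by rewrite !(ipC h) ipBl. Qed.

Lemma ipDr h k1 k2 : ip h (k1 + k2) = ip h k1 + ip h k2.
Proof. by rewrite !(ipC h) ipDl. Qed.

Lemma ipZr (a : R) h k : ip h (a *: k) = a * ip h k.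
Proof. by rewrite !(ipC h) ipZl. Qed.

Lemma ip_suml n (E : 'I_n -> H) k : ip (\sum_i E i) k = \sum_i ip (E i) k.
Proof. by apply: (big_morph (fun h => ip h k)) => [a b|]; rewrite (ipDl, ip0l). Qed.

Lemma sqr_normB h k : `|h - k| ^+ 2 = `|h| ^+ 2 + `|k| ^+ 2 - 2 * ip h k.
Proof. rewrite !normE ipBl !ipBr (ipC k h); lra. Qed.

Lemma sqr_normD h k : `|h + k| ^+ 2 = `|h| ^+ 2 + `|k| ^+ 2 + 2 * ip h k.
Proof. rewrite !normE ipDl !ipDr (ipC k h); lra. Qed.

(** This additive form of Cauchy-Schwarz is the one that gets integrated: its right-hand side is
    controlled by the energy alone. *)
Lemma ip_le_sqr_norm h k : `|ip h k| <= (`|h| ^+ 2 + `|k| ^+ 2) / 2.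
Proof.
have := sqr_normB h k; have := sqr_normD h k.
have := sqr_ge0 `|h - k|; have := sqr_ge0 `|h + k|.
rewrite ler_norml; lra.
Qed.

Lemma ip_continuous k : continuous (fun h => ip h k).
Proof.
have lin : linear ((fun h => ip h k) : H -> R^o) by move=> a u v; rewrite ipDl ipZl.
pose f : {linear H -> R^o} :=
  HB.pack ((fun h => ip h k) : H -> R^o) (GRing.isLinear.Build R H R^o *:%R _ lin).
apply: (@bounded_linear_continuous _ _ _ f); apply/ex_bound.
exists ((1 + `|k| ^+ 2) / 2); apply/nbhs_ballP; exists 1 => //= h.
rewrite -ball_normE/= sub0r normrN => h1.
apply: (le_trans (ip_le_sqr_norm _ _)); rewrite ler_pM2r// lerD2r.
by rewrite -(expr1n _ 2) ler_sqr ?nnegrE// ltW.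
Qed.

Section gram_schmidt.
Variable u : nat -> H.

(* [gs_residue n h] is h minus its projection on span (u_0, ..., u_(n-1)). *)
Fixpoint gs_residue (n : nat) (h : H) : H :=
  if n is m.+1 then
    let e := `|gs_residue m (u m)|^-1 *: gs_residue m (u m) in
    gs_residue m h - ip (gs_residue m h) e *: e
  else h.

(* The zero vector when u_n lies in the span of its predecessors. *)
Definition gs_basis n := `|gs_residue n (u n)|^-1 *: gs_residue n (u n).

Local Notation r := gs_residue.
Local Notation g := gs_basis.

Lemma gs_residueS n h : r n.+1 h = r n h - ip (r n h) (g n) *: g n.
Proof. by []. Qed.

(** The vector g_n is either a unit vector or zero; this identity holds in both cases and stands in
    for normalization. *)
Lemma gs_basis_norm n h : ip h (g n) * ip (g n) (g n) = ip h (g n).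
Proof.
rewrite /g; set v := r n (u n).
have [->|v0] := eqVneq v 0; first by rewrite scaler0 (ipC h) !ip0l mul0r.
have nv0 : `|v| != 0 by rewrite normr_eq0.
rewrite -normE normrZ normfV normr_id mulVf// expr1n mulr1//.
Qed.

Lemma gs_residue_ortho n h i : (i < n)%N -> ip (r n h) (g i) = 0.
Proof.
elim: n h => // n IH h; rewrite ltnS leq_eqVlt => /predU1P[->|i_n].
  by rewrite gs_residueS ipBl ipZl gs_basis_norm// subrr.
by rewrite gs_residueS ipBl ipZl IH// /g ipZl IH// !mulr0 subr0.
Qed.

Lemma gs_basis_ortho n i : (i < n)%N -> ip (g n) (g i) = 0.
Proof. by move=> i_n; rewrite {1}/g ipZl gs_residue_ortho// mulr0. Qed.

Lemma gs_residueE n h : r n h = h - \sum_(i < n) ip h (g i) *: g i.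
Proof.
elim: n => [|n IH]; first by rewrite big_ord0 subr0.
rewrite gs_residueS big_ord_recr/= opprD addrA -IH; congr (_ - _ *: _).
rewrite {1}IH ipBl.
suff -> : ip (\sum_(i < n) ip h (g i) *: g i) (g n) = 0 by rewrite subr0.
rewrite ip_suml big1//= => i _.
by rewrite ipZl ipC gs_basis_ortho// mulr0.
Qed.

Lemma gs_residue_basis n h : ip (r n h) (g n) = ip h (g n).
Proof.
rewrite gs_residueE ipBl ip_suml big1 ?subr0//= => i _.
by rewrite ipZl ipC gs_basis_ortho// mulr0.
Qed.

Lemma gs_residue0 n (k : nat) : (k < n)%N -> r n (u k) = 0.
Proof.
elim: n => // n IH; rewrite ltnS leq_eqVlt => /predU1P[->|/IH kn]; last first.
  by rewrite gs_residueS kn ip0l scale0r subr0.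
rewrite gs_residueS /g; set v := r n (u n).
have [->|v0] := eqVneq v 0; first by rewrite !scaler0 subr0.
have nv0 : `|v| != 0 by rewrite normr_eq0.
by rewrite ipZr -normE expr2 mulKf// scalerA divff// scale1r subrr.
Qed.

Lemma gs_residue_pythagoras n h :
  `|r n h| ^+ 2 = `|h| ^+ 2 - \sum_(i < n) ip h (g i) ^+ 2.
Proof.
elim: n => [|n IH]; first by rewrite big_ord0 subr0.
rewrite gs_residueS big_ord_recr/= sqr_normB IH normrZ exprMn [`|ip _ _| ^+ 2]real_normK ?num_real//.
rewrite !(gs_residue_basis, ipZr (ip _ _)) (normE (g n)).
have := gs_basis_norm n h; set a := ip h _; set b := ip _ _ => ab.
by rewrite (expr2 a) -mulrA ab; ring.
Qed.

Lemma gs_bessel n h : \sum_(i < n) ip h (g i) ^+ 2 <= `|h| ^+ 2.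
Proof. by have := gs_residue_pythagoras n h; have := sqr_ge0 `|r n h|; lra. Qed.

(** The difference lies in the span of g_m, ..., g_(n-1), to which the residue r_n h is
    orthogonal. *)
Lemma gs_residueB m n h : (m <= n)%N ->
  `|r m h - r n h| ^+ 2 = `|r m h| ^+ 2 - `|r n h| ^+ 2.
Proof.
move=> mn; rewrite sqr_normB.
suff : ip (r m h - r n h) (r n h) = 0 by rewrite ipBl -normE; lra.
rewrite -(subnKC mn); elim: (n - m)%N => [|j IH]; first by rewrite addn0 subrr ip0l.
have -> : r m h - r (m + j.+1) h =
    (r m h - r (m + j) h) + ip (r (m + j) h) (g (m + j)) *: g (m + j).
  by rewrite addnS gs_residueS opprB addrA addrAC.
rewrite ipDl ipZl (ipC (g (m + j)) (r _ _)).
rewrite (@gs_residue_ortho (m + j.+1)) ?addnS// mulr0 addr0.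
rewrite gs_residueS ipBr IH ipZr sub0r.
suff -> : ip (r m h - r (m + j) h) (g (m + j)) = 0 by rewrite mulr0 oppr0.
rewrite !gs_residueE opprB addrC addrA subrK ipBl.
by rewrite !ip_suml !big1 ?subr0// => i _ /=;
  rewrite ipZl ipC gs_basis_ortho ?mulr0// (leq_trans (ltn_ord i)) ?leq_addr.
Qed.

Hypothesis u_total : forall h, (forall n, ip h (u n) = 0) -> h = 0.

(** The squared norms decrease, hence converge, and by [gs_residueB] the residues are Cauchy. Each
    u_k is orthogonal to r_n h for n > k, so the limit is orthogonal to all u_k and vanishes by
    totality. *)
Lemma gs_residue_cvg0 h : r ^~ h @ \oo --> (0 : H).
Proof.
have dec : nonincreasing_seq (fun n => `|r n h| ^+ 2).
  by move=> m n mn; have := gs_residueB h mn; have := sqr_ge0 `|r m h - r n h|; lra.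
have cv : cvgn (fun n => `|r n h| ^+ 2).
  apply: nonincreasing_is_cvgn => //; exists 0 => _ [n _ <-]; exact: sqr_ge0.
have /cvg_ex[v hv] : cvgn (r ^~ h).
  apply/cauchy_cvgP/cauchy_ballP => e e0; near_simpl.
  have /cauchy_cvgP/cauchy_ballP/(_ (e ^+ 2)) := cv.
  rewrite exprn_gt0// => /(_ isT).
  case=> -[A B] /= [[N1 _ hA] [N2 _ hB]] AB.
  pose N := maxn N1 N2.
  exists ([set n | (N <= n)%N], [set n | (N <= n)%N]) => /=.
    by split; exists N.
  move=> [m n] /= [Nm Nn].
  have key p q : (N <= p)%N -> (p <= q)%N -> `|r p h - r q h| < e.
    move=> Np pq; rewrite -(@ltr_pXn2r _ 2)// ?nnegrE// ?ltW// gs_residueB//.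
    have Ap : A (`|r p h| ^+ 2) by apply: hA => /=; rewrite (leq_trans _ Np)// leq_maxl.
    have Bq : B (`|r q h| ^+ 2).
      by apply: hB => /=; rewrite (leq_trans _ (leq_trans Np pq))// leq_maxr.
    exact: le_lt_trans (ler_norm _) (AB (_, _) (conj Ap Bq)).
  rewrite -ball_normE/=; have [mn|/ltnW nm] := leqP m n; first exact: key.
  by rewrite distrC; exact: key.
suff -> : 0 = v by [].
apply/esym/u_total => k.
have : ip (r n h) (u k) @[n --> \oo] --> ip v (u k).
  exact: (cvg_comp _ _ hv (@ip_continuous (u k) v)).
move/cvg_lim => <-//; apply: lim_near_cst => //.
exists k.+1 => // n /= kn.
have := gs_residue0 kn; rewrite gs_residueE => /eqP; rewrite subr_eq0 => /eqP ->.
rewrite ipC ip_suml big1//= => i _.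
by rewrite ipZl ipC gs_residue_ortho// mulr0.
Unshelve. all: by end_near. Qed.

Lemma gs_parseval h : \sum_(i < n) ip h (g i) ^+ 2 @[n --> \oo] --> `|h| ^+ 2.
Proof.
have -> : (fun n => \sum_(i < n) ip h (g i) ^+ 2) =
          (fun n => `|h| ^+ 2 - `|r n h| * `|r n h|).
  by apply/funext => n; rewrite -expr2 gs_residue_pythagoras subKr.
rewrite -[X in _ --> X]subr0; apply: cvgB; first exact: cvg_cst.
have h0 : `|r n h| @[n --> \oo] --> (0 : R).
  by rewrite -(normr0 H); apply: cvg_norm; exact: gs_residue_cvg0.
by rewrite -[X in _ --> X](mulr0 0); exact: cvgM.
Qed.

End gram_schmidt.

(** Polarization of [gs_parseval]. The bound uniform in n, from Bessel term by term, is what permits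
    dominated convergence in [parseval_integral]. *)
Lemma exists_parseval_sequence (u : nat -> H) :
    (forall h, (forall n, ip h (u n) = 0) -> h = 0) ->
  exists g : nat -> H, forall h k,
    (forall n, `|\sum_(i < n) ip h (g i) * ip k (g i)| <= (`|h| ^+ 2 + `|k| ^+ 2) / 2) /\
    \sum_(i < n) ip h (g i) * ip k (g i) @[n --> \oo] --> ip h k.
Proof.
move=> tot; exists (gs_basis u) => h k; split=> [n|].
  have := gs_bessel u n h; have := gs_bessel u n k => hk hh.
  apply: (le_trans (ler_norm_sum _ _ _)).
  apply: le_trans (_ : _ <= \sum_(i < n) (ip h (gs_basis u i) ^+ 2 + ip k (gs_basis u i) ^+ 2) / 2) _.
    apply: ler_sum => i _; set a := ip h _; set b := ip k _.
    have := sqr_ge0 (a - b); have := sqr_ge0 (a + b); rewrite ler_norml; nra.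
  by rewrite -mulr_suml big_split/= ler_pM2r// lerD.
have -> : (fun n => \sum_(i < n) ip h (gs_basis u i) * ip k (gs_basis u i)) =
    (fun n => 2^-1 * (\sum_(i < n) ip (h + k) (gs_basis u i) ^+ 2 -
      \sum_(i < n) ip h (gs_basis u i) ^+ 2 - \sum_(i < n) ip k (gs_basis u i) ^+ 2)).
  apply/funext => n; rewrite -!sumrB mulr_sumr; apply: eq_bigr => i _.
  by rewrite ipDl; field.
have -> : ip h k = 2^-1 * (`|h + k| ^+ 2 - `|h| ^+ 2 - `|k| ^+ 2).
  by rewrite sqr_normD; field.
by apply: cvgMr; apply: cvgB; [apply: cvgB|]; exact: gs_parseval.
Qed.

End inner_product.

(** * The pairing of H and W *)

Lemma continuous_measurable_realfun (R : realType) (T : ptopologicalType) (f : T -> R) :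
  continuous f -> measurable_fun [set: borel T] (f : borel T -> R).
Proof.
move=> /continuousP cf; apply: (measurability _ (RGenOpens.measurableE R)).
move=> _ [_ [a [b ->] <-]]; rewrite setTI; apply: sub_sigma_algebra.
by apply: cf; exact: interval_open.
Qed.

Section wiener_geometry.
Context {R : realType} (S : abstract_wiener_space R).
Local Notation W := (wiener S).
Local Notation H := (cameron_martin S).
Local Notation ip := (inner S).
Local Notation normE := (@norm_innerE _ S).

(** Orthonormalize the images in H of a norming sequence f_n. It is total: (h, f_n) = f_n (embed h)
    = 0 for all n makes the norm of embed h zero, and the embedding is injective. *)
Lemma exists_wiener_parseval_sequence : exists g : nat -> H, forall h k,
  (forall n, `|\sum_(i < n) ip h (g i) * ip k (g i)| <= (`|h| ^+ 2 + `|k| ^+ 2) / 2) /\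
  \sum_(i < n) ip h (g i) * ip k (g i) @[n --> \oo] --> ip h k.
Proof.
have [f fP] := exists_norming_sequence (@wiener_separable _ S).
apply: (exists_parseval_sequence normE (u := fun n => dual_embed S (f n))) => h h0.
apply: (@embed_inj _ S); rewrite linear0; apply/eqP; rewrite -normr_eq0.
rewrite eq_le normr_ge0 andbT leNgt; apply/negP => /(fP (embed S h)).2[n].
by rewrite subrr -dual_embedE h0 ltxx.
Qed.

Lemma exists_dense_cameron_martin_sequence : exists k : nat -> H,
  forall w e, 0 < e -> exists n, `|embed S (k n) - w| < e.
Proof.
have [D cD dD] := @wiener_separable _ S.
have [d Dd] : exists d : nat -> W, D `<=` range d.
  have /pfcard_geP[D0|/unsquash d] := cD; last by exists d; rewrite (image_eq d).
  have [| |x [_]] := dD setT; [by exists 0|exact: openT|by rewrite D0].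
have /choice[k kP] : forall q : nat * nat,
    exists k : H, `|embed S k - d q.1| < q.2.+1%:R^-1.
  move=> q; have [| |x [dq [h _ hx]]] := @embed_dense _ S (ball (d q.1) q.2.+1%:R^-1).
  - by exists (d q.1); exact: ballxx.
  - exact: ball_open.
  by exists h; move: dq; rewrite -hx -ball_normE/= distrC.
(* Pairs (dense point, precision) are enumerated by their codes; a number that is not a code falls
   back on the pair (0, 0). *)
exists (fun n => k (odflt (0, 0) (unpickle n))%N) => w e e0.
have e2 : 0 < e / 2 by rewrite divr_gt0.
have [| |x [wx Dx]] := dD (ball w (e / 2)).
- by exists w; exact: ballxx.
- exact: ball_open.
have [n _ nx] := Dd x Dx.
have [m] := ltr_add_invr e2; rewrite add0r => me.
exists (pickle (n, m)); rewrite pickleK/=.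
have /= := kP (n, m); rewrite nx; move: wx; rewrite -ball_normE/=.
have := ler_distD x (embed S (k (n, m))) w; rewrite (distrC x w).
by move: (m.+1%:R^-1) me => c; lra.
Qed.

Definition cm_dense : nat -> H := projT1 (cid exists_dense_cameron_martin_sequence).

Lemma cm_denseP w (e : R) : 0 < e -> exists n, `|embed S (cm_dense n) - w| < e.
Proof. by move=> e0; exact: (projT2 (cid exists_dense_cameron_martin_sequence)). Qed.

(* A jointly measurable version of the pairing (h, w) |-> <w, h>, which is exact
   when h comes from W^*: then h = dual_embed e and <w, h> = e w is the limit of
   (h, k) as embed k tends to w along a countable dense family. *)
Definition pairing_term (z : borel H * borel W) (n k : nat) : \bar R :=
  if `|embed S (cm_dense k) - (z.2 : W)| < n.+1%:R^-1 then (ip z.1 (cm_dense k))%:E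
  else -oo%E.

(** An upper limit as the radius 1 / (n + 1) shrinks, written with countable infima and suprema so
    that measurability is immediate; starting both at index 0 discards no term. *)
Definition pairing (z : borel H * borel W) : R :=
  fine (einfs (fun n => esups (pairing_term z n) 0) 0).

Lemma measurable_ip k : measurable_fun [set: borel H] ((fun h => ip h k) : borel H -> R).
Proof. by apply: continuous_measurable_realfun; exact: ip_continuous normE _. Qed.

Lemma measurable_pairing : measurable_fun [set: borel H * borel W] pairing.
Proof.
apply: (measurableT_comp (@fine_measurable R setT measurableT)).
apply: (measurable_fun_einfs (f := fun n z => esups (pairing_term z n) 0)) => n.
apply: (measurable_fun_esups (f := fun k z => pairing_term z n k)) => k.
apply: measurable_fun_ifT => //.
  apply: measurable_fun_ltr => //.
  pose f (w : borel W) : R := `|embed S (cm_dense k) - (w : W)|.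
  have mf : measurable_fun setT f.
    apply: continuous_measurable_realfun => w.
    by apply: cvg_norm; apply: cvgB; [exact: cvg_cst|exact: cvg_id].
  exact: (measurableT_comp mf measurable_snd).
apply/measurable_EFinP.
exact: (measurableT_comp (measurable_ip _) measurable_fst).
Qed.

(** By continuity of e, all terms of a small enough ball are at most e w + d, and by density every
    ball contains a term that is at least e w - d. *)
Lemma pairing_dual_embed (e : dual W) w : pairing (dual_embed S e, w) = e w.
Proof.
rewrite /pairing (_ : einfs _ _ = (e w)%:E)//; apply/eqP; rewrite eq_le.
have cE k : ip (dual_embed S e) (cm_dense k) = e (embed S (cm_dense k)).
  by rewrite ipC dual_embedE.
have near_e (d : R) : 0 < d -> exists2 c : R, 0 < c &
    forall v, `|v - w| < c -> `|e v - e w| < d.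
  move=> d0; have /cvgrPdist_lt/(_ d d0)/nbhs_ballP[c /= c0 hc] := @dual_continuous _ _ e w.
  by exists c => // v vw; rewrite distrC; apply: hc; rewrite -ball_normE/= distrC.
apply/andP; split.
  apply/lee_addgt0Pr => d d0; have [c c0 hc] := near_e _ d0.
  have [n] := ltr_add_invr c0; rewrite add0r => nc.
  apply: (@le_trans _ _ (esups (pairing_term (dual_embed S e, w) n) 0)).
    by apply: ereal_inf_lbound; exists n.
  apply: ge_ereal_sup => _ [k _ <-]; rewrite /pairing_term/=.
  case: ifPn => [kn|_]; last by rewrite leNye.
  rewrite cE -EFinD lee_fin; have := hc _ (lt_trans kn nc).
  by rewrite ltr_norml; lra.
apply: le_ereal_inf_tmp => _ [n _ <-]; apply/lee_addgt0Pr => d d0.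
have [c c0 hc] := near_e _ d0.
have [|k] := @cm_denseP w (Num.min c n.+1%:R^-1); first by rewrite lt_min c0/=.
rewrite lt_min => /andP[kc kn].
apply: (@le_trans _ _ (pairing_term (dual_embed S e, w) n k + d%:E)%E).
  rewrite /pairing_term/= kn cE -EFinD lee_fin; have := hc _ kc.
  by rewrite ltr_norml; lra.
by rewrite leeD2r//; apply: ereal_sup_ubound; exists k.
Qed.

End wiener_geometry.

(** * Laplace transforms determine measures *)

Section same_integral.
Context {R : realType} {d} {T : measurableType d}.
Variables mu nu : {finite_measure set T -> \bar R}.
Implicit Types (f g X : T -> R).

Definition same_integral f :=
  [/\ mu.-integrable setT (EFin \o f), nu.-integrable setT (EFin \o f) &
      (\int[mu]_x (f x)%:E = \int[nu]_x (f x)%:E)%E].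

Lemma same_integralD f g : same_integral f -> same_integral g ->
  same_integral (fun x => f x + g x).
Proof.
move=> [f1 f2 fE] [g1 g2 gE]; split.
- by rewrite (_ : _ \o _ = (EFin \o f) \+ (EFin \o g))//; exact: integrableD.
- by rewrite (_ : _ \o _ = (EFin \o f) \+ (EFin \o g))//; exact: integrableD.
- by rewrite !integralD_EFin// fE gE.
Qed.

Lemma same_integralZ (c : R) f : same_integral f -> same_integral (fun x => c * f x).
Proof.
move=> [f1 f2 fE]; split.
- by rewrite (_ : _ \o _ = (fun x => c%:E * (EFin \o f) x)%E)//; exact: integrableZl.
- by rewrite (_ : _ \o _ = (fun x => c%:E * (EFin \o f) x)%E)//; exact: integrableZl.
- under eq_integral do rewrite EFinM.
  under [RHS]eq_integral do rewrite EFinM.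
  by rewrite !integralZl// fE.
Qed.

Lemma same_integral0 : same_integral (fun=> 0).
Proof. by split; [exact: integrable0|exact: integrable0|rewrite !integral0]. Qed.

Lemma same_integral_sum n (F : 'I_n -> T -> R) : (forall i, same_integral (F i)) ->
  same_integral (fun x => \sum_i F i x).
Proof.
elim: n F => [|n IH] F sF.
  rewrite (_ : (fun _ => _) = fun=> 0); first exact: same_integral0.
  by apply/funext => x; rewrite big_ord0.
rewrite (_ : (fun _ => _) = fun x => \sum_i F (widen_ord (leqnSn n) i) x + F ord_max x).
  by apply: same_integralD => //; exact: IH.
by apply/funext => x; rewrite big_ord_recr.
Qed.

Lemma same_integral_cvg (F : nat -> T -> R) f g :
    (forall n, same_integral (F n)) -> same_integral g ->
    (forall n x, `|F n x| <= g x) -> (forall x, F n x @[n --> \oo] --> f x) ->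
  same_integral f.
Proof.
move=> sF [g1 g2 _] Fg Ff.
have mF n : measurable_fun setT (EFin \o F n) by case: (sF n) => /measurable_int.
have cF x : EFin (F n x) @[n --> \oo] --> (f x)%:E by apply: cvg_EFin; [exact: nearW|exact: Ff].
have mf : measurable_fun setT (EFin \o f).
  by apply: (emeasurable_fun_cvg (fun n => EFin \o F n)) => // x _; exact: cF.
have [|||||f1 _ c1] := @dominated_convergence _ _ _ mu setT measurableT (fun n => EFin \o F n)
  (EFin \o f) (EFin \o g) => //.
- by apply: aeW => x _; exact: cF.
- by apply: aeW => x n _; rewrite lee_fin.
have [|||||f2 _ c2] := @dominated_convergence _ _ _ nu setT measurableT (fun n => EFin \o F n)
  (EFin \o f) (EFin \o g) => //.
- by apply: aeW => x _; exact: cF.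
- by apply: aeW => x n _; rewrite lee_fin.
split=> //; move/cvg_lim : c1 => <-//; move/cvg_lim : c2 => <-//.
by congr (lim (_ @ \oo)); apply/funext => n; case: (sF n).
Qed.

Lemma expRB1_bounds (y : R) : y <= expR y - 1 <= y * expR y.
Proof.
have := expR_ge1Dx y; have := expR_ge1Dx (- y).
rewrite expRN => h1 h2; apply/andP; split; first lra.
have := expR_gt0 y; move: h1 h2; set e := expR y => h1 h2 e0.
have : (1 - y) * e <= 1 by rewrite -ler_pdivlMr// div1r.
by rewrite mulrBl mul1r; lra.
Qed.

Lemma norm_expRB1 (y : R) : `|expR y - 1| <= `|y| * expR `|y|.
Proof.
have /andP[h1 h2] := expRB1_bounds y; rewrite ler_norml; apply/andP; split.
  apply: le_trans h1; rewrite lerNl.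
  have := ler_norm (- y); rewrite normrN => /le_trans; apply.
  by rewrite ler_peMr// -expR0 ler_expR.
apply: (le_trans h2).
apply: le_trans (_ : `|y| * expR y <= _); first by rewrite ler_wpM2r// ?expR_ge0// ler_norm.
by rewrite ler_wpM2l// ler_expR ler_norm.
Qed.

Lemma norm_le_expR (y : R) : `|y| <= expR `|y|.
Proof. by have := expR_ge1Dx `|y|; lra. Qed.

Lemma expR_norm_le (y : R) : expR `|y| <= expR y + expR (- y).
Proof.
have := expR_gt0 y; have := expR_gt0 (- y).
by case: (ger0P y) => _; lra.
Qed.

Section laplace_to_fourier.
Variable X : T -> R.
Hypothesis sX : forall t : R, same_integral (fun x => expR (t * X x)).

(** For c >= 0 this sum majorizes exp (c |X|); it is the dominating function of all the limits
    below. *)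
Lemma same_integral_expR_norm (c : R) :
  same_integral (fun x => expR (c * X x) + expR (- c * X x)).
Proof. exact: same_integralD. Qed.

(* The weight X ^ k.+1 e^(t X) is the limit of the difference quotients
   n (X ^ k e^((t + 1/n) X) - X ^ k e^(t X)). *)
Lemma same_integral_pow_expR k (t : R) :
  same_integral (fun x => X x ^+ k * expR (t * X x)).
Proof.
elim: k t => [|k IH] t.
  by rewrite (_ : (fun _ => _) = fun x => expR (t * X x))//; apply/funext => x; rewrite mul1r.
(* The exponents add up as k for |X|^k <= exp (k |X|), |t| for exp (t X), and 2 for n |exp (X / n) -
   1| <= |X| exp |X| <= exp (2 |X|). *)
pose c : R := k%:R + 2 + `|t|.
have c0 : 0 <= c by rewrite !addr_ge0.
pose y n x := X x / n.+1%:R.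
have n0 n : n.+1%:R != 0 :> R by rewrite pnatr_eq0.
have FE n x : n.+1%:R * (X x ^+ k * expR ((t + n.+1%:R^-1) * X x)) +
     - n.+1%:R * (X x ^+ k * expR (t * X x)) =
   X x ^+ k * expR (t * X x) * (n.+1%:R * (expR (y n x) - 1)).
  by rewrite mulrDl expRD /y (mulrC (X x) _^-1); ring.
apply: (@same_integral_cvg (fun n x => n.+1%:R * (X x ^+ k * expR ((t + n.+1%:R^-1) * X x)) +
     - n.+1%:R * (X x ^+ k * expR (t * X x))) _
   (fun x => expR (c * X x) + expR (- c * X x))).
- by move=> n; apply: same_integralD; apply: same_integralZ; exact: IH.
- exact: same_integral_expR_norm.
- move=> n x; rewrite FE mulNr; apply: le_trans (expR_norm_le _).
  rewrite normrM normrM normrX normrM (ger0_norm (expR_ge0 _)) (ger0_norm (ler0n _ _)).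
  have yX : n.+1%:R * `|y n x| = `|X x|.
    by rewrite normrM normfV (ger0_norm (ler0n _ _)) mulrCA mulfV// mulr1.
  have h1 : n.+1%:R * `|expR (y n x) - 1| <= expR `|X x| * expR `|X x|.
    apply: (@le_trans _ _ (`|X x| * expR `|X x|)); last by rewrite ler_wpM2r ?expR_ge0// norm_le_expR.
    apply: (@le_trans _ _ (n.+1%:R * (`|y n x| * expR `|y n x|))).
      by rewrite ler_wpM2l// norm_expRB1.
    rewrite mulrA yX ler_wpM2l// ler_expR -yX ler_peMl//.
    by rewrite ler1n.
  have h2 : `|X x| ^+ k * expR (t * X x) <= expR (k%:R * `|X x|) * expR (`|t| * `|X x|).
    apply: ler_pM; rewrite ?expR_ge0 ?exprn_ge0//.
      by rewrite expRM_natl lerXn2r ?nnegrE ?expR_ge0// norm_le_expR.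
    by rewrite ler_expR -normrM ler_norm.
  apply: (le_trans (ler_pM _ _ h2 h1)); rewrite ?mulr_ge0 ?exprn_ge0 ?expR_ge0//.
  rewrite -!expRD ler_expR normrM (ger0_norm c0) /c; lra.
- move=> x; under eq_cvg do rewrite FE.
  rewrite exprSr mulrAC; apply: cvgM; first exact: cvg_cst.
  have y0 : y n x @[n --> \oo] --> (0 : R).
    rewrite -(mulr0 (X x)); apply: cvgMr; first exact: cvg_harmonic.
  apply: (@squeeze_cvgr _ _ _ _ (fun=> X x) (fun n => X x * expR (y n x))).
  + apply: nearW => n; have /andP[h1 h2] := expRB1_bounds (y n x).
    have yX : X x = n.+1%:R * y n x by rewrite /y mulrCA mulfV// mulr1.
    by rewrite yX -mulrA !ler_pM2l// h1 h2.
  + exact: cvg_cst.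
  + rewrite -[X in _ --> X]mulr1 -expR0; apply: cvgM; first exact: cvg_cst.
    exact: (cvg_comp _ _ y0 (@continuous_expR R 0)).
Qed.

Lemma series_exp_coeff_le (y : R) n : series (exp_coeff `|y|) n <= expR `|y|.
Proof.
rewrite /expR; apply: nondecreasing_cvgn_le; last exact: is_cvg_series_exp_coeff.
by apply: nondecreasing_series => k _ _; rewrite divr_ge0// exprn_ge0.
Qed.

(** Cosine and sine at once: the partial sums are combinations of moments, available at t = 0, and
    are dominated by the exponential series of |X|. *)
Lemma same_integral_trig (a : nat -> R) (F : R -> R) : (forall n, `|a n| <= 1) ->
    (forall y, series (fun n => a n * y ^+ n / n`!%:R) @ \oo --> F y) ->
  same_integral (fun x => F (X x)).
Proof.
move=> a1 aF.
apply: (@same_integral_cvg (fun n x => series (fun k => a k * X x ^+ k / k`!%:R) n) _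
  (fun x => expR (1 * X x) + expR (- 1 * X x))).
- move=> n; rewrite (_ : (fun _ => _) = fun x => \sum_(k < n) a k / k`!%:R * (X x ^+ k * expR (0 * X x))).
    apply: same_integral_sum => k; apply: same_integralZ; exact: same_integral_pow_expR.
  apply/funext => x; rewrite /series/= big_mkord; apply: eq_bigr => k _.
  by rewrite mul0r expR0 mulr1 mulrAC.
- exact: same_integral_expR_norm.
- move=> n x; rewrite mul1r mulN1r; apply: le_trans (expR_norm_le _).
  apply: le_trans (series_exp_coeff_le _ n).
  apply: (le_trans (ler_norm_sum _ _ _)); apply: ler_sum => k _.
  rewrite !normrM normfV normrX (ger0_norm (ler0n _ _)) /exp_coeff/=.
  by rewrite ler_wpM2r// ler_piMl// exprn_ge0.
- by move=> x; exact: aF.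
Qed.

Lemma same_integral_cos : same_integral (fun x => cos (X x)).
Proof.
apply: (same_integral_trig (a := fun n => (~~ odd n)%:R * (-1) ^+ n./2)) => [n|y].
  by rewrite normrM normrX normrN normr1 expr1n mulr1 normr_nat; case: odd.
by rewrite unlock; exact: is_cvg_series_cos_coeff.
Qed.

Lemma same_integral_sin : same_integral (fun x => sin (X x)).
Proof.
apply: (same_integral_trig (a := fun n => (odd n)%:R * (-1) ^+ n.-1./2)) => [n|y].
  by rewrite normrM normrX normrN normr1 expr1n mulr1 normr_nat; case: odd.
by rewrite unlock; exact: is_cvg_series_sin_coeff.
Qed.

End laplace_to_fourier.
End same_integral.

(** * Polynomials converging on [0, 1] to the indicator of [1/2, 1] *)

Section step_polynomial.
Context {R : realType}.
Implicit Types t : R.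

(** With N = n 2^n, the quantity N t^n = n (2 t)^n tends to 0 for t < 1/2 and to infinity for t >=
    1/2. The factor n settles the endpoint: with exponent 2^n alone the limit at t = 1/2 would be 1
    - 1/e. *)
Definition step_poly (n : nat) t : R := 1 - (1 - t ^+ n) ^+ (n * 2 ^ n).

Lemma step_poly_bounds n t : 0 <= t <= 1 -> 0 <= step_poly n t <= 1.
Proof.
move=> /andP[t0 t1]; rewrite /step_poly.
have tn : 0 <= t ^+ n <= 1 by rewrite exprn_ge0// exprn_ile1.
have : 0 <= (1 - t ^+ n) ^+ (n * 2 ^ n) <= 1 by rewrite exprn_ge0 ?exprn_ile1//; lra.
lra.
Qed.

Lemma bernoulli_inv (s : R) N : 0 <= s <= 1 -> (1 - s) ^+ N * (1 + N%:R * s) <= 1.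
Proof.
move=> s01; elim: N => [|N IH]; first by rewrite expr0 mul0r addr0 mulr1.
apply: le_trans IH; rewrite exprSr -mulrA ler_wpM2l//; first by rewrite exprn_ge0//; lra.
have : 0 <= s * (N%:R * s + s) by rewrite mulr_ge0 ?addr_ge0 ?mulr_ge0//; lra.
by rewrite -natr1; nra.
Qed.

Lemma bernoulli_sub (s : R) N : 0 <= s <= 1 -> 1 - (1 - s) ^+ N <= N%:R * s.
Proof.
move=> s01; elim: N => [|N IH]; first by rewrite expr0 mul0r subrr.
rewrite exprSr -natr1; have : 0 <= (1 - s) ^+ N <= 1.
  by rewrite exprn_ge0 ?exprn_ile1//; lra.
by move: ((1 - s) ^+ N) IH => a; nra.
Qed.

Lemma step_poly_cvg t : 0 <= t <= 1 ->
  step_poly n t @[n --> \oo] --> (if 1 / 2 <= t then 1 else 0 : R).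
Proof.
move=> t01; have tn n : 0 <= t ^+ n <= 1 by rewrite exprn_ge0 ?exprn_ile1//; lra.
have E n : n%:R * (2 * t) ^+ n = (n * 2 ^ n)%N%:R * t ^+ n :> R.
  by rewrite exprMn natrM natrX mulrA.
case: ifPn => [t2|].
  rewrite /step_poly -[X in _ --> X]subr0; apply: cvgB; first exact: cvg_cst.
  apply: (@squeeze_cvgr _ _ _ _ (fun=> 0) (fun n : nat => n.+1%:R^-1)).
  - apply: nearW => n; rewrite exprn_ge0 ?subr_ge0; last by have /andP[] := tn n.
    rewrite /= -[leRHS]div1r ler_pdivlMr// -natr1 (addrC _ 1).
    apply: le_trans (bernoulli_inv (n * 2 ^ n) (tn n)).
    apply: ler_wpM2l; first by rewrite exprn_ge0 ?subr_ge0//; have /andP[] := tn n.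
    rewrite lerD2l -E ler_peMr// exprn_ege1//; lra.
  - exact: cvg_cst.
  - exact: cvg_harmonic.
rewrite -ltNge => t2.
apply: (@squeeze_cvgr _ _ _ _ (fun=> 0) (fun n : nat => n%:R * (2 * t) ^+ n)).
- apply: nearW => n; have /andP[-> _] := step_poly_bounds n t01.
  by rewrite E; exact: bernoulli_sub.
- exact: cvg_cst.
(* Write n (2 t)^n = (n r^n) r^n. The inverse Bernoulli inequality bounds n r^n by 1 / (1 - r),
   leaving a geometric sequence. *)
- pose r := Num.sqrt (2 * t).
  have r0 : 0 <= r by exact: sqrtr_ge0.
  have r2 : r ^+ 2 = 2 * t by rewrite sqr_sqrtr//; lra.
  have r1 : r < 1 by rewrite -(@ltr_pXn2r _ 2)// ?nnegrE// r2 expr1n; lra.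
  have r01 : 0 <= 1 - r <= 1 by lra.
  apply: (@squeeze_cvgr _ _ _ _ (fun=> 0) (geometric (1 - r)^-1 r)).
  + apply: nearW => n; rewrite mulr_ge0 ?exprn_ge0//=; last lra.
    have := bernoulli_inv n r01; rewrite subKr => h.
    rewrite -r2 exprAC expr2 mulrA ler_wpM2r ?exprn_ge0//.
    rewrite -[leRHS]div1r ler_pdivlMr ?subr_gt0//; apply: le_trans h.
    by have := exprn_ge0 n r0; lra.
  + exact: cvg_cst.
  + by apply: cvg_geometric; rewrite ger0_norm.
Qed.

End step_polynomial.

Section dual_combination.
Context {R : realType} {V : normedModType R}.

(** The record [dual] carries no vector space structure; linear combinations are provided
    existentially. *)
Lemma exists_dual_combination (e f : dual V) (a b : R) :
  exists g : dual V, forall w, g w = a * e w + b * f w.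
Proof.
have lin : linear ((fun w => a * e w + b * f w) : V -> R^o).
  by move=> c u v; rewrite !linearP /= /GRing.scale/=; ring.
pose g : {linear V -> R^o} := HB.pack ((fun w => a * e w + b * f w) : V -> R^o)
  (GRing.isLinear.Build R V R^o *:%R _ lin).
have cg : continuous g.
  by move=> w; apply: cvgD; apply: cvgMr; exact: dual_continuous.
by exists (Dual cg).
Qed.

Lemma measurable_dual (f : dual V) : measurable_fun setT ((f : V -> R) : borel V -> R).
Proof. apply: continuous_measurable_realfun; exact: dual_continuous. Qed.

End dual_combination.

(* The bounded functions g with the same integrals against all cos f and sin f
   form a class stable under multiplication by cos f and sin f, hence under
   multiplication by the bounded limits of trigonometric polynomials; these
   include the indicators of half-spaces, then of all Borel sets. *)
Section laplace_unique.
Context {R : realType} {V : normedModType R}.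
Hypothesis sepV : separable V.
Variables mu nu : {finite_measure set (borel V) -> \bar R}.
Hypothesis laplaceE : forall f : dual V, same_integral mu nu (fun w => expR (f w)).
Implicit Types (g s : borel V -> R) (f : dual V).

Definition trig_agree g := [/\ measurable_fun setT g, exists M, forall w, `|g w| <= M &
  forall f, same_integral mu nu (fun w => g w * cos (f w)) /\
            same_integral mu nu (fun w => g w * sin (f w))].

(** Products of multipliers are handled by composition, so multipliers visibly form an algebra,
    closed under bounded limits; the class [trig_agree] has no such evident product rule. *)
Definition trig_multiplier s := forall g, trig_agree g -> trig_agree (fun w => g w * s w).

Lemma dual_zero : exists f, forall w, f w = 0.
Proof.
have [f _] := @exists_norming_functional R V 0.
have [g gE] := exists_dual_combination f f 0 0.
by exists g => w; rewrite gE !mul0r addr0.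
Qed.

Lemma same_integral_cst (c : R) : same_integral mu nu (fun=> c).
Proof.
have [f f0] := dual_zero.
rewrite (_ : (fun=> c) = fun w => c * expR (f w)); last first.
  by apply/funext => w; rewrite f0 expR0 mulr1.
by apply: same_integralZ; exact: laplaceE.
Qed.

Lemma trig_agree1 : trig_agree (fun=> 1).
Proof.
split; [exact: measurable_cst|by exists 1 => w; rewrite normr1|move=> f].
have sf (t : R) : same_integral mu nu (fun w => expR (t * f w)).
  have [g gE] := exists_dual_combination f f t 0.
  rewrite (_ : (fun _ => _) = fun w => expR (g w)); first exact: laplaceE.
  by apply/funext => w; rewrite gE mul0r addr0.
split; under [X in same_integral _ _ X]eq_fun do rewrite mul1r.
  exact: (@same_integral_cos _ _ (borel V) mu nu (f : borel V -> R)).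
exact: (@same_integral_sin _ _ (borel V) mu nu (f : borel V -> R)).
Qed.

Lemma trig_agreeD g h : trig_agree g -> trig_agree h -> trig_agree (fun w => g w + h w).
Proof.
move=> [mg [M gM] sg] [mh [N hN] sh]; split.
- exact: measurable_funD.
- by exists (M + N) => w; apply: (le_trans (ler_normD _ _)); exact: lerD.
- move=> f; split; under [X in same_integral _ _ X]eq_fun do rewrite mulrDl;
    apply: same_integralD; [apply (sg f).1|apply (sh f).1|apply (sg f).2|apply (sh f).2].
Qed.

Lemma trig_agreeZ (c : R) g : trig_agree g -> trig_agree (fun w => c * g w).
Proof.
move=> [mg [M gM] sg]; split.
- exact: measurable_funM.
- by exists (`|c| * M) => w; rewrite normrM ler_wpM2l.
- move=> f; split; under [X in same_integral _ _ X]eq_fun do rewrite -mulrA;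
    apply: same_integralZ; [apply (sg f).1|apply (sg f).2].
Qed.

Lemma trig_agree_cvg (G : nat -> borel V -> R) g (M : R) : (forall n, trig_agree (G n)) ->
  (forall n w, `|G n w| <= M) -> (forall w, G n w @[n --> \oo] --> g w) -> trig_agree g.
Proof.
move=> sG GM Gg; split.
- by apply: (measurable_fun_cvg (h := G)) => [n|w _]; [case: (sG n)|exact: Gg].
- exists M => w; have cw : `|G n w| @[n --> \oo] --> `|g w| by apply: cvg_norm; exact: Gg.
  rewrite -(cvg_lim (@Rhausdorff R) cw); apply: limr_le; first by apply/cvg_ex; exists `|g w|.
  by apply: nearW => n; exact: GM.
- have M0 : 0 <= M by exact: le_trans (GM 0%N 0).
  move=> f; split.
    apply: (@same_integral_cvg _ _ _ _ _ (fun n w => G n w * cos (f w)) _ (fun=> M)).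
    + by move=> n; case: (sG n) => _ _ /(_ f)[].
    + exact: same_integral_cst.
    + by move=> n w; rewrite normrM -(mulr1 M) ler_pM// ler_norml cos_le1 cos_geN1.
    + by move=> w; apply: cvgM; [exact: Gg|exact: cvg_cst].
  apply: (@same_integral_cvg _ _ _ _ _ (fun n w => G n w * sin (f w)) _ (fun=> M)).
  + by move=> n; case: (sG n) => _ _ /(_ f)[].
  + exact: same_integral_cst.
  + by move=> n w; rewrite normrM -(mulr1 M) ler_pM// ler_norml sin_le1 sin_geN1.
  + by move=> w; apply: cvgM; [exact: Gg|exact: cvg_cst].
Qed.

Lemma trig_multiplier_eq s s' : s =1 s' -> trig_multiplier s -> trig_multiplier s'.
Proof. by move=> /funext ->. Qed.

Lemma trig_multiplier_cst (c : R) : trig_multiplier (fun=> c).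
Proof.
move=> g ag; rewrite (_ : (fun _ => _) = fun w => c * g w); first exact: trig_agreeZ.
by apply/funext => w; rewrite mulrC.
Qed.

Lemma trig_multiplierD s1 s2 : trig_multiplier s1 -> trig_multiplier s2 ->
  trig_multiplier (fun w => s1 w + s2 w).
Proof.
move=> h1 h2 g ag; rewrite (_ : (fun _ => _) = fun w => g w * s1 w + g w * s2 w).
  by apply: trig_agreeD; [exact: h1|exact: h2].
by apply/funext => w; rewrite mulrDr.
Qed.

Lemma trig_multiplierM s1 s2 : trig_multiplier s1 -> trig_multiplier s2 ->
  trig_multiplier (fun w => s1 w * s2 w).
Proof.
move=> h1 h2 g ag; rewrite (_ : (fun _ => _) = fun w => (g w * s1 w) * s2 w).
  exact/h2/h1.
by apply/funext => w; rewrite mulrA.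
Qed.

Lemma trig_multiplierB s1 s2 : trig_multiplier s1 -> trig_multiplier s2 ->
  trig_multiplier (fun w => s1 w - s2 w).
Proof.
move=> h1 h2; apply: (@trig_multiplier_eq (fun w => s1 w + (-1) * s2 w)).
  by move=> w; rewrite mulN1r.
apply: trig_multiplierD => //; apply: trig_multiplierM => //.
exact: trig_multiplier_cst.
Qed.

Lemma trig_multiplierX s n : trig_multiplier s -> trig_multiplier (fun w => s w ^+ n).
Proof.
move=> hs; elim: n => [|n IH]; first exact: trig_multiplier_cst.
apply: (@trig_multiplier_eq (fun w => s w * s w ^+ n)).
  by move=> w; rewrite exprS.
exact: trig_multiplierM.
Qed.

Lemma trig_multiplier_cvg (F : nat -> borel V -> R) s (M : R) :
    (forall n, trig_multiplier (F n)) -> (forall n w, `|F n w| <= M) ->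
  (forall w, F n w @[n --> \oo] --> s w) -> trig_multiplier s.
Proof.
move=> hF FM Fs g ag; have [_ [N gN] _] := ag.
apply: (@trig_agree_cvg (fun n w => g w * F n w) _ (N * M)).
- by move=> n; exact: hF.
- by move=> n w; rewrite normrM ler_pM.
- by move=> w; apply: cvgM; [exact: cvg_cst|exact: Fs].
Qed.

(** The product-to-sum formulas reduce a product of trigonometric functions of f and e to ones of f
    + e and f - e, which are again functionals. *)
Lemma trig_multiplier_cos_sin f :
  trig_multiplier (fun w => cos (f w)) /\ trig_multiplier (fun w => sin (f w)).
Proof.
have key (g : borel V -> R) (e : dual V) : trig_agree g ->
  [/\ same_integral mu nu (fun w => g w * cos (f w) * cos (e w)),
     same_integral mu nu (fun w => g w * cos (f w) * sin (e w)),
     same_integral mu nu (fun w => g w * sin (f w) * cos (e w)) &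
     same_integral mu nu (fun w => g w * sin (f w) * sin (e w))].
  move=> [_ _ ag]; have [p pE] := exists_dual_combination f e 1 1.
  have [m mE] := exists_dual_combination f e 1 (- 1).
  have [[pc ps] [mc ms]] := (ag p, ag m).
  have E := (pE, mE, mul1r, mulN1r, cosD, sinD, cosN, sinN).
  split.
  - rewrite (_ : (fun _ => _) = fun w => 2^-1 * (g w * cos (p w)) + 2^-1 * (g w * cos (m w))).
      by apply: same_integralD; exact: same_integralZ.
    by apply/funext => w; rewrite !E; field.
  - rewrite (_ : (fun _ => _) = fun w => 2^-1 * (g w * sin (p w)) + - 2^-1 * (g w * sin (m w))).
      by apply: same_integralD; exact: same_integralZ.
    by apply/funext => w; rewrite !E; field.
  - rewrite (_ : (fun _ => _) = fun w => 2^-1 * (g w * sin (p w)) + 2^-1 * (g w * sin (m w))).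
      by apply: same_integralD; exact: same_integralZ.
    by apply/funext => w; rewrite !E; field.
  - rewrite (_ : (fun _ => _) = fun w => - 2^-1 * (g w * cos (p w)) + 2^-1 * (g w * cos (m w))).
      by apply: same_integralD; exact: same_integralZ.
    by apply/funext => w; rewrite !E; field.
have mf := measurable_dual f.
split=> g ag; have [mg [M gM] _] := ag; split.
- apply: measurable_funM => //; apply: measurableT_comp mf.
  by apply: continuous_measurable_fun; exact: continuous_cos.
- by exists M => w; rewrite normrM -(mulr1 M) ler_pM// ler_norml cos_le1 cos_geN1.
- by move=> e; have [] := key _ e ag.
- apply: measurable_funM => //; apply: measurableT_comp mf.
  by apply: continuous_measurable_fun; exact: continuous_sin.
- by exists M => w; rewrite normrM -(mulr1 M) ler_pM// ler_norml sin_le1 sin_geN1.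
- by move=> e; have [] := key _ e ag.
Qed.

(** Once |f w - a| / N is below pi, the sine of (f w - a) / N has the sign of f w - a. Mapped
    affinely to [0, 1], nonnegativity of the sine becomes t >= 1/2, which [step_poly] detects; then
    N goes to infinity. *)
Lemma trig_multiplier_halfspace f (a : R) :
  trig_multiplier (fun w => if a <= f w then 1 else 0).
Proof.
have ms (N : nat) : trig_multiplier (fun w => sin ((f w - a) / N.+1%:R)).
  have [g gE] := exists_dual_combination f f N.+1%:R^-1 0.
  have [mc msn] := trig_multiplier_cos_sin g.
  apply: (@trig_multiplier_eq (fun w =>
     sin (g w) * cos (- a / N.+1%:R) + cos (g w) * sin (- a / N.+1%:R))).
    by move=> w; rewrite -sinD gE mul0r addr0 mulrC -mulrDl.
  by apply: trig_multiplierD; apply: trig_multiplierM => //; exact: trig_multiplier_cst.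
pose t (N : nat) w := 2^-1 + 2^-1 * sin ((f w - a) / N.+1%:R).
have t01 N w : 0 <= t N w <= 1.
  have := sin_le1 ((f w - a) / N.+1%:R); have := sin_geN1 ((f w - a) / N.+1%:R).
  rewrite /t; lra.
have mt N : trig_multiplier (t N).
  apply: trig_multiplierD; first exact: trig_multiplier_cst.
  by apply: trig_multiplierM => //; exact: trig_multiplier_cst.
have mstep N : trig_multiplier (fun w => if 1 / 2 <= t N w then 1 else 0).
  apply: (@trig_multiplier_cvg (fun n w => step_poly n (t N w)) _ 1).
  - move=> n; apply: trig_multiplierB; first exact: trig_multiplier_cst.
    apply: trig_multiplierX; apply: trig_multiplierB; first exact: trig_multiplier_cst.
    exact: trig_multiplierX.
  - move=> n w; have /andP[h1 h2] := step_poly_bounds n (t01 N w).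
    by rewrite ger0_norm.
  - by move=> w; exact: step_poly_cvg.
apply: (@trig_multiplier_cvg (fun N w => if 1 / 2 <= t N w then 1 else 0) _ 1) => //.
  by move=> n w; case: ifP => _; rewrite ?normr1 ?normr0.
move=> w; apply: cvg_near_cst.
near=> N; rewrite /t.
have piN : `|(f w - a) / N.+1%:R| < pi.
  rewrite normrM normfV (ger0_norm (ler0n _ _)) ltr_pdivrMr// mulrC -ltr_pdivrMr ?pi_gt0//.
  apply: lt_trans (_ : N%:R < _); last by rewrite ltr_nat.
  near: N; exact: nbhs_infty_gtr.
move: piN; rewrite ltr_norml => /andP[p1 p2].
have N0 : 0 < N.+1%:R^-1 :> R by rewrite invr_gt0.
case: (ltP (f w) a) => fa.
  have : sin ((f w - a) / N.+1%:R) < 0.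
    rewrite -[X in sin X]opprK sinN oppr_lt0 sin_gt0_pi// ltrNl p1 andbT oppr_gt0.
    by rewrite pmulr_llt0// subr_lt0.
  by case: ifPn => //; lra.
have : 0 <= sin ((f w - a) / N.+1%:R).
  by rewrite sin_ge0_pi// (ltW p2) andbT mulr_ge0 ?subr_ge0// ltW.
by case: ifPn => //; lra.
Unshelve. all: by end_near. Qed.

Theorem laplace_unique (A : set (borel V)) : measurable A -> mu A = nu A.
Proof.
move=> mA.
pose G : set (set V) := [set A | trig_multiplier (\1_A : borel V -> R)].
have GC A0 : G A0 -> G (~` A0).
  move=> GA; apply: (@trig_multiplier_eq (fun w => 1 - \1_A0 w)).
    by move=> w; rewrite !indicE in_setC; case: (w \in A0); rewrite ?subrr ?subr0.
  by apply: trig_multiplierB => //; exact: trig_multiplier_cst.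
have GI (F : nat -> set V) : (forall n, G (F n)) -> G (\bigcap_n F n).
  move=> GF; apply: (@trig_multiplier_cvg
    (fun n w => \prod_(i < n) (\1_(F i) : borel V -> R) w) _ 1).
  - elim=> [|n IH].
      apply: (@trig_multiplier_eq (fun=> 1)); first by move=> w; rewrite big_ord0.
      exact: trig_multiplier_cst.
    apply: (@trig_multiplier_eq
      (fun w => (\prod_(i < n) (\1_(F i) : borel V -> R) w) * \1_(F n) w)).
      by move=> w; rewrite big_ord_recr.
    by apply: trig_multiplierM; [exact: IH|exact: GF].
  - elim=> [|n IH] w; first by rewrite big_ord0 normr1.
    rewrite big_ord_recr/= normrM mulr_ile1// indicE.
    by case: (w \in F n); rewrite ?normr1 ?normr0.
  - move=> w; apply: cvg_near_cst.
    have [wF|/existsNP[k /not_implyP[_ wk]]] := pselect ((\bigcap_n F n) w).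
      apply: nearW => n; rewrite [RHS]indicE mem_set// big1// => i _.
      by rewrite indicE mem_set//; exact: wF.
    exists k.+1 => // n /= kn; rewrite [RHS]indicE memNset; last by move/(_ k I).
    by rewrite (bigD1 (Ordinal kn))//= indicE memNset// mul0r.
have sG : sigma_algebra setT G.
  split.
  - apply: (@trig_multiplier_eq (fun=> 0)); first by move=> w; rewrite indic0.
    exact: trig_multiplier_cst.
  - by move=> B GB; rewrite setTD; exact: GC.
  - by move=> F GF; rewrite -[X in G X]setCK setC_bigcup; apply/GC/GI => n; exact/GC.
have Gf f (a : R) : G [set w | a <= f w].
  apply: trig_multiplier_eq (trig_multiplier_halfspace f a) => w.
  rewrite indicE; case: ifPn => fa; first by rewrite mem_set.
  by rewrite memNset//=; exact/negP.
(* The multiplier \1_A is applied to the constant 1 and tested against the cosine of the zero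
   functional, which leaves the measure of A. *)
have := dual_generates_borel sepV sG Gf mA => /(_ _ trig_agree1)[_ _].
have [f f0] := dual_zero => /(_ f)[[_ _ +] _].
rewrite (_ : (fun _ => _) = EFin \o \1_A) ?integral_indic// ?setIT//.
by apply/funext => w; rewrite f0 cos0 mulr1 mul1r.
Qed.

End laplace_unique.

(** * The Cameron-Martin formula *)

Section density.
Context {R : realType} {d} {T : measurableType d}.
Local Open Scope ereal_scope.

Lemma ge0_integrable (mu : {measure set T -> \bar R}) (f : T -> \bar R) :
    measurable_fun setT f -> (forall x, 0 <= f x) -> \int[mu]_x f x < +oo ->
  mu.-integrable setT f.
Proof.
move=> mf f0 fy; apply/integrableP; split => //.
by under eq_integral do rewrite gee0_abs//.
Qed.

Section density_measure.
Variables (mu : {measure set T -> \bar R}) (D : T -> R).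
Hypotheses (D0 : forall x, (0 <= D x)%R) (iD : mu.-integrable setT (EFin \o D)).

(** The two proofs are arguments of the definition so that the structure of finite measure can be
    attached to it. *)
Definition density_measure of (forall x, (0 <= D x)%R) &
    mu.-integrable setT (EFin \o D) : set T -> \bar R :=
  fun A => \int[mu]_(x in A) (D x)%:E.

Local Notation nu := (density_measure D0 iD).

Let density0 : nu set0 = 0.
Proof. exact: integral_set0. Qed.

Let density_ge0 A : 0 <= nu A.
Proof. by apply: integral_ge0 => x _; rewrite lee_fin. Qed.

Let density_sigma_additive : semi_sigma_additive nu.
Proof.
move=> /= A mA tA mUA; rewrite /density_measure integral_bigcup//=; last first.
  exact: integrableS iD.
by apply: is_cvg_ereal_nneg_natsum_cond => n _ _; exact: density_ge0.
Qed.

HB.instance Definition _ :=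
  isMeasure.Build _ _ _ nu density0 density_ge0 density_sigma_additive.

Let density_finite : fin_num_fun nu.
Proof.
move=> A mA; apply: integrable_fin_num => //.
exact: integrableS iD.
Qed.

HB.instance Definition _ := Measure_isFinite.Build _ _ _ nu density_finite.

End density_measure.

(** D and the Radon-Nikodym derivative have equal integrals over all measurable sets, so they agree
    almost everywhere and the change of variables for the latter transfers to D. *)
Lemma integral_density (mu : {sigma_finite_measure set T -> \bar R})
    (nu : {finite_measure set T -> \bar R}) (D : T -> R) :
    measurable_fun setT D -> (forall x, (0 <= D x)%R) ->
    (forall A, measurable A -> nu A = \int[mu]_(x in A) (D x)%:E) ->
  forall f, measurable_fun setT f -> (forall x, 0 <= f x) ->
    \int[nu]_x f x = \int[mu]_x (f x * (D x)%:E).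
Proof.
move=> mD D0 nuE f mf f0.
have mDE : measurable_fun setT (EFin \o D) by exact/measurable_EFinP.
have iD : mu.-integrable setT (EFin \o D).
  apply: ge0_integrable => //.
  by rewrite -nuE// ltey_eq fin_num_measure.
have numu : nu `<< mu.
  apply/null_content_dominatesP => A mA A0; rewrite nuE//.
  apply: null_set_integral => //; exact: measurable_funTS.
rewrite -(Radon_Nikodym_SigmaFinite.change_of_variables numu f0 measurableT mf).
apply: ae_eq_integral => //.
- apply: emeasurable_funM => //.
  exact: measurable_int (Radon_Nikodym_SigmaFinite.f_integrable numu).
- exact: emeasurable_funM.
- apply: ae_eqe_mul2l; apply: integral_ae_eq => //.
    exact: Radon_Nikodym_SigmaFinite.f_integrable.
  by move=> E _ mE; rewrite -nuE// -Radon_Nikodym_SigmaFinite.f_integral.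
Qed.

End density.

Section gaussian.
Context {R : realType}.
Local Open Scope ereal_scope.

Lemma normal_prob_laplace (s : R) : s != 0%R ->
  \int[normal_prob 0 s]_x (expR x)%:E = (expR (s ^+ 2 / 2))%:E.
Proof.
move=> s0.
have mE : measurable_fun setT (EFin \o @expR R) by apply/measurable_EFinP; exact: measurable_expR.
have E0 x : 0 <= (EFin \o @expR R) x by rewrite lee_fin expR_ge0.
have nE A : measurable A -> normal_prob 0 s A =
  \int[lebesgue_measure]_(x in A) (normal_pdf 0 s x)%:E by [].
rewrite (@integral_density R _ (measurableTypeR R) lebesgue_measure (normal_prob 0 s)
  (normal_pdf 0 s) (measurable_normal_pdf 0 s) (normal_pdf_ge0 0 s) nE (EFin \o @expR R) mE E0).
(* Completing the square: exp x times the density of N(0, s^2) is exp (s^2 / 2) times that of N(s^2,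
   s^2). *)
transitivity (\int[lebesgue_measure]_x
    ((expR (s ^+ 2 / 2))%:E * (normal_pdf (s ^+ 2) s x)%:E)).
  apply: eq_integral => x _; rewrite -!EFinM; congr EFin.
  rewrite !normal_pdfE// mulrCA [RHS]mulrCA; congr *%R.
  rewrite /normal_fun -!expRD; congr expR; field.
  by rewrite ?sqrf_eq0 s0.
rewrite ge0_integralZl//.
- by rewrite integral_normal_pdf mule1.
- by apply/measurable_EFinP; exact: measurable_normal_pdf.
- by move=> x _; rewrite lee_fin normal_pdf_ge0.
Qed.

Variable S : abstract_wiener_space R.
Local Notation W := (wiener S).
Local Notation H := (cameron_martin S).
Local Notation gamma := (wiener_measure S).
Local Notation ip := (inner S).
Local Notation normE := (@norm_innerE _ S).

(** Linearity of [dual_embed] is not a field of the structure; it follows from the representation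
    property, which makes the difference of the two sides orthogonal to itself. *)
Lemma dual_embed_combination (e f g : dual W) (a b : R) :
  (forall w, g w = a * e w + b * f w)%R ->
  dual_embed S g = (a *: dual_embed S e + b *: dual_embed S f)%R.
Proof.
move=> gE; apply/eqP; rewrite -subr_eq0 -normr_eq0 -sqrf_eq0 normE; apply/eqP.
set k := (_ - _)%R; rewrite {2}/k ipBr ipDr !ipZr.
by rewrite !(@dual_embedE _ S) gE subrr.
Qed.

Lemma wiener_laplace (e : dual W) :
  \int[gamma]_w (expR (e w))%:E = (expR (`|dual_embed S e| ^+ 2 / 2))%:E.
Proof.
have mX : @measurable_fun _ _ (borel W) (measurableTypeR R) setT (e : W -> R).
  exact: measurable_dual.
pose X : {RV gamma >-> measurableTypeR R} :=
  HB.pack ((e : W -> R) : borel W -> R) (isMeasurableFun.Build _ _ _ _ _ mX).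
have mE : measurable_fun setT (EFin \o @expR R) by apply/measurable_EFinP; exact: measurable_expR.
transitivity (\int[distribution gamma X]_y (expR y)%:E).
  by rewrite ge0_integral_distribution// => y; rewrite lee_fin expR_ge0.
have XE A : measurable A -> distribution gamma X A = gaussian_law 0 `|dual_embed S e|%R A.
  by move=> mA; exact: wiener_gaussian.
(* In the degenerate case the Gaussian law is the Dirac mass at 0, and both sides are 1. *)
have [s0|s0] := eqVneq (`|dual_embed S e|%R : R) 0%R.
  rewrite s0 expr0n mul0r expR0.
  rewrite (@eq_measure_integral _ (measurableTypeR R) R setT \d_(0%R : measurableTypeR R)); last first.
    by move=> A mA _; apply: etrans (XE _ mA) _; rewrite /gaussian_law s0 eqxx.
  by rewrite integral_dirac//= diracT mul1e expR0.
rewrite -(normal_prob_laplace s0); apply: eq_measure_integral => A mA _.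
by apply: etrans (XE _ mA) _; rewrite /gaussian_law (negbTE s0).
Qed.

Lemma integrable_wiener_laplace (e : dual W) :
  gamma.-integrable setT (fun w => (expR (e w))%:E).
Proof.
apply: ge0_integrable.
- apply/measurable_EFinP; apply: (measurableT_comp (@measurable_expR R)).
  exact: measurable_dual.
- by move=> w; rewrite lee_fin expR_ge0.
- by rewrite wiener_laplace ltry.
Qed.

Definition cm_density (r : R) (e : dual W) (w : borel W) : R :=
  expR (r * e w - r ^+ 2 * `|dual_embed S e| ^+ 2 / 2).

Lemma measurable_cm_density r e :
  measurable_fun setT (cm_density r e : borel W -> R).
Proof.
apply: (measurableT_comp (@measurable_expR R)); apply: measurable_funB => //.
apply: measurable_funM => //; exact: measurable_dual.
Qed.

Lemma cm_density_laplace (r : R) (e f : dual W) :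
  \int[gamma]_w (expR (f w) * cm_density r e w)%:E =
  (expR (`|dual_embed S f| ^+ 2 / 2 + r * ip (dual_embed S e) (dual_embed S f)))%:E.
Proof.
have [g gE] := exists_dual_combination e f r 1.
under eq_integral => w _.
  rewrite /cm_density -expRD addrA (addrC (f w)) -[f w]mul1r -gE expRD mulrC EFinM.
  over.
rewrite integralZl ?integrable_wiener_laplace//.
rewrite wiener_laplace -EFinM -expRD (dual_embed_combination gE) scale1r.
by rewrite (sqr_normD normE) normrZ exprMn real_normK ?num_real// ipZl; congr (expR _)%:E; field.
Qed.

(** The image of gamma under the translation and the measure with density [cm_density r e] have the
    same Laplace transform, hence coincide by [laplace_unique]. *)
Theorem cameron_martin_formula (r : R) (e : dual W) (F : borel W -> \bar R) :
    measurable_fun setT F -> (forall w, 0 <= F w) ->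
  \int[gamma]_w F (r *: embed S (dual_embed S e) + w)%R =
  \int[gamma]_w (F w * (cm_density r e w)%:E).
Proof.
move=> mF F0; set h := dual_embed S e.
have D0 (w : borel W) : (0 <= cm_density r e w)%R by exact: expR_ge0.
have iD : gamma.-integrable setT (EFin \o (cm_density r e : borel W -> R)).
  (* The total mass is the Laplace transform at the zero functional. *)
  have [f f0] := @dual_zero R W.
  apply: ge0_integrable => [|w|]; first by apply/measurable_EFinP; exact: measurable_cm_density.
    by rewrite lee_fin.
  suff -> : \int[gamma]_w (EFin \o cm_density r e) w =
            \int[gamma]_w (expR (f w) * cm_density r e w)%:E.
    by rewrite cm_density_laplace ltry.
  by apply: eq_integral => w _; rewrite f0 expR0 mul1r.
pose theta (w : borel W) : borel W := (r *: embed S h + w)%R.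
have mtheta : measurable_fun setT theta.
  apply: continuous_borel_measurable => w.
  by apply: cvgD; [exact: cvg_cst|exact: cvg_id].
pose X : {mfun borel W >-> borel W} := HB.pack theta (isMeasurableFun.Build _ _ _ _ _ mtheta).
pose mu1 : probability (borel W) R := distribution gamma X.
pose nu1 := density_measure D0 iD : {finite_measure set (borel W) -> \bar R}.
have nu1E G : measurable_fun setT G -> (forall w, 0 <= G w) ->
    \int[nu1]_w G w = \int[gamma]_w (G w * (cm_density r e w)%:E).
  apply: (@integral_density _ _ _ gamma nu1 (cm_density r e)) => //.
  exact: measurable_cm_density.
have mu1E G : measurable_fun setT G -> (forall w, 0 <= G w) ->
    \int[mu1]_w G w = \int[gamma]_w G (r *: embed S h + w)%R.
  by move=> mG G0; rewrite ge0_integral_distribution.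
rewrite -nu1E// -mu1E//; apply: eq_measure_integral => A mA _.
apply: (laplace_unique (@wiener_separable _ S)) => // f.
have mf : measurable_fun setT (fun w : borel W => (expR (f w))%:E).
  apply/measurable_EFinP; apply: (measurableT_comp (@measurable_expR R)).
  exact: measurable_dual.
have f0 w : 0 <= (expR (f w))%:E by rewrite lee_fin expR_ge0.
have L1 : \int[mu1]_w (expR (f w))%:E =
    (expR (`|dual_embed S f| ^+ 2 / 2 + r * ip h (dual_embed S f)))%:E.
  rewrite mu1E//; under eq_integral do rewrite linearD linearZ/= expRD EFinM.
  rewrite integralZl//; last exact: integrable_wiener_laplace.
  by rewrite wiener_laplace -EFinM -expRD -(@dual_embedE _ S) addrC.
have L2 : \int[nu1]_w (expR (f w))%:E =
    (expR (`|dual_embed S f| ^+ 2 / 2 + r * ip h (dual_embed S f)))%:E.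
  by rewrite nu1E//; under eq_integral do rewrite -EFinM; exact: cm_density_laplace.
split; [| |by rewrite L1 L2].
  by apply: ge0_integrable => //; rewrite L1 ltry.
by apply: ge0_integrable => //; rewrite L2 ltry.
Qed.

End gaussian.

(** * Likelihood and output density *)

Section ae_tools.
Context {R : realType} {d} {T : measurableType d} (mu : {measure set T -> \bar R}).

(** Replacing g by max (f, g), which is equal to it almost everywhere, turns the almost sure
    inequality into a pointwise one. *)
Lemma ae_le_integral (f g : T -> R) :
    mu.-integrable setT (EFin \o f) -> mu.-integrable setT (EFin \o g) ->
    {ae mu, forall x, f x <= g x} ->
  (\int[mu]_x (f x)%:E <= \int[mu]_x (g x)%:E)%E.
Proof.
move=> fi gi fg; have mf := measurable_int _ fi; have mg := measurable_int _ gi.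
have mm : measurable_fun setT (fun x => maxe (f x)%:E (g x)%:E).
  exact: measurable_maxe.
have gm : ae_eq mu setT (EFin \o g) (fun x => maxe (f x)%:E (g x)%:E).
  apply: filterS fg => x fg _ /=; by rewrite -EFin_max max_r.
have -> : (\int[mu]_x (g x)%:E = \int[mu]_x maxe (f x)%:E (g x)%:E)%E.
  exact: ae_eq_integral.
apply: le_integral => //.
- apply/integrableP; split=> //; move/integrableP : (gi) => [_].
  have -> // : (\int[mu]_x `|(g x)%:E| = \int[mu]_x `|maxe (f x)%:E (g x)%:E|)%E.
  apply: ae_eq_integral => //; [exact: measurableT_comp|exact: measurableT_comp|].
  by apply: filterS gm => x /(_ I) gE _; exact: (congr1 abse gE).
- by move=> x _; rewrite le_max lexx.
Qed.

Lemma ge0_ae_eq_integralT (f g : T -> \bar R) :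
    measurable_fun setT f -> measurable_fun setT g ->
    (forall x, 0 <= f x)%E -> (forall x, 0 <= g x)%E ->
    {ae mu, forall x, f x = g x} ->
  (\int[mu]_x f x = \int[mu]_x g x)%E.
Proof.
move=> mf mg f0 g0 fg; apply: ge0_ae_eq_integral => //.
by apply: filterS fg => x fg _.
Qed.

Lemma ae_impl (F G : T -> Prop) : {ae mu, forall x, F x} ->
  (forall x, F x -> G x) -> {ae mu, forall x, G x}.
Proof. by move=> h FG; apply: filterS h. Qed.

Lemma ae_and (F G : T -> Prop) : {ae mu, forall x, F x} -> {ae mu, forall x, G x} ->
  {ae mu, forall x, F x /\ G x}.
Proof. exact: filterI. Qed.

End ae_tools.

Section ae_product.
Context {R : realType} {d1 d2} {T1 : measurableType d1} {T2 : measurableType d2}.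
Variables (m1 : probability T1 R) (m2 : probability T2 R).

Lemma ae_fst (G : T1 -> Prop) : {ae m1, forall x, G x} -> {ae (m1 \x m2)%E, forall z, G z.1}.
Proof.
move=> [N [mN N0 GN]]; exists (N `*` setT); split.
- exact: measurableX.
- by rewrite product_measure1E// [X in (X * _)%E]N0 mul0e.
- by move=> z /= /GN.
Qed.

Lemma ae_snd (G : T2 -> Prop) : {ae m2, forall x, G x} -> {ae (m1 \x m2)%E, forall z, G z.2}.
Proof.
move=> [N [mN N0 GN]]; exists (setT `*` N); split.
- exact: measurableX.
- by rewrite product_measure1E// [X in (_ * X)%E]N0 mule0.
- by move=> z /= /GN.
Qed.

End ae_product.

Section channel.
Context {R : realType} (S : abstract_wiener_space R).
Local Notation W := (wiener S).
Local Notation H := (cameron_martin S).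
Local Notation ip := (inner S).
Local Notation normE := (@norm_innerE _ S).
Variable muX : probability (borel H) R.
Local Notation gamma := (wiener_measure S).
Local Notation P := (channel_prob muX).

Lemma measurable_sqr_norm : measurable_fun setT ((fun h : H => `|h| ^+ 2) : borel H -> R).
Proof.
apply: measurable_funX; apply: continuous_measurable_realfun; exact: norm_continuous.
Qed.

(* The Borel sets of H * H need not lie in the product sigma-algebra a priori,
   hence the detour through a Parseval sequence. *)
Lemma measurable_ip2 :
  measurable_fun setT ((fun z => ip z.1 z.2) : borel H * borel H -> R).
Proof.
have [g gP] := exists_wiener_parseval_sequence S.
apply: (measurable_fun_cvg (h := fun n (z : borel H * borel H) =>
    \sum_(i < n) ip z.1 (g i) * ip z.2 (g i))) => [n|z _]; last exact: (gP z.1 z.2).2.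
apply: measurable_sum => i; apply: measurable_funM.
  exact: (measurableT_comp (measurable_ip (g i)) measurable_fst).
exact: (measurableT_comp (measurable_ip (g i)) measurable_snd).
Qed.

(* Density of the law of rho x + w with respect to that of w, given x. *)
Definition likelihood (r : R) (z : borel H * borel W) : R :=
  expR (r * pairing z - r ^+ 2 * `|z.1 : H| ^+ 2 / 2).

Local Notation lik := likelihood.

Lemma likelihood_gt0 r z : 0 < lik r z. Proof. exact: expR_gt0. Qed.

Lemma likelihood_ge0 r z : 0 <= lik r z. Proof. exact: expR_ge0. Qed.

Lemma likelihood0 z : lik 0 z = 1.
Proof. by rewrite /lik mul0r expr0n !mul0r subrr expR0. Qed.

Lemma measurable_likelihood r : measurable_fun setT (lik r).
Proof.
apply: (measurableT_comp (@measurable_expR R)); apply: measurable_funB.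
  by apply: measurable_funM => //; exact: measurable_pairing.
apply: measurable_funM => //; apply: measurable_funM => //.
exact: (measurableT_comp measurable_sqr_norm measurable_fst).
Qed.

Lemma likelihood_dual_embed r (e : dual W) w :
  lik r (dual_embed S e, w) = cm_density r e w.
Proof. by rewrite /lik pairing_dual_embed. Qed.

Lemma measurable_channel r :
  measurable_fun setT ((fun z => (z.1, output S r z)) : borel H * borel W -> borel H * borel W).
Proof.
by apply: measurable_fun_pair; [exact: measurable_fst|exact: measurable_output].
Qed.

Hypothesis x_dual : {ae muX, forall h, range (dual_embed S) h}.

(** The law of (x, y) has density [lik r] with respect to P: by Tonelli, it is enough to apply the
    Cameron-Martin formula to each fixed input in the range of [dual_embed], which carries almost
    all inputs. *)
Lemma channel_transfer r (F : borel H * borel W -> \bar R) :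
    measurable_fun setT F -> (forall z, 0 <= F z)%E ->
  (\int[P]_z F (z.1, output S r z) = \int[P]_z (F z * (lik r z)%:E))%E.
Proof.
move=> mF F0.
have mF1 : measurable_fun setT (fun z => F (z.1, output S r z)).
  exact: (measurableT_comp mF (measurable_channel r)).
have mF2 : measurable_fun setT (fun z => F z * (lik r z)%:E)%E.
  apply: emeasurable_funM => //; apply/measurable_EFinP; exact: measurable_likelihood.
have F20 z : (0 <= F z * (lik r z)%:E)%E by rewrite mule_ge0// lee_fin likelihood_ge0.
rewrite (fubini_tonelli1 _ mF1 (fun z => F0 _)) [RHS](fubini_tonelli1 _ mF2 F20).
apply: ge0_ae_eq_integralT.
- exact: measurable_fun_fubini_tonelli_F.
- exact: measurable_fun_fubini_tonelli_F.
- by move=> h; apply: integral_ge0 => w _.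
- by move=> h; apply: integral_ge0 => w _.
apply: (ae_impl x_dual) => _ [e _ <-]; rewrite /fubini_F.
have mFe : measurable_fun setT (fun w => F (dual_embed S e, w)).
  exact: (measurableT_comp mF (pair1_measurable _)).
have Fe0 w : (0 <= F (dual_embed S e, w))%E by exact: F0.
apply: etrans (@cameron_martin_formula _ S r e _ mFe Fe0) _.
by apply: eq_integral => w _; rewrite likelihood_dual_embed.
Qed.

(** By [channel_transfer] the law of (x, y) is dominated by P, so null sets pull back to null
    sets. *)
Lemma ae_channel r (G : borel H * borel W -> Prop) :
  {ae P, forall z, G z} -> {ae P, forall z, G (z.1, output S r z)}.
Proof.
move=> [N [mN N0 GN]].
exists ((fun z => (z.1, output S r z)) @^-1` N); split.
- by rewrite -[X in measurable X]setTI; exact: measurable_channel.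
- suff : (\int[P]_z (\1_((fun z => (z.1, output S r z)) @^-1` N) z)%:E = 0)%E.
    rewrite integral_indic// ?setIT//.
    by rewrite -[X in measurable X]setTI; exact: measurable_channel.
  have mI : measurable_fun setT (fun z => (\1_N z)%:E : \bar R).
    by apply/measurable_EFinP; exact: measurable_indic.
  apply: (etrans (@channel_transfer r (fun z => (\1_N z)%:E) mI _)) => //.
  transitivity (\int[P]_z (cst 0%E z))%E; last by rewrite integral0.
  apply: ge0_ae_eq_integralT => //.
  + apply: emeasurable_funM; first by apply/measurable_EFinP; exact: measurable_indic.
    by apply/measurable_EFinP; exact: measurable_likelihood.
  + by move=> z; rewrite mule_ge0// lee_fin likelihood_ge0.
  exists N; split => // z /= h; apply: contrapT => Nz; apply: h.
  by rewrite indicE memNset// mul0e.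
- by move=> z /= /GN.
Qed.

(** The density q of the output law with respect to gamma, extended real because it is known to be
    finite only almost everywhere. *)
Definition evidence (r : R) (w : borel W) : \bar R := (\int[muX]_h (lik r (h, w))%:E)%E.

Local Notation Q := evidence.

Lemma measurable_evidence r : measurable_fun setT (Q r).
Proof.
apply: (@measurable_fun_fubini_tonelli_G _ _ _ _ _ muX (EFin \o lik r)).
- by apply/measurable_EFinP; exact: measurable_likelihood.
- by move=> z; rewrite lee_fin likelihood_ge0.
Qed.

Lemma evidence_gt0 r w : (0 < Q r w)%E.
Proof.
have mL : measurable_fun setT (fun h => (lik r (h, w))%:E).
  apply/measurable_EFinP.
  exact: (measurableT_comp (measurable_likelihood r) (pair2_measurable w)).
rewrite lt_neqAle integral_ge0 ?andbT; last by move=> h _; rewrite lee_fin likelihood_ge0.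
apply/negP => /eqP/esym Q0.
have : ae_eq muX setT (fun h => (lik r (h, w))%:E) (cst 0%E).
  apply/ae_eq_integral_abs => //; rewrite -Q0; apply: eq_integral => h _.
  by rewrite gee0_abs// lee_fin likelihood_ge0.
move=> [N [mN N0 hN]].
have NT : N = setT.
  apply/seteqP; split=> // h _; apply: hN => /= /(_ I)[] /eqP.
  by rewrite gt_eqF// likelihood_gt0.
have /eqP : (1 = 0 :> \bar R)%E by rewrite -(probability_setT muX) -NT; exact: N0.
by rewrite onee_eq0.
Qed.

Lemma evidence_ge0 r w : (0 <= Q r w)%E. Proof. exact/ltW/evidence_gt0. Qed.

Lemma evidence0 w : Q 0 w = 1%E.
Proof.
rewrite /evidence; under eq_integral do rewrite likelihood0.
by rewrite integral_cst// mul1e; exact: probability_setT.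
Qed.

Lemma integral_evidence r (F : borel W -> \bar R) : measurable_fun setT F ->
    (forall w, 0 <= F w)%E ->
  (\int[P]_z (F z.2 * (lik r z)%:E) = \int[gamma]_w (F w * Q r w))%E.
Proof.
move=> mF F0; rewrite fubini_tonelli2//; last 2 first.
- apply: emeasurable_funM; first exact: (measurableT_comp mF measurable_snd).
  by apply/measurable_EFinP; exact: measurable_likelihood.
- by move=> z; rewrite mule_ge0// lee_fin likelihood_ge0.
apply: eq_integral => w _; rewrite /fubini_G /= ge0_integralZl//.
- apply/measurable_EFinP.
  exact: (measurableT_comp (measurable_likelihood r) (pair2_measurable w)).
- by move=> h _; rewrite lee_fin likelihood_ge0.
Qed.

Lemma integral_output r (F : borel W -> \bar R) : measurable_fun setT F ->
    (forall w, 0 <= F w)%E ->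
  (\int[P]_z F (output S r z) = \int[gamma]_w (F w * Q r w))%E.
Proof.
move=> mF F0; rewrite (@channel_transfer r (fun z => F z.2))//.
  exact: integral_evidence.
exact: (measurableT_comp mF measurable_snd).
Qed.

Lemma integral_evidence1 r : (\int[gamma]_w Q r w = 1)%E.
Proof.
transitivity (\int[P]_z (cst 1%E z))%E; last first.
  by rewrite integral_cst// mul1e; exact: probability_setT.
apply: etrans (esym (@integral_output r (cst 1%E) _ _)) => //.
by apply: eq_integral => w _; rewrite mul1e.
Qed.

Lemma evidence_fin_ae r : {ae gamma, forall w, Q r w \is a fin_num}.
Proof.
have iQ : gamma.-integrable setT (Q r).
  apply: ge0_integrable; [exact: measurable_evidence|exact: evidence_ge0|].
  by rewrite integral_evidence1 ltry.
by apply: (ae_impl (integrable_ae measurableT iQ)) => w; apply.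
Qed.

(* [fine] makes the evidence 0 on the null set where it is infinite. *)
Definition rev_evidence (r : R) (w : borel W) : R := fine (Q r w).

Local Notation q := rev_evidence.

Lemma rev_evidence_ge0 r w : 0 <= q r w.
Proof. by rewrite fine_ge0// evidence_ge0. Qed.

Lemma measurable_rev_evidence r : measurable_fun setT (q r).
Proof. exact: (measurableT_comp (@fine_measurable R setT measurableT) (measurable_evidence r)). Qed.

Lemma rev_evidence0 w : q 0 w = 1.
Proof. by rewrite /q evidence0. Qed.

Lemma rev_evidence_ae r : {ae gamma, forall w, Q r w = (q r w)%:E /\ 0 < q r w}.
Proof.
apply: (ae_impl (evidence_fin_ae r)) => w Qw; rewrite /q fineK//; split=> //.
by rewrite fine_gt0// evidence_gt0/= ltey_eq Qw.
Qed.

Lemma rev_evidence_output_ae r r' :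
  {ae P, forall z, Q r (output S r' z) = (q r (output S r' z))%:E /\ 0 < q r (output S r' z)}.
Proof.
apply: (@ae_channel r' (fun z => Q r z.2 = (q r z.2)%:E /\ 0 < q r z.2)).
exact: (ae_snd muX (rev_evidence_ae r)).
Qed.

End channel.

(** * Replicas *)

Section integral_is.
Context {R : realType} {d} {T : measurableType d} (mu : {measure set T -> \bar R}).
Implicit Types f g : T -> R.

(** Integrability travels with the value, so that linear combinations and comparisons of integrals
    compose without side conditions. *)
Definition integral_is f (a : R) :=
  mu.-integrable setT (EFin \o f) /\ (\int[mu]_x (f x)%:E = a%:E)%E.

Lemma integral_isD f g a b : integral_is f a -> integral_is g b ->
  integral_is (fun x => f x + g x) (a + b).
Proof.
move=> [fi fE] [gi gE]; split; last by rewrite integralD_EFin// fE gE.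
by rewrite (_ : _ \o _ = (EFin \o f) \+ (EFin \o g))//; exact: integrableD.
Qed.

Lemma integral_isZ c f a : integral_is f a -> integral_is (fun x => c * f x) (c * a).
Proof.
move=> [fi fE]; split.
  by rewrite (_ : _ \o _ = (fun x => c%:E * (EFin \o f) x)%E)//; exact: integrableZl.
by under eq_integral do rewrite EFinM; rewrite integralZl// fE.
Qed.

Lemma integral_isB f g a b : integral_is f a -> integral_is g b ->
  integral_is (fun x => f x - g x) (a - b).
Proof.
move=> hf hg; rewrite -mulN1r (_ : (fun _ => _) = fun x => f x + (-1) * g x).
  by apply: integral_isD => //; exact: integral_isZ.
by apply/funext => x; rewrite mulN1r.
Qed.

Lemma integral_is_ge0 f a : measurable_fun setT f -> (forall x, 0 <= f x) ->
  (\int[mu]_x (f x)%:E = a%:E)%E -> integral_is f a.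
Proof.
move=> mf f0 fE; split=> //; apply: ge0_integrable.
- exact/measurable_EFinP.
- by move=> x; rewrite lee_fin.
- by rewrite [X in (X < _)%E](_ : _ = a%:E) ?ltry.
Qed.

Lemma integral_is_le f g a b : integral_is f a -> integral_is g b ->
  {ae mu, forall x, f x <= g x} -> a <= b.
Proof.
by move=> [fi fE] [gi gE] fg; rewrite -lee_fin -fE -gE; exact: ae_le_integral.
Qed.

Lemma integral_is_eq f g a : f =1 g -> integral_is f a -> integral_is g a.
Proof. by move=> /funext ->. Qed.

Lemma integral_is_ae f g a : measurable_fun setT g -> {ae mu, forall x, f x = g x} ->
  integral_is f a -> integral_is g a.
Proof.
move=> mg fg [fi fE]; have mf := measurable_int _ fi.
have mgE : measurable_fun setT (EFin \o g) by exact/measurable_EFinP.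
split.
  apply/integrableP; split => //; move/integrableP : (fi) => [_].
  have -> // : (\int[mu]_x `|(EFin \o f) x| = \int[mu]_x `|(EFin \o g) x|)%E.
  apply: ge0_ae_eq_integralT => //; [exact: measurableT_comp|exact: measurableT_comp|].
  by apply: (ae_impl fg) => x /= ->.
rewrite -fE; apply/esym/ae_eq_integral => //.
by apply: (ae_impl fg) => x /= ->.
Qed.

Lemma integral_is_unique f a b : integral_is f a -> integral_is f b -> a = b.
Proof. by move=> [_ fa] [_ fb]; move: fb; rewrite fa => -[]. Qed.

Lemma integral_is_between f g h a c : measurable_fun setT g ->
    integral_is f a -> integral_is h c ->
    {ae mu, forall x, f x <= g x <= h x} ->
  exists b, integral_is g b.
Proof.
move=> mg [fi _] [hi _] fgh.
have mgE : measurable_fun setT (EFin \o g) by exact/measurable_EFinP.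
pose k x := `|f x| + `|h x|.
have ki : mu.-integrable setT (EFin \o k).
  rewrite (_ : _ \o _ = (EFin \o (Num.norm \o f)) \+ (EFin \o (Num.norm \o h)))//.
  by apply: integrableD => //; exact: integrable_norm.
have mk := measurable_int _ ki.
have gi : mu.-integrable setT (EFin \o g).
  apply/integrableP; split=> //; move/integrableP : (ki) => [_]; apply: le_lt_trans.
  apply: ae_ge0_le_integral => //; [exact: measurableT_comp|exact: measurableT_comp|].
  apply: (ae_impl fgh) => x /andP[fg gh] _ /=; rewrite lee_fin.
  rewrite [leRHS]ger0_norm ?addr_ge0//.
  have := ler_norm (- f x); have := ler_norm (h x); rewrite normrN ler_norml.
  have := normr_ge0 (f x); have := normr_ge0 (h x); rewrite /k; lra.
exists (fine (\int[mu]_x (g x)%:E)); split=> //.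
by rewrite fineK//; exact: integrable_fin_num.
Qed.

End integral_is.

Lemma measurable_funV (R : realType) d (T : measurableType d) (f : T -> R) :
  (forall x, 0 <= f x) -> measurable_fun setT f -> measurable_fun setT (fun x => (f x)^-1).
Proof.
move=> f0 mf; rewrite (_ : (fun _ => _) = (fun x => powR (f x) (-1))).
  exact: (measurableT_comp (measurable_powR (-1)) mf).
by apply/funext => x; rewrite powR_inv1.
Qed.

(** With u = exp (a / 2) and v = exp (b / 2), split |u - v| (u + v) by AM-GM with weight dl.
    Expanding |u - v|^2 leaves - 2 u v, where u v = exp (m - k) >= (1 - k) exp m; this bound is
    linear in k, so it integrates when k is a multiple of |x|^2. *)
Lemma expR_dist_le (R : realType) (a b m k dl : R) : 0 < dl -> (a + b) / 2 = m - k ->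
  `|expR a - expR b| <= (2 * dl)^-1 * (expR a + expR b - 2 * expR m + 2 * k * expR m)
                        + dl * (expR a + expR b).
Proof.
move=> dl0 abE; pose u := expR (a / 2); pose v := expR (b / 2).
have uE : expR a = u ^+ 2 by rewrite expr2 -expRD; congr expR; field.
have vE : expR b = v ^+ 2 by rewrite expr2 -expRD; congr expR; field.
have uv : expR m * (1 - k) <= u * v.
  rewrite -expRD (_ : a / 2 + b / 2 = m - k); last by rewrite -abE; field.
  by rewrite expRD ler_wpM2l ?expR_ge0//; have := expR_ge1Dx (- k); lra.
have u0 : 0 < u := expR_gt0 _; have v0 : 0 < v := expR_gt0 _.
rewrite uE vE subr_sqr normrM (gtr0_norm (addr_gt0 u0 v0)).
have amgm : `|u - v| * (u + v) <= (2 * dl)^-1 * `|u - v| ^+ 2 + dl / 2 * (u + v) ^+ 2.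
  have -> : (2 * dl)^-1 * `|u - v| ^+ 2 + dl / 2 * (u + v) ^+ 2 =
     `|u - v| * (u + v) + (2 * dl)^-1 * (`|u - v| - dl * (u + v)) ^+ 2.
    by field; rewrite gt_eqF.
  by rewrite lerDl mulr_ge0 ?sqr_ge0// invr_ge0; lra.
apply: (le_trans amgm); apply: lerD.
  rewrite ler_pM2l ?invr_gt0; last lra.
  rewrite real_normK ?num_real//; move: uv; rewrite sqrrB mulrBr mulr1; lra.
have := sqr_ge0 (u - v); nra.
Qed.

Section replica.
Context {R : realType} (S : abstract_wiener_space R).
Local Notation W := (wiener S).
Local Notation H := (cameron_martin S).
Local Notation ip := (inner S).
Local Notation normE := (@norm_innerE _ S).
Variable muX : probability (borel H) R.
Local Notation gamma := (wiener_measure S).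
Local Notation P := (channel_prob muX).
Local Notation lik := (@likelihood R S).
Local Notation Q := (@evidence R S muX).
Local Notation q := (@rev_evidence R S muX).
Hypothesis x_dual : {ae muX, forall h, range (dual_embed S) h}.
Hypothesis x_energy : muX.-integrable setT (fun h : H => (`|h| ^+ 2)%:E).

Lemma integral_fst (c : borel H -> \bar R) : measurable_fun setT c ->
  (forall h, 0 <= c h)%E -> (\int[P]_z c z.1 = \int[muX]_h c h)%E.
Proof.
move=> mc c0; rewrite fubini_tonelli1//; last exact: (measurableT_comp mc measurable_fst).
apply: eq_integral => h _; rewrite /fubini_F/= integral_cst//.
by rewrite [X in (_ * X)%E](_ : _ = 1%E) ?mule1//; exact: probability_setT.
Qed.

Definition input_energy : R := fine (\int[muX]_h (`|h : H| ^+ 2)%:E)%E.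

Lemma input_energyE : (\int[muX]_h (`|h : H| ^+ 2)%:E = input_energy%:E)%E.
Proof. by rewrite fineK//; apply: (integrable_fin_num _ x_energy). Qed.

(** A function of the input alone does not see the channel, so reweighting by the likelihood leaves
    its integral unchanged. *)
Lemma integral_likelihood r (c : borel H -> \bar R) : measurable_fun setT c ->
  (forall h, 0 <= c h)%E -> (\int[P]_z (c z.1 * (lik r z)%:E) = \int[muX]_h c h)%E.
Proof.
move=> mc c0.
have mc1 : measurable_fun setT (fun z : borel H * borel W => c z.1).
  exact: (measurableT_comp mc measurable_fst).
by rewrite -(channel_transfer x_dual r mc1)// integral_fst.
Qed.

Lemma likelihood_is r : integral_is P (lik r) 1.
Proof.
apply: integral_is_ge0; [exact: measurable_likelihood|exact: likelihood_ge0|].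
have <- : (\int[muX]_h (cst 1%E h) = 1)%E.
  by rewrite integral_cst// mul1e; exact: probability_setT.
rewrite -(@integral_likelihood r (cst 1%E))//.
by apply: eq_integral => z _; rewrite mul1e.
Qed.

Lemma likelihood_energy_is r :
  integral_is P (fun z => `|z.1 : H| ^+ 2 * lik r z) input_energy.
Proof.
apply: integral_is_ge0.
- apply: measurable_funM; last exact: measurable_likelihood.
  exact: (measurableT_comp (@measurable_sqr_norm _ S) measurable_fst).
- by move=> z; rewrite mulr_ge0 ?sqr_ge0// likelihood_ge0.
- rewrite -input_energyE -(@integral_likelihood r (fun h => (`|h : H| ^+ 2)%:E))//.
    by apply/measurable_EFinP; exact: measurable_sqr_norm.
Qed.

(* sqrt (p_r p_r') is a multiple of p at the midpoint, which makes the Hellinger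
   distance explicit; AM-GM then compares it to the L^1 distance. *)
Lemma likelihood_dist_le r r' :
  (\int[P]_z (`|lik r z - lik r' z|)%:E <= (`|r - r'| * (input_energy / 8 + 2))%:E)%E.
Proof.
have [->|rr'] := eqVneq r r'.
  rewrite subrr normr0 mul0r.
  under eq_integral do rewrite subrr normr0.
  by rewrite integral0.
(* The Hellinger term is of order |r - r'|^2, so this AM-GM weight makes both terms linear in |r -
   r'|. *)
pose dl := `|r - r'|; have dl0 : 0 < dl by rewrite normr_gt0 subr_eq0.
pose rm := (r + r') / 2.
pose B z := (2 * dl)^-1 * (lik r z + lik r' z - 2 * lik rm z +
    dl ^+ 2 / 4 * (`|z.1 : H| ^+ 2 * lik rm z)) + dl * (lik r z + lik r' z).
have Bis : integral_is P B (dl * (input_energy / 8 + 2)).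
  have -> : dl * (input_energy / 8 + 2) = (2 * dl)^-1 * (1 + 1 - 2 * 1 +
      dl ^+ 2 / 4 * input_energy) + dl * (1 + 1) by field; rewrite gt_eqF.
  apply: integral_isD; last by apply/integral_isZ/integral_isD; exact: likelihood_is.
  apply/integral_isZ/integral_isD; last exact/integral_isZ/likelihood_energy_is.
  apply: integral_isB; last exact/integral_isZ/likelihood_is.
  by apply: integral_isD; exact: likelihood_is.
have lB z : `|lik r z - lik r' z| <= B z.
  (* The defect of the quadratic exponent at the midpoint: (r^2 + r'^2) / 2 = rm^2 + (r - r')^2 / 4,
     times |x|^2 / 2. *)
  pose k := dl ^+ 2 * `|z.1 : H| ^+ 2 / 8.
  apply: le_trans (@expR_dist_le R _ _ (rm * pairing z - rm ^+ 2 * `|z.1 : H| ^+ 2 / 2) k _ dl0 _) _.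
    by rewrite /k /dl real_normK ?num_real// /rm; field.
  by rewrite le_eqVlt; apply/orP; left; apply/eqP; rewrite /B /likelihood /k; field; rewrite gt_eqF.
rewrite -Bis.2; apply: ge0_le_integral => //.
- apply/measurable_EFinP; apply: measurableT_comp => //.
  by apply: measurable_funB; exact: measurable_likelihood.
- exact: measurable_int Bis.1.
- by move=> z _; rewrite lee_fin.
Qed.

(** Joint density of (replica, (input, output)) with respect to the product of [muX] and P: the
    density of (input, output) times the posterior density of the replica. It is symmetric in the
    two inputs. *)
Definition replica_weight (r : R) (t : borel H * (borel H * borel W)) : R :=
  lik r (t.1, t.2.2) * lik r t.2 / q r t.2.2.

Local Notation M := (muX \x P)%E.
Local Notation rep := replica_weight.

Lemma replica_weight_ge0 r t : 0 <= rep r t.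
Proof. by rewrite !mulr_ge0 ?likelihood_ge0// invr_ge0 rev_evidence_ge0. Qed.

Lemma measurable_snd_snd d1 d2 d3 (A : measurableType d1) (B : measurableType d2)
  (C : measurableType d3) : measurable_fun setT (fun t : A * (B * C) => t.2.2).
Proof. exact: (measurableT_comp measurable_snd measurable_snd). Qed.

Lemma measurable_fst_snd_snd d1 d2 d3 (A : measurableType d1) (B : measurableType d2)
  (C : measurableType d3) : measurable_fun setT (fun t : A * (B * C) => (t.1, t.2.2)).
Proof.
by apply: measurable_fun_pair; [exact: measurable_fst|exact: measurable_snd_snd].
Qed.

Lemma measurable_evidence_inv r : measurable_fun setT (fun w => (q r w)^-1).
Proof. by apply: measurable_funV; [exact: rev_evidence_ge0|exact: measurable_rev_evidence]. Qed.

Lemma measurable_replica_weight r : measurable_fun setT (rep r).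
Proof.
apply: measurable_funM; first apply: measurable_funM.
- exact: (measurableT_comp (@measurable_likelihood _ S r) (@measurable_fst_snd_snd _ _ _ _ _ _)).
- exact: (measurableT_comp (@measurable_likelihood _ S r) measurable_snd).
- exact: (measurableT_comp (measurable_evidence_inv r) (@measurable_snd_snd _ _ _ _ _ _)).
Qed.

(** For almost every w the posterior density of the replica has total mass 1 under [muX]. *)
Lemma replica_integral_out r (c : borel H * borel W -> \bar R) : measurable_fun setT c ->
    (forall z, 0 <= c z)%E ->
  (\int[M]_t (c t.2 * (lik r (t.1, t.2.2) / q r t.2.2)%:E) = \int[P]_z c z)%E.
Proof.
move=> mc c0.
have mF : measurable_fun setT (fun t : borel H * (borel H * borel W) =>
    (c t.2 * (lik r (t.1, t.2.2) / q r t.2.2)%:E)%E).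
  apply: emeasurable_funM; first exact: (measurableT_comp mc measurable_snd).
  apply/measurable_EFinP; apply: measurable_funM.
    exact: (measurableT_comp (@measurable_likelihood _ S r) (@measurable_fst_snd_snd _ _ _ _ _ _)).
  exact: (measurableT_comp (measurable_evidence_inv r) (@measurable_snd_snd _ _ _ _ _ _)).
have F0 (t : borel H * (borel H * borel W)) :
    (0 <= c t.2 * (lik r (t.1, t.2.2) / q r t.2.2)%:E)%E.
  by rewrite mule_ge0// lee_fin divr_ge0 ?likelihood_ge0 ?rev_evidence_ge0.
rewrite fubini_tonelli2//; apply: ge0_ae_eq_integralT => //.
- exact: measurable_fun_fubini_tonelli_G.
- by move=> z; apply: integral_ge0 => h _; exact: F0.
apply: (ae_impl (ae_snd muX (rev_evidence_ae x_dual r))) => z [Qq q0].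
rewrite /fubini_G/=.
under eq_integral do rewrite mulrC EFinM.
have mL : measurable_fun setT (fun h => (lik r (h, z.2))%:E).
  apply/measurable_EFinP.
  exact: (measurableT_comp (@measurable_likelihood _ S r) (pair2_measurable z.2)).
rewrite ge0_integralZl//; last 2 first.
- by apply: measurable_funeM.
- by move=> h _; rewrite -EFinM lee_fin mulr_ge0 ?likelihood_ge0// invr_ge0 ltW.
rewrite ge0_integralZl//; last 2 first.
- by move=> h _; rewrite lee_fin likelihood_ge0.
- by rewrite lee_fin invr_ge0 ltW.
by rewrite [X in (_ * (_ * X))%E]Qq -EFinM mulVf ?mule1// gt_eqF.
Qed.

End replica.

Lemma ge0_integral_le3 (R : realType) d (T : measurableType d) (mu : {measure set T -> \bar R})
    (f A B C : T -> R) (a : R) :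
    measurable_fun setT f -> measurable_fun setT A -> measurable_fun setT B ->
    measurable_fun setT C -> (forall x, 0 <= f x) ->
    (forall x, 0 <= A x) -> (forall x, 0 <= B x) -> (forall x, 0 <= C x) ->
    (\int[mu]_x (A x)%:E <= a%:E)%E -> (\int[mu]_x (B x)%:E <= a%:E)%E ->
    (\int[mu]_x (C x)%:E <= a%:E)%E -> {ae mu, forall x, f x <= A x + B x + C x} ->
  (\int[mu]_x (f x)%:E <= (3 * a)%:E)%E.
Proof.
move=> mf mA mB mC f0 A0 B0 C0 hA hB hC fABC.
have E0 (g : T -> R) : (forall x, 0 <= g x) -> forall x, setT x -> (0 <= (g x)%:E)%E.
  by move=> g0 x _; rewrite lee_fin.
have mE (g : T -> R) : measurable_fun setT g -> measurable_fun setT (EFin \o g).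
  by move=> mg; exact/measurable_EFinP.
apply: (@le_trans _ _ (\int[mu]_x ((A x + B x)%:E + (C x)%:E))%E).
  apply: ae_ge0_le_integral => //; [exact: E0|exact: mE| | |].
  - by move=> x _; rewrite adde_ge0// lee_fin// addr_ge0.
  - by apply: emeasurable_funD; apply: mE => //; exact: measurable_funD.
  - by apply: (ae_impl fABC) => x fx _; rewrite -EFinD lee_fin.
rewrite ge0_integralD//; [|by apply: E0 => x; rewrite addr_ge0| |exact: E0|exact: mE]; last first.
  by apply: mE; exact: measurable_funD.
under eq_integral do rewrite EFinD.
rewrite ge0_integralD//; [|exact: E0|exact: mE|exact: E0|exact: mE].
apply: (le_trans (leeD (leeD hA hB) hC)).
by rewrite -!EFinD lee_fin le_eqVlt; apply/orP; left; apply/eqP; ring.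
Qed.

(** A telescoping arranged so that every term integrates out: p / k and a' / k' will be posterior
    densities, and in the last term removing p / k and then a' / k' leaves |k - k'|. *)
Lemma quotient_dist_le (R : realType) (p p' a a' k k' : R) :
    0 <= p -> 0 <= a' -> 0 < k -> 0 < k' ->
  `|p * a / k - p' * a' / k'| <=
    `|a - a'| * (p / k) + `|p - p'| * (a' / k') + `|k - k'| / k' * a' * (p / k).
Proof.
move=> p0 a0 k0 k0'.
have -> : p * a / k - p' * a' / k' =
    (a - a') * (p / k) + (p - p') * (a' / k') + (k' - k) / k' * a' * (p / k).
  by field; rewrite !gt_eqF.
have pk : 0 <= p / k by rewrite divr_ge0// ltW.
have ak : 0 <= a' / k' by rewrite divr_ge0// ltW.
apply: (le_trans (ler_normD _ _)); apply: lerD.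
  apply: (le_trans (ler_normD _ _)).
  by rewrite (normrM (a - a')) (normrM (p - p')) (ger0_norm pk) (ger0_norm ak).
by rewrite (normrM _ (p / k)) (ger0_norm pk) !normrM (ger0_norm a0) normfV (gtr0_norm k0') (distrC k).
Qed.

(** * Continuity of the replica law in total variation *)

Section replica_continuity.
Context {R : realType} (S : abstract_wiener_space R).
Local Notation W := (wiener S).
Local Notation H := (cameron_martin S).
Local Notation ip := (inner S).
Local Notation normE := (@norm_innerE _ S).
Variable muX : probability (borel H) R.
Local Notation gamma := (wiener_measure S).
Local Notation P := (channel_prob muX).
Local Notation lik := (@likelihood R S).
Local Notation Q := (@evidence R S muX).
Local Notation q := (@rev_evidence R S muX).
Local Notation M := (muX \x P)%E.
Local Notation rep := (@replica_weight R S muX).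
Local Notation E0 := (@input_energy R S muX).
Hypothesis x_dual : {ae muX, forall h, range (dual_embed S) h}.
Hypothesis x_energy : muX.-integrable setT (fun h : H => (`|h| ^+ 2)%:E).

Local Notation triple := (borel H * (borel H * borel W))%type.

Local Lemma m13 : measurable_fun setT (fun t : triple => (t.1, t.2.2)).
Proof. exact: measurable_fst_snd_snd. Qed.

Local Lemma m3 : measurable_fun setT (fun t : triple => t.2.2).
Proof. exact: measurable_snd_snd. Qed.

Lemma integral_rev_evidence r (F : borel W -> R) : measurable_fun setT F -> (forall w, 0 <= F w) ->
  (\int[gamma]_w ((F w / q r w)%:E * Q r w) = \int[gamma]_w (F w)%:E)%E.
Proof.
move=> mF F0; apply: ge0_ae_eq_integralT.
- apply: emeasurable_funM; last exact: measurable_evidence.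
  apply/measurable_EFinP; apply: measurable_funM => //; exact: measurable_evidence_inv.
- exact/measurable_EFinP.
- by move=> w; rewrite mule_ge0 ?evidence_ge0// lee_fin divr_ge0 ?rev_evidence_ge0.
- by move=> w; rewrite lee_fin.
apply: (ae_impl (rev_evidence_ae x_dual r)) => w [-> q0].
by rewrite -EFinM divfK// gt_eqF.
Qed.

(** With the replica fixed, integrating the input out of the likelihood produces the evidence, which
    cancels the denominator. *)
Lemma replica_integral_out_snd r (c : borel H * borel W -> R) : measurable_fun setT c ->
    (forall z, 0 <= c z) ->
  (\int[M]_t (c (t.1, t.2.2) * (lik r t.2 / q r t.2.2))%:E = \int[P]_z (c z)%:E)%E.
Proof.
move=> mc c0.
have mF : measurable_fun setT (fun t : triple => (c (t.1, t.2.2) * (lik r t.2 / q r t.2.2))%:E).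
  apply/measurable_EFinP; apply: measurable_funM; first exact: (measurableT_comp mc m13).
  apply: measurable_funM; first exact: (measurableT_comp (@measurable_likelihood _ S r) measurable_snd).
  exact: (measurableT_comp (measurable_evidence_inv muX r) m3).
have F0 (t : triple) : (0 <= (c (t.1, t.2.2) * (lik r t.2 / q r t.2.2))%:E)%E.
  by rewrite lee_fin mulr_ge0// divr_ge0 ?likelihood_ge0 ?rev_evidence_ge0.
rewrite fubini_tonelli1// [RHS]fubini_tonelli1//; last exact/measurable_EFinP.
apply: eq_integral => h _; rewrite /fubini_F/=.
have mch : measurable_fun setT (fun w => c (h, w)).
  exact: (measurableT_comp mc (pair1_measurable h)).
rewrite -(@integral_rev_evidence r)// -integral_evidence.
- by apply: eq_integral => z _; rewrite -EFinM; congr EFin; rewrite mulrAC mulrA.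
- apply/measurable_EFinP; apply: measurable_funM => //; exact: measurable_evidence_inv.
- by move=> w; rewrite lee_fin divr_ge0 ?rev_evidence_ge0.
Qed.

Lemma rev_evidence_dist_le r r' :
  (\int[gamma]_w (`|q r w - q r' w|)%:E <= \int[P]_z (`|lik r z - lik r' z|)%:E)%E.
Proof.
have mD : measurable_fun setT (fun z => (`|lik r z - lik r' z|)%:E).
  apply/measurable_EFinP; apply: measurableT_comp => //.
  by apply: measurable_funB; exact: measurable_likelihood.
have D0 z : (0 <= (`|lik r z - lik r' z|)%:E)%E by rewrite lee_fin.
rewrite [leRHS]fubini_tonelli2//; apply: ae_ge0_le_integral => //.
- apply/measurable_EFinP; apply: measurableT_comp => //.
  by apply: measurable_funB; exact: measurable_rev_evidence.
- by move=> w _; apply: integral_ge0 => h _.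
- exact: measurable_fun_fubini_tonelli_G.
apply: (ae_impl (ae_and (rev_evidence_ae x_dual r) (rev_evidence_ae x_dual r'))).
move=> w [[Qq q0] [Qq' q0']] _; rewrite /fubini_G/=.
have mL s : measurable_fun setT (fun h => (lik s (h, w))%:E).
  apply/measurable_EFinP.
  exact: (measurableT_comp (@measurable_likelihood _ S s) (pair2_measurable w)).
have iL s : Q s w = (q s w)%:E -> muX.-integrable setT (fun h => (lik s (h, w))%:E).
  move=> Qs; apply: ge0_integrable => // [h|]; first by rewrite lee_fin likelihood_ge0.
  by rewrite [X in (X < _)%E](_ : _ = (q s w)%:E) ?ltry.
have -> : (`|q r w - q r' w|%:E = `|\int[muX]_h ((lik r (h, w))%:E - (lik r' (h, w))%:E)|)%E.
  by rewrite integralB ?iL// -[X in (`|X - _|)%E]/(Q r w) -[X in (`|_ - X|)%E]/(Q r' w) Qq Qq'.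
apply: le_abse_integral => //; exact: emeasurable_funB.
Qed.

(** Each of the three terms of [quotient_dist_le] costs at most the L^1 distance of the likelihoods,
    whence the factor 3. *)
Lemma replica_dist_le r r' :
  (\int[M]_t (`|rep r t - rep r' t|)%:E <= (`|r - r'| * (3 * (E0 / 8 + 2)))%:E)%E.
Proof.
pose dp z := `|lik r z - lik r' z|.
have mdp : measurable_fun setT dp.
  apply: measurableT_comp => //.
  by apply: measurable_funB; exact: measurable_likelihood.
pose A (t : triple) := dp t.2 * (lik r (t.1, t.2.2) / q r t.2.2).
pose B (t : triple) := dp (t.1, t.2.2) * (lik r' t.2 / q r' t.2.2).
pose cC z := `|q r z.2 - q r' z.2| / q r' z.2 * lik r' z.
pose C (t : triple) := cC t.2 * (lik r (t.1, t.2.2) / q r t.2.2).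
have mq s : measurable_fun setT (fun z : borel H * borel W => q s z.2).
  exact: (measurableT_comp (measurable_rev_evidence muX s) measurable_snd).
have mcC : measurable_fun setT cC.
  apply: measurable_funM; last exact: measurable_likelihood.
  apply: measurable_funM; first by apply: measurableT_comp => //; exact: measurable_funB.
  exact: (measurableT_comp (measurable_evidence_inv muX r') measurable_snd).
have cC0 z : 0 <= cC z.
  by rewrite mulr_ge0 ?likelihood_ge0// divr_ge0 ?rev_evidence_ge0.
have mL13 s : measurable_fun setT (fun t : triple => lik s (t.1, t.2.2) / q s t.2.2).
  apply: measurable_funM; first exact: (measurableT_comp (@measurable_likelihood _ S s) m13).
  exact: (measurableT_comp (measurable_evidence_inv muX s) m3).
have mL2 s : measurable_fun setT (fun t : triple => lik s t.2 / q s t.2.2).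
  apply: measurable_funM; first exact: (measurableT_comp (@measurable_likelihood _ S s) measurable_snd).
  exact: (measurableT_comp (measurable_evidence_inv muX s) m3).
have mA : measurable_fun setT A.
  by apply: measurable_funM => //; exact: (measurableT_comp mdp measurable_snd).
have mB : measurable_fun setT B.
  by apply: measurable_funM => //; exact: (measurableT_comp mdp m13).
have mC : measurable_fun setT C.
  by apply: measurable_funM => //; exact: (measurableT_comp mcC measurable_snd).
have L0 s z : 0 <= lik s z := likelihood_ge0 s z.
have q0 s w : 0 <= q s w := rev_evidence_ge0 muX s w.
have A0 t : 0 <= A t by apply: mulr_ge0; [exact: normr_ge0|exact: divr_ge0].
have B0 t : 0 <= B t by apply: mulr_ge0; [exact: normr_ge0|exact: divr_ge0].
have C0 t : 0 <= C t by apply: mulr_ge0; [exact: cC0|exact: divr_ge0].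
have IA : (\int[M]_t (A t)%:E = \int[P]_z (dp z)%:E)%E.
  apply: etrans (replica_integral_out x_dual r (c := EFin \o dp) _ _) => //.
    exact/measurable_EFinP.
  by move=> z; rewrite lee_fin normr_ge0.
have IB : (\int[M]_t (B t)%:E = \int[P]_z (dp z)%:E)%E.
  by apply: replica_integral_out_snd => // z; exact: normr_ge0.
have IC : (\int[M]_t (C t)%:E <= \int[P]_z (dp z)%:E)%E.
  apply: le_trans (rev_evidence_dist_le r r').
  have -> : (\int[M]_t (C t)%:E = \int[P]_z (cC z)%:E)%E.
    apply: etrans (replica_integral_out x_dual r (c := EFin \o cC) _ _) => //.
    exact/measurable_EFinP.
  rewrite -(@integral_rev_evidence r')//; last first.
    apply: measurableT_comp => //; apply: measurable_funB; exact: measurable_rev_evidence.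
  rewrite -integral_evidence//.
  - apply/measurable_EFinP; apply: measurable_funM.
      apply: measurableT_comp => //; apply: measurable_funB; exact: measurable_rev_evidence.
    exact: measurable_evidence_inv.
  - by move=> w; rewrite lee_fin divr_ge0.
have h3 := likelihood_dist_le x_dual x_energy r r'.
rewrite mulrCA; apply: (ge0_integral_le3 _ mA mB mC _ A0 B0 C0);
  [| |by rewrite IA|by rewrite IB|exact: le_trans IC h3|].
- apply: measurableT_comp => //.
  by apply: measurable_funB; exact: measurable_replica_weight.
- by move=> t; exact: normr_ge0.
have h s := ae_snd muX (ae_snd muX (rev_evidence_ae x_dual s)).
apply: (ae_impl (ae_and (h r) (h r'))) => -[x' z] /= [[_ qr] [_ qr']].
by apply: quotient_dist_le => //; exact: L0.
Qed.

End replica_continuity.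

(** * The overlap of two replicas and its continuity *)

Section overlap.
Context {R : realType} (S : abstract_wiener_space R).
Local Notation W := (wiener S).
Local Notation H := (cameron_martin S).
Local Notation ip := (inner S).
Local Notation normE := (@norm_innerE _ S).
Variable muX : probability (borel H) R.
Local Notation gamma := (wiener_measure S).
Local Notation P := (channel_prob muX).
Local Notation lik := (@likelihood R S).
Local Notation Q := (@evidence R S muX).
Local Notation q := (@rev_evidence R S muX).
Local Notation M := (muX \x P)%E.
Local Notation rep := (@replica_weight R S muX).
Local Notation E0 := (@input_energy R S muX).
Hypothesis x_dual : {ae muX, forall h, range (dual_embed S) h}.
Hypothesis x_energy : muX.-integrable setT (fun h : H => (`|h| ^+ 2)%:E).

Local Notation triple := (borel H * (borel H * borel W))%type.

Lemma replica_input_is r (c : borel H -> R) a : measurable_fun setT c -> (forall h, 0 <= c h) ->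
    (\int[muX]_h (c h)%:E = a%:E)%E ->
  integral_is M (fun t => c t.2.1 * rep r t) a.
Proof.
move=> mc c0 ca; apply: integral_is_ge0.
- apply: measurable_funM; last exact: measurable_replica_weight.
  exact: (measurableT_comp mc (measurableT_comp measurable_fst measurable_snd)).
- by move=> t; rewrite mulr_ge0// replica_weight_ge0.
have mF : measurable_fun setT (fun z : borel H * borel W => (c z.1 * lik r z)%:E).
  apply/measurable_EFinP; apply: measurable_funM; last exact: measurable_likelihood.
  exact: (measurableT_comp mc measurable_fst).
transitivity (\int[P]_z (c z.1 * lik r z)%:E)%E.
  rewrite -(replica_integral_out x_dual r mF) => [|z]; last first.
    by rewrite lee_fin mulr_ge0// likelihood_ge0.
  apply: eq_integral => t _; rewrite -EFinM; congr EFin.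
  by rewrite /replica_weight; ring.
rewrite -ca -(integral_likelihood x_dual r (c := EFin \o c))//; exact/measurable_EFinP.
Qed.

Lemma replica_replica_is r (c : borel H -> R) a : measurable_fun setT c -> (forall h, 0 <= c h) ->
    (\int[muX]_h (c h)%:E = a%:E)%E ->
  integral_is M (fun t => c t.1 * rep r t) a.
Proof.
move=> mc c0 ca; apply: integral_is_ge0.
- apply: measurable_funM; last exact: measurable_replica_weight.
  exact: (measurableT_comp mc measurable_fst).
- by move=> t; rewrite mulr_ge0// replica_weight_ge0.
have mF : measurable_fun setT (fun z : borel H * borel W => c z.1 * lik r z).
  apply: measurable_funM; last exact: measurable_likelihood.
  exact: (measurableT_comp mc measurable_fst).
transitivity (\int[P]_z (c z.1 * lik r z)%:E)%E.
  rewrite -(replica_integral_out_snd x_dual r mF) => [|z]; last first.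
    by rewrite mulr_ge0// likelihood_ge0.
  apply: eq_integral => t _; congr EFin.
  by rewrite /replica_weight; ring.
rewrite -ca -(integral_likelihood x_dual r (c := EFin \o c))//; exact/measurable_EFinP.
Qed.

Lemma measurable_ip_triple : measurable_fun setT ((fun t => ip t.1 t.2.1) : triple -> R).
Proof.
apply: (measurableT_comp (@measurable_ip2 _ S)
  (_ : measurable_fun setT (fun t : triple => (t.1, t.2.1)))).
apply: measurable_fun_pair; first exact: measurable_fst.
exact: (measurableT_comp measurable_fst measurable_snd).
Qed.

(** Input and replica both have law [muX] under the replica weight, whatever r is. The factor a lets
    the lemma supply both the lower and the upper bound for [overlap_is]. *)
Lemma replica_energy_is r (a : R) : integral_is M
  (fun t => a * ((`|t.1 : H| ^+ 2 + `|t.2.1 : H| ^+ 2) * rep r t)) (a * (E0 + E0)).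
Proof.
have mn := @measurable_sqr_norm _ S.
have n0 (h : borel H) : 0 <= `|h : H| ^+ 2 by exact: sqr_ge0.
apply: (integral_is_eq (f := fun t : triple =>
    a * (`|t.1 : H| ^+ 2 * rep r t + `|t.2.1 : H| ^+ 2 * rep r t))).
  by move=> t; rewrite mulrDl.
apply/integral_isZ/integral_isD.
  exact: (replica_replica_is r mn n0 (input_energyE x_energy)).
exact: (replica_input_is r mn n0 (input_energyE x_energy)).
Qed.

(* E (x, x') for x' an independent replica of x given the output. *)
Definition overlap (r : R) : R := fine (\int[M]_t (ip t.1 t.2.1 * rep r t)%:E)%E.

Lemma overlap_is r : integral_is M (fun t => ip t.1 t.2.1 * rep r t) (overlap r).
Proof.
have [b hb] : exists b, integral_is M (fun t : triple => ip t.1 t.2.1 * rep r t) b.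
  apply: (integral_is_between _ (replica_energy_is r (- 2^-1)) (replica_energy_is r 2^-1)).
    by apply: measurable_funM; [exact: measurable_ip_triple|exact: measurable_replica_weight].
  apply: aeW => t; have := ip_le_sqr_norm normE t.1 t.2.1.
  rewrite ler_norml => /andP[h1 h2]; have r0 := replica_weight_ge0 muX r t.
  move: (ip _ _) (`|_| ^+ 2 + _) (replica_weight _ _ _) h1 h2 r0 => i a w h1 h2 w0.
  by apply/andP; split; nra.
by rewrite /overlap hb.2.
Qed.

(** For the truncation of g at K, [replica_dist_le] makes the integral Lipschitz in r; an increasing
    limit of continuous functions is lower semicontinuous. *)
Lemma replica_lower_semicontinuous (g : triple -> R) (n : R -> R) :
    measurable_fun setT g -> (forall t, 0 <= g t) ->
    (forall r, integral_is M (fun t => g t * rep r t) (n r)) ->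
  forall r0 e, 0 < e -> \forall r \near r0, n r0 - e < n r.
Proof.
move=> mg g0 gn r0 e e0.
pose gK (K : nat) t := Num.min (g t) K%:R.
have mgK K : measurable_fun setT (gK K) by exact: measurable_minr.
have gK0 K t : 0 <= gK K t by rewrite le_min g0/=.
have gKg K t : gK K t <= g t by rewrite ge_min lexx.
have iK r K : exists b, integral_is M (fun t => gK K t * rep r t) b.
  apply: (integral_is_between _ (integral_isZ 0 (gn r)) (gn r)).
    by apply: measurable_funM => //; exact: measurable_replica_weight.
  apply: aeW => t; rewrite mul0r mulr_ge0 ?replica_weight_ge0//=.
  by rewrite ler_wpM2r ?replica_weight_ge0.
have [|||||_ _ cK] := @dominated_convergence _ _ _ M setT measurableT
  (fun K => EFin \o (fun t => gK K t * rep r0 t)) (EFin \o (fun t => g t * rep r0 t))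
  (EFin \o (fun t => g t * rep r0 t)).
- by move=> K; have [b [+ _]] := iK r0 K => /measurable_int.
- exact: measurable_int (gn r0).1.
- apply: aeW => t _ /=; apply: cvg_EFin; first exact: nearW.
  apply: cvgM; last exact: cvg_cst.
  apply: cvg_near_cst; near=> K; apply/min_idPl; apply: ltW; near: K.
  exact: nbhs_infty_gtr.
- exact: (gn r0).1.
- apply: aeW => t K _ /=; have w0 := replica_weight_ge0 muX r0 t.
  by rewrite lee_fin normrM (ger0_norm (gK0 K t)) (ger0_norm w0) ler_wpM2r.
have cKr : fine (\int[M]_t (gK K t * rep r0 t)%:E)%E @[K --> \oo] --> n r0.
  by apply: fine_cvg; rewrite -(gn r0).2.
have [K hK] : exists K, n r0 - e / 2 < fine (\int[M]_t (gK K t * rep r0 t)%:E)%E.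
  have [N _ hN] : \forall K \near \oo,
      n r0 - e / 2 < fine (\int[M]_t (gK K t * rep r0 t)%:E)%E.
    by apply: (cvgr_gt _ cKr); rewrite ltrBlDr ltrDl divr_gt0.
  by exists N; exact: hN N (leqnn N).
have [b hb] := iK r0 K; rewrite hb.2 /= in hK.
(* The Lipschitz constant of the truncated integral, increased by 1 so that one can divide by it
   even when K = 0. *)
pose C := K%:R * (3 * (E0 / 8 + 2)) + 1.
have E00 : 0 <= E0.
  by rewrite fine_ge0// integral_ge0// => h _; rewrite lee_fin sqr_ge0.
have C0 : 0 < C by rewrite ltr_wpDl// mulr_ge0//; lra.
near=> r.
have rr0 : `|r - r0| * C < e / 2.
  rewrite -ltr_pdivlMr// distrC; near: r.
  by apply: (@cvgr_dist_lt _ _ _ _ _ id r0) => //; rewrite !divr_gt0.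
have [c hc] := iK r K.
have cn : c <= n r.
  apply: (integral_is_le hc (gn r)); apply: aeW => t.
  by rewrite ler_wpM2r ?replica_weight_ge0.
pose df t := `|rep r t - rep r0 t|.
have [dd hdd] : exists2 dd, integral_is M df dd & dd <= `|r - r0| * (3 * (E0 / 8 + 2)).
  have dle := replica_dist_le x_dual x_energy r r0.
  have dfin : (\int[M]_t (df t)%:E)%E \is a fin_num.
    rewrite ge0_fin_numE; last by apply: integral_ge0 => t _; rewrite lee_fin normr_ge0.
    exact: le_lt_trans dle (ltry _).
  exists (fine (\int[M]_t (df t)%:E)%E); last by rewrite -lee_fin fineK.
  apply: integral_is_ge0; last by rewrite fineK.
    apply: measurableT_comp => //; apply: measurable_funB; exact: measurable_replica_weight.
  by move=> t; exact: normr_ge0.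
move=> ddle.
have : b - K%:R * dd <= c.
  apply: (integral_is_le (integral_isB hb (integral_isZ K%:R hdd)) hc).
  apply: aeW => t; rewrite lerBlDl -lerBlDr -mulrBr.
  apply: le_trans (ler_norm _) _; rewrite normrM (ger0_norm (gK0 K t)) distrC.
  by rewrite ler_wpM2r// ge_min lexx orbT.
have : K%:R * dd <= `|r - r0| * C.
  apply: (@le_trans _ _ (K%:R * (`|r - r0| * (3 * (E0 / 8 + 2))))); first exact: ler_wpM2l.
  by rewrite mulrCA ler_wpM2l// /C lerDl.
move: (n r) (n r0) (K%:R * dd) (`|r - r0| * C) cn hK rr0 => *; lra.
Unshelve. all: by end_near. Qed.

(** The replica expectations of |x + x'|^2 and |x - x'|^2 are 2 E0 + 2 G and 2 E0 - 2 G, with E0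
    constant; lower semicontinuity of both makes G lower and upper semicontinuous. *)
Lemma overlap_continuous : continuous overlap.
Proof.
move=> r0; apply/cvgrPdist_lt => e e0.
pose g (s : R) (t : triple) := `|t.1 : H| ^+ 2 + `|t.2.1 : H| ^+ 2 + s * 2 * ip t.1 t.2.1.
have mn := @measurable_sqr_norm _ S.
have mg s : measurable_fun setT (g s).
  apply: measurable_funD; last by apply: measurable_funM => //; exact: measurable_ip_triple.
  apply: measurable_funD; first exact: (measurableT_comp mn measurable_fst).
  exact: (measurableT_comp mn (measurableT_comp measurable_fst measurable_snd)).
have gis s r : integral_is M (fun t => g s t * rep r t) (1 * (E0 + E0) + s * 2 * overlap r).
  apply: (integral_is_eq (f := fun t : triple => 1 * ((`|t.1 : H| ^+ 2 + `|t.2.1 : H| ^+ 2) * rep r t) +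
     s * 2 * (ip t.1 t.2.1 * rep r t))).
    by move=> t; rewrite /g; ring.
  by apply: integral_isD; [exact: replica_energy_is|exact/integral_isZ/overlap_is].
have g1 t : 0 <= g 1 t.
  by have := sqr_ge0 `|(t.1 : H) + t.2.1|; rewrite (sqr_normD normE) /g mul1r.
have gN1 t : 0 <= g (- 1) t.
  by have := sqr_ge0 `|(t.1 : H) - t.2.1|; rewrite (sqr_normB normE) /g; lra.
near=> r.
have h1 : 1 * (E0 + E0) + 1 * 2 * overlap r0 - 2 * e < 1 * (E0 + E0) + 1 * 2 * overlap r.
  near: r; apply: (replica_lower_semicontinuous (mg 1) g1 (gis 1)); lra.
have h2 : 1 * (E0 + E0) + - 1 * 2 * overlap r0 - 2 * e < 1 * (E0 + E0) + - 1 * 2 * overlap r.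
  near: r; apply: (replica_lower_semicontinuous (mg (- 1)) gN1 (gis (- 1))); lra.
move: (overlap r) (overlap r0) (input_energy muX) h1 h2 => a b c h1 h2.
have {h1} : b - e < a by lra.
have {h2} : a < b + e by lra.
by rewrite ltr_norml ltrBlDr ltrBrDl => *; apply/andP; split; lra.
Unshelve. all: by end_near. Qed.

End overlap.

(** * Entropy of the output *)

Lemma integral_is_fine (R : realType) d (T : measurableType d) (mu : {measure set T -> \bar R})
    (G : T -> \bar R) (a : R) : mu.-integrable setT G -> (\int[mu]_x G x = a%:E)%E ->
  integral_is mu (fine \o G) a.
Proof.
move=> iG Ga; have mG := measurable_int _ iG.
have mfG : measurable_fun setT (EFin \o (fine \o G)).
  apply/measurable_EFinP; exact: (measurableT_comp (@fine_measurable R setT measurableT) mG).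
have GE : {ae mu, forall x, G x = (fine (G x))%:E}.
  by apply: (ae_impl (integrable_ae measurableT iG)) => x /(_ I) Gx; rewrite fineK.
split.
  apply/integrableP; split=> //; move/integrableP : (iG) => [_].
  have -> // : (\int[mu]_x `|G x| = \int[mu]_x `|(EFin \o (fine \o G)) x|)%E.
  apply: ge0_ae_eq_integralT => //; [exact: measurableT_comp|exact: measurableT_comp|].
  by apply: (ae_impl GE) => x /= {1}->.
rewrite -Ga; apply: ae_eq_integral => //.
by apply: (ae_impl GE) => x /= {2}->.
Qed.

Lemma integrable_partial_snd (R : realType) d1 d2 (T1 : measurableType d1)
    (T2 : measurableType d2) (m1 : {sigma_finite_measure set T1 -> \bar R})
    (m2 : {sigma_finite_measure set T2 -> \bar R}) (f : T1 * T2 -> \bar R) :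
  (m1 \x m2)%E.-integrable setT f -> m2.-integrable setT (fun y => \int[m1]_x f (x, y))%E.
Proof.
move=> intf; have mf := measurable_int _ intf.
have mG := measurable_fubini_G intf.
apply/integrableP; split=> //.
have := (integrable21ltyP m1 m2 mf).1 intf; apply: le_lt_trans.
apply: ge0_le_integral => //.
- exact: measurableT_comp.
- apply: (measurable_fun_fubini_tonelli_G (abse \o f)) => //=.
  exact: measurableT_comp.
- move=> y _; apply: le_abse_integral => //.
  exact: (measurableT_comp mf (pair2_measurable y)).
Qed.

(** A transfer formula known for nonnegative functions extends to signed ones through positive and
    negative parts, a nonnegative weight commuting with both. *)
Lemma transfer_is (R : realType) d1 d2 (T1 : measurableType d1) (T2 : measurableType d2)
    (mu : {measure set T1 -> \bar R}) (nu : {measure set T2 -> \bar R})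
    (phi : T1 -> T2) (D : T2 -> R) : measurable_fun setT phi -> (forall y, 0 <= D y) ->
    (forall F : T2 -> \bar R, measurable_fun setT F -> (forall y, 0 <= F y)%E ->
      (\int[mu]_x F (phi x) = \int[nu]_y (F y * (D y)%:E))%E) ->
  forall (F : T2 -> R) a, measurable_fun setT F ->
    integral_is nu (fun y => F y * D y) a -> integral_is mu (fun x => F (phi x)) a.
Proof.
move=> mphi D0 transfer F a mF [iF Fa].
have mFE : measurable_fun setT (EFin \o F) by exact/measurable_EFinP.
have mG : measurable_fun setT (fun x => F (phi x)) by exact: (measurableT_comp mF mphi).
split.
  apply/integrableP; split; first exact/measurable_EFinP.
  move/integrableP : (iF) => [_]; apply: le_lt_trans.
  rewrite (transfer (fun y => `|F y|%:E))//; last first.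
    by apply/measurable_EFinP; exact: measurableT_comp.
  rewrite le_eqVlt; apply/orP; left; apply/eqP; apply: eq_integral => y _ /=.
  by rewrite -EFinM normrM (ger0_norm (D0 y)).
have maxe_scale (x l : R) : 0 <= l -> (maxe (x * l)%:E 0 = maxe x%:E 0 * l%:E)%E.
  by move=> l0; rewrite -!EFin_max -EFinM maxr_pMl// mul0r.
have mFp := measurable_funepos mFE; have mFn := measurable_funeneg mFE.
rewrite -Fa integralE [RHS]integralE; congr (_ - _)%E.
  apply: etrans (etrans (transfer _ mFp (funepos_ge0 _)) _).
    by apply: eq_integral => y _; rewrite !funeposE.
  by apply: eq_integral => y _; rewrite !funeposE -maxe_scale.
apply: etrans (etrans (transfer _ mFn (funeneg_ge0 _)) _).
  by apply: eq_integral => y _; rewrite !funenegE.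
by apply: eq_integral => y _; rewrite !funenegE -!EFinN -mulNr -maxe_scale.
Qed.

Section jensen_gibbs.
Context {R : realType} (S : abstract_wiener_space R).
Local Notation W := (wiener S).
Local Notation H := (cameron_martin S).
Local Notation ip := (inner S).
Local Notation normE := (@norm_innerE _ S).
Variable muX : probability (borel H) R.
Local Notation gamma := (wiener_measure S).
Local Notation P := (channel_prob muX).
Local Notation lik := (@likelihood R S).
Local Notation Q := (@evidence R S muX).
Local Notation q := (@rev_evidence R S muX).
Local Notation M := (muX \x P)%E.
Local Notation rep := (@replica_weight R S muX).
Local Notation E0 := (@input_energy R S muX).
Hypothesis x_dual : {ae muX, forall h, range (dual_embed S) h}.
Hypothesis x_energy : muX.-integrable setT (fun h : H => (`|h| ^+ 2)%:E).

Local Notation triple := (borel H * (borel H * borel W))%type.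

Lemma channel_transfer_is r (F : borel H * borel W -> R) a : measurable_fun setT F ->
  integral_is P (fun z => F z * lik r z) a ->
  integral_is P (fun z => F (z.1, output S r z)) a.
Proof.
apply: transfer_is.
- exact: (@measurable_channel _ S r).
- exact: likelihood_ge0.
- exact: channel_transfer.
Qed.

(* E ((x', h) | output = w), as a function of (h, w). *)
Definition posterior_mean (r : R) (z : borel H * borel W) : R :=
  fine (\int[muX]_x (ip x z.1 * rep r (x, z))%:E)%E / lik r z.

Lemma measurable_posterior_mean r : measurable_fun setT (posterior_mean r).
Proof.
apply: measurable_funM; last first.
  by apply: measurable_funV; [exact: likelihood_ge0|exact: measurable_likelihood].
apply: (measurableT_comp (@fine_measurable R setT measurableT)).
exact: (measurable_fubini_G (overlap_is x_dual x_energy r).1).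
Qed.

(** Integrating the replica out of the overlap leaves [posterior_mean] times the likelihood, and
    that likelihood is the weight absorbed by passing to the output. *)
Lemma posterior_mean_is r :
  integral_is P (fun z => posterior_mean r (z.1, output S r z)) (overlap muX r).
Proof.
apply: channel_transfer_is; first exact: measurable_posterior_mean.
have [iO OE] := overlap_is x_dual x_energy r.
have iG := integrable_partial_snd iO.
have mG := measurable_fubini_G iO.
apply: (integral_is_ae (f := fun z : borel H * borel W => fine (\int[muX]_x (ip x z.1 * rep r (x, z))%:E)%E)).
- by apply: measurable_funM; [exact: measurable_posterior_mean|exact: measurable_likelihood].
- by apply: aeW => z; rewrite /posterior_mean divfK// gt_eqF// likelihood_gt0.
have GO : (\int[P]_z \int[muX]_x (ip x z.1 * rep r (x, z))%:E = (overlap muX r)%:E)%E.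
  by rewrite -OE (integral21_prod_meas1 iO).
exact: (integral_is_fine iG GO).
Qed.

(** The two outputs differ by (r' - r) times the input, and the exponent is affine in the output;
    the likelihood stays the one at rate r. *)
Lemma likelihood_shift r r' h z : range (dual_embed S) h ->
  lik r (h, output S r' z) =
  lik r (h, output S r z) * expR (r * (r' - r) * ip h z.1).
Proof.
move=> [e _ <-]; rewrite /likelihood !pairing_dual_embed -expRD; congr expR.
rewrite /output !linearD !linearZ /= -!(@dual_embedE _ S) (ipC _ _ (z.1)) /GRing.scale/=; ring.
Qed.

(* Properties of (h, w), true almost everywhere, under which the posterior mean
   given w is a genuine expectation. *)
Definition regular (r : R) (z : borel H * borel W) :=
  [/\ Q r z.2 = (q r z.2)%:E, 0 < q r z.2 &
      integral_is muX (fun x => ip x z.1 * lik r (x, z.2)) (posterior_mean r z * q r z.2)].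

Lemma regular_ae r : {ae P, forall z, regular r z}.
Proof.
have [iO _] := overlap_is x_dual x_energy r.
apply: (ae_impl (ae_and (ae_integrable2 iO) (ae_snd muX (rev_evidence_ae x_dual r)))).
move=> z [iz [Qq q0]]; split=> //.
have l0 := likelihood_gt0 r z.
have hz : integral_is muX (fun x => ip x z.1 * rep r (x, z)) (posterior_mean r z * lik r z).
  split; first exact: iz.
  rewrite /posterior_mean divfK ?gt_eqF// fineK//; exact: (integrable_fin_num _ iz).
have := integral_isZ (q r z.2 / lik r z) hz.
rewrite (_ : _ * (_ * _) = posterior_mean r z * q r z.2); last by field; rewrite gt_eqF.
apply: integral_is_eq => x; rewrite /replica_weight/=; field.
by rewrite !gt_eqF.
Qed.

Lemma likelihood_evidence_is r w : Q r w = (q r w)%:E ->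
  integral_is muX (fun x => lik r (x, w)) (q r w).
Proof.
move=> Qq; apply: integral_is_ge0 => // [|x]; last exact: likelihood_ge0.
exact: (measurableT_comp (@measurable_likelihood _ S r) (pair2_measurable w)).
Qed.

(* Jensen: the shift multiplies the likelihood by e^(d (x', h)), whose posterior
   expectation is at least e^(d T). *)
Lemma evidence_shift_ge r r' z : regular r (z.1, output S r z) ->
    Q r (output S r' z) = (q r (output S r' z))%:E ->
  q r (output S r z) * expR (r * (r' - r) * posterior_mean r (z.1, output S r z)) <=
  q r (output S r' z).
Proof.
move=> [/= Qq q0 hT] Qq'.
set y := output S r z in Qq q0 hT *; set y' := output S r' z in Qq' *.
set d := r * (r' - r); set T := posterior_mean r (z.1, y) in hT *.
(* Jensen by a supporting line: exp is bounded below by its tangent at a, the posterior mean of d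
   (x', h), and the tangent integrates linearly. *)
pose a := d * T.
have hl := likelihood_evidence_is Qq.
have hr := integral_isZ (expR a) (integral_isD (integral_isZ (1 - a) hl) (integral_isZ d hT)).
have -> : q r y * expR a = expR a * ((1 - a) * q r y + d * (T * q r y)) by rewrite /a; ring.
apply: (integral_is_le hr (likelihood_evidence_is Qq')).
apply: (ae_impl x_dual) => h hh.
rewrite /y' (likelihood_shift r r' z hh) -/y -/d.
have l0 := likelihood_ge0 r (h, y).
have e1 : 1 + (d * ip h z.1 - a) <= expR (d * ip h z.1 - a) by exact: expR_ge1Dx.
have -> : expR (d * ip h z.1) = expR a * expR (d * ip h z.1 - a).
  by rewrite -expRD; congr expR; ring.
rewrite [leRHS]mulrCA ler_wpM2l ?expR_ge0//.
have -> : (1 - a) * lik r (h, y) + d * (ip h z.1 * lik r (h, y)) =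
          lik r (h, y) * (1 + (d * ip h z.1 - a)) by ring.
by rewrite ler_wpM2l.
Qed.

(** Gibbs' inequality in pointwise form, ln (b / c) <= b / c - 1. Here b / c will be a ratio of
    output densities with mean 1, so the correction disappears on integration. *)
Lemma ln_shift_le (a b c t : R) : 0 < a -> 0 < b -> 0 < c -> a * expR t <= b ->
  ln a + t <= ln c + b / c - 1.
Proof.
move=> a0 b0 c0 ab; have bc0 : 0 < b / c by rewrite divr_gt0.
have h1 : ln a + t <= ln b.
  have <- : ln (a * expR t) = ln a + t by rewrite lnM ?posrE ?expR_gt0// expRK.
  by rewrite ler_ln ?posrE// mulr_gt0// expR_gt0.
apply: (le_trans h1).
have : ln (b / c) <= b / c - 1.
  have := @le_ln1Dx R (b / c - 1); rewrite (_ : 1 + (b / c - 1) = b / c); last by ring.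
  by apply; lra.
by rewrite ln_div ?posrE//; lra.
Qed.

Lemma between_shift (l a b t : R) : 0 <= l + a - 1 -> l - t <= b - 1 ->
  1 - a <= l <= b - 1 + t.
Proof. by move=> h1 h2; apply/andP; split; lra. Qed.

Local Notation lq r z := (ln (q r (output S r z))).
Local Notation T r z := (posterior_mean r (z.1, output S r z)).
Local Notation ratio r r' z := (q r (output S r' z) / q r' (output S r' z)).

Lemma jensen_gibbs_ae r r' : {ae P, forall z,
  lq r z + r * (r' - r) * T r z <= lq r' z + ratio r r' z - 1}.
Proof.
apply: (ae_impl (ae_and (ae_channel x_dual r (regular_ae r))
  (ae_and (rev_evidence_output_ae x_dual r r') (rev_evidence_output_ae x_dual r' r')))).
move=> z /= [reg [[Qy' q0y'] [_ q0]]].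
have [/= _ qy0 _] := reg.
exact: ln_shift_le qy0 q0y' q0 (evidence_shift_ge reg Qy').
Qed.

Lemma rev_evidence_is r : integral_is gamma (q r) 1.
Proof.
apply: integral_is_ge0.
- exact: measurable_rev_evidence.
- by move=> w; exact: rev_evidence_ge0.
rewrite -(integral_evidence1 x_dual r); apply: ge0_ae_eq_integralT.
- apply/measurable_EFinP; exact: measurable_rev_evidence.
- exact: measurable_evidence.
- by move=> w; rewrite lee_fin rev_evidence_ge0.
- by move=> w; exact: evidence_ge0.
by apply: (ae_impl (rev_evidence_ae x_dual r)) => w [-> _].
Qed.

(** The output at rate r' has density q_r', which cancels the denominator and leaves the integral of
    q_r against gamma. *)
Lemma ratio_is r r' : integral_is P (fun z => ratio r r' z) 1.
Proof.
have mr : measurable_fun setT (fun w => q r w / q r' w).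
  apply: measurable_funM; [exact: measurable_rev_evidence|exact: measurable_evidence_inv].
apply: integral_is_ge0.
- exact: (measurableT_comp mr (@measurable_output _ S r')).
- by move=> z; rewrite divr_ge0 ?rev_evidence_ge0.
rewrite (integral_output x_dual r' (F := fun w => (q r w / q r' w)%:E)).
- rewrite (integral_rev_evidence x_dual).
  + exact: (rev_evidence_is r).2.
  + exact: measurable_rev_evidence.
  + by move=> w; exact: rev_evidence_ge0.
- exact/measurable_EFinP.
- by move=> w; rewrite lee_fin divr_ge0 ?rev_evidence_ge0.
Qed.

Lemma rev_evidence_prior_is r : integral_is P (fun z => q r z.2) 1.
Proof.
have := ratio_is r 0; apply: integral_is_eq => z.
by rewrite rev_evidence0 divr1 /output scale0r add0r.
Qed.

(* The relative entropy of the output law with respect to the noise law. *)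
Definition output_entropy (r : R) : R := fine (\int[P]_z (lq r z)%:E)%E.

(** Integrability comes from [jensen_gibbs_ae] between r and the rate 0, where q is 1 and the output
    is w: it gives 1 - 1 / q(y) <= ln q(y) <= q(w) - 1 + r^2 T, with integrable bounds. *)
Lemma output_entropy_is r : integral_is P (fun z => lq r z) (output_entropy r).
Proof.
have [b hb] : exists b, integral_is P (fun z => lq r z) b.
  have T_is := posterior_mean_is r.
  have one_is : integral_is P (fun=> 1) 1.
    apply: integral_is_ge0 => //; rewrite integral_cst//= mul1e; exact: probability_setT.
  have low := integral_isB one_is (ratio_is 0 r).
  have up := integral_isD (integral_isB (rev_evidence_prior_is r) one_is)
                          (integral_isZ (r * r) T_is).
  apply: (integral_is_between _ low up).
    apply: (measurableT_comp (@measurable_ln R)).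
    exact: (measurableT_comp (measurable_rev_evidence muX r) (@measurable_output _ S r)).
  apply: (ae_impl (ae_and (jensen_gibbs_ae 0 r) (jensen_gibbs_ae r 0))) => z [].
  rewrite !rev_evidence0 ln1 divr1 !mul0r addr0 sub0r mulrN mulNr.
  have -> : output S 0 z = z.2 by rewrite /output scale0r add0r.
  rewrite add0r; exact: between_shift.
by rewrite /output_entropy hb.2.
Qed.

Lemma output_entropy_subgradient r r' :
  output_entropy r + r * (r' - r) * overlap muX r <= output_entropy r'.
Proof.
have T_is := posterior_mean_is r.
have one_is : integral_is P (fun=> 1) 1.
  apply: integral_is_ge0 => //; rewrite integral_cst//= mul1e; exact: probability_setT.
rewrite -[leRHS](addrK 1).
apply: (integral_is_le
  (integral_isD (output_entropy_is r) (integral_isZ (r * (r' - r)) T_is))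
  (integral_isB (integral_isD (output_entropy_is r') (ratio_is r r')) one_is)).
exact: jensen_gibbs_ae.
Qed.

End jensen_gibbs.

(** * Mutual information *)

Lemma measurable_lne_fin (R : realType) d (T : measurableType d) (f : T -> \bar R) :
  measurable_fun setT f -> (forall x, f x \is a fin_num) -> measurable_fun setT (@lne R \o f).
Proof.
move=> mf ff.
have mg : measurable_fun setT (fine \o f).
  exact: (measurableT_comp (@fine_measurable R setT measurableT) mf).
rewrite (_ : _ \o _ = fun x => if fine (f x) <= 0 then -oo%E else (ln (fine (f x)))%:E).
  apply: measurable_fun_ifT => //; first exact: measurable_fun_ler.
  apply/measurable_EFinP; exact: (measurableT_comp (@measurable_ln R) mg).
by apply/funext => x /=; rewrite -{1}(fineK (ff x)).
Qed.

Lemma integral_is_ereal_ae (R : realType) d (T : measurableType d)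
    (mu : {measure set T -> \bar R}) (G : T -> \bar R) (f : T -> R) (a : R) :
    measurable_fun setT G -> {ae mu, forall x, G x = (f x)%:E} -> integral_is mu f a ->
  mu.-integrable setT G /\ (\int[mu]_x G x = a%:E)%E.
Proof.
move=> mG Gf [fi fE]; have mf := measurable_int _ fi; split.
  apply/integrableP; split => //; move/integrableP : (fi) => [_].
  have -> // : (\int[mu]_x `|(EFin \o f) x| = \int[mu]_x `|G x|)%E.
  apply: ge0_ae_eq_integralT => //; [exact: measurableT_comp|exact: measurableT_comp|].
  by apply: (ae_impl Gf) => x /= ->.
rewrite -fE; apply: ae_eq_integral => //.
by apply: (ae_impl Gf) => x /= ->.
Qed.

Section density.
Context {R : realType} {d} {T : measurableType d} {nu mu : probability T R} {D : T -> R}.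
Hypothesis mD : measurable_fun setT D.
Hypothesis nuD : forall A, measurable A -> (nu A = \int[mu]_(x in A) (D x)%:E)%E.

Lemma density_dominated : charge_of_finite_measure nu `<< mu.
Proof.
move=> N N0 A mA AN; rewrite [LHS]nuD//; apply: null_set_integral => //; last exact: N0.
by apply: measurable_funTS; apply/measurable_EFinP.
Qed.

Lemma density_Radon_Nikodym :
  {ae nu, forall x, Radon_Nikodym (charge_of_finite_measure nu) mu x = (D x)%:E}.
Proof.
have RN_ae : ae_eq mu setT (Radon_Nikodym (charge_of_finite_measure nu) mu) (EFin \o D).
  apply: integral_ae_eq => //.
  - exact: Radon_Nikodym_integrable density_dominated.
  - exact/measurable_EFinP.
  - by move=> A _ mA; rewrite -(Radon_Nikodym_integral density_dominated mA) -nuD.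
have h := @null_dominates_ae_eq _ _ _ _ nu mu _ _ _ measurableT density_dominated RN_ae.
by apply: (ae_impl h) => z /(_ I).
Qed.

End density.

Section information.
Context {R : realType} (S : abstract_wiener_space R).
Local Notation W := (wiener S).
Local Notation H := (cameron_martin S).
Local Notation ip := (inner S).
Local Notation normE := (@norm_innerE _ S).
Variable muX : probability (borel H) R.
Local Notation gamma := (wiener_measure S).
Local Notation P := (channel_prob muX).
Local Notation lik := (@likelihood R S).
Local Notation Q := (@evidence R S muX).
Local Notation q := (@rev_evidence R S muX).
Local Notation E0 := (@input_energy R S muX).
Hypothesis x_dual : {ae muX, forall h, range (dual_embed S) h}.
Hypothesis x_energy : muX.-integrable setT (fun h : H => (`|h| ^+ 2)%:E).

Lemma input_energy_is : integral_is P (fun z => `|z.1 : H| ^+ 2) E0.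
Proof.
apply: integral_is_ge0.
- exact: (measurableT_comp (@measurable_sqr_norm _ S) measurable_fst).
- by move=> z; rewrite exprn_ge0.
rewrite -(input_energyE x_energy) -(integral_fst muX (c := fun h => (`|h : H| ^+ 2)%:E))//.
by apply/measurable_EFinP; exact: measurable_sqr_norm.
Qed.

Lemma linear_le_quadratic_eq0 (a c : R) : 0 <= c -> (forall r, r * a <= r ^+ 2 * c) -> a = 0.
Proof.
move=> c0 h; apply/eqP; rewrite -normr_le0 leNgt; apply/negP => a0.
have c1 : 0 < c + 1 by lra.
(* The maximizer of r a - r^2 c is a / (2 c); adding 1 to c avoids a zero denominator and still
   yields a contradiction. *)
have := h (a / (2 * (c + 1))).
have -> : a / (2 * (c + 1)) * a = a ^+ 2 / (c + 1) * (1 / 2) by field; by rewrite gt_eqF.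
have -> : (a / (2 * (c + 1))) ^+ 2 * c = a ^+ 2 / (c + 1) * ((1 / 4) * (c / (c + 1))).
  by field; by rewrite gt_eqF.
have A0 : 0 < a ^+ 2 / (c + 1) by rewrite divr_gt0// -real_normK ?num_real// exprn_gt0.
rewrite ler_pM2l//; have : c / (c + 1) <= 1 by rewrite ler_pdivrMr// mul1r; lra.
by move: (c / (c + 1)) => x; lra.
Qed.

Lemma pairing_le_likelihood r (z : borel H * borel W) :
  1 + (r * pairing z - r ^+ 2 / 2 * `|z.1 : H| ^+ 2) <= lik r z.
Proof.
rewrite /likelihood.
have -> : r ^+ 2 / 2 * `|z.1 : H| ^+ 2 = r ^+ 2 * `|z.1 : H| ^+ 2 / 2 by ring.
exact: expR_ge1Dx.
Qed.

(** No Gaussian moment is computed. Since 1 + r p - r^2 |x|^2 / 2 <= [lik r] and the right side has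
    mean 1, the rates 1 and -1 give integrability, and r E p <= r^2 E0 / 2 for all r of either sign
    forces E p = 0. *)
Lemma pairing_is : integral_is P (@pairing _ S) 0.
Proof.
have one_is : integral_is P (fun=> 1) 1.
  apply: integral_is_ge0 => //; rewrite integral_cst//= mul1e; exact: probability_setT.
have E_is := input_energy_is.
have L_is r := likelihood_is x_dual r.
have [b hb] : exists b, integral_is P (@pairing _ S) b.
  have low := integral_isB (integral_isB one_is (L_is (-1))) (integral_isZ (1 / 2) E_is).
  have up := integral_isD (integral_isB (L_is 1) one_is) (integral_isZ (1 / 2) E_is).
  apply: (integral_is_between _ low up); first exact: measurable_pairing.
  apply: aeW => z; have := pairing_le_likelihood 1 z; have := pairing_le_likelihood (-1) z.
  rewrite expr1n sqrrN expr1n mulN1r mul1r.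
  move: (lik 1 z) (lik (-1) z) (pairing z) (`|z.1 : H| ^+ 2) => l l' p e h1 h2.
  by apply/andP; split; lra.
suff <- : b = 0 by [].
have E0_ge0 : 0 <= E0.
  rewrite -lee_fin -(input_energyE x_energy); apply: integral_ge0 => h _.
  by rewrite lee_fin exprn_ge0.
apply: (@linear_le_quadratic_eq0 _ (E0 / 2)); first by rewrite divr_ge0.
move=> r.
have := integral_is_le (integral_isD one_is (integral_isB (integral_isZ r hb)
  (integral_isZ (r ^+ 2 / 2) E_is))) (L_is r) (aeW _ (pairing_le_likelihood r)).
have -> : r ^+ 2 * (E0 / 2) = r ^+ 2 / 2 * E0 by ring.
by move: (r * b) (r ^+ 2 / 2 * E0) => x y; lra.
Qed.

Section rate.
Variable r : R.
Local Notation PXY := (distribution P (RV_pair (P := P) (input S) (output S r))).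
Local Notation PX_PY := (distribution P (input S) \x distribution P (output S r))%E.

Lemma integral_product_laws (F : borel H * borel W -> \bar R) : measurable_fun setT F ->
    (forall z, (0 <= F z)%E) ->
  (\int[PX_PY]_z F z = \int[P]_z (F z * Q r z.2))%E.
Proof.
move=> mF F0; have mQ := measurable_evidence muX r.
rewrite (fubini_tonelli1 _ mF F0).
have mG : measurable_fun setT (fun z : borel H * borel W => F z * Q r z.2)%E.
  apply: emeasurable_funM; first exact: mF.
  exact: (measurableT_comp mQ measurable_snd).
have FQ0 z : (0 <= F z * Q r z.2)%E by rewrite mule_ge0// evidence_ge0.
rewrite (fubini_tonelli1 _ mG FQ0) /fubini_F.
have secE x : (\int[distribution P (output S r)]_y F (x, y) =
               \int[gamma]_w (F (x, w) * Q r w))%E.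
  have mFx : measurable_fun setT (fun w => F (x, w)).
    exact: (measurableT_comp mF (pair1_measurable x)).
  rewrite (ge0_integral_distribution (output S r) mFx)//.
  exact: (integral_output x_dual r mFx).
under eq_integral do rewrite secE.
have mI : measurable_fun setT (fun x : borel H => \int[gamma]_w (F (x, w) * Q r w))%E.
  exact: (measurable_fun_fubini_tonelli_F (fun z => F z * Q r z.2)%E).
have I0 x : (0 <= \int[gamma]_w (F (x, w) * Q r w))%E.
  by apply: integral_ge0 => w _; exact: (FQ0 (x, w)).
rewrite (ge0_integral_distribution (input S) mI)//.
exact: (integral_fst muX mI).
Qed.

(** Relative to P, the law of (x, y) has density [lik r] and the product of the laws of x and y has
    density q; this is their quotient. *)
Definition joint_density (z : borel H * borel W) : R := lik r z / q r z.2.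

Lemma measurable_joint_density : measurable_fun setT joint_density.
Proof.
apply: measurable_funM; first exact: measurable_likelihood.
exact: (measurableT_comp (measurable_evidence_inv muX r) measurable_snd).
Qed.

Lemma joint_density_ge0 z : 0 <= joint_density z.
Proof. by rewrite divr_ge0 ?likelihood_ge0 ?rev_evidence_ge0. Qed.

Lemma joint_lawE (A : set (borel H * borel W)) : measurable A ->
  (PXY A = \int[PX_PY]_(z in A) (joint_density z)%:E)%E.
Proof.
move=> mA; have mD := measurable_joint_density.
have mDE : measurable_fun setT (EFin \o joint_density) by exact/measurable_EFinP.
have mI : measurable_fun setT (fun z : borel H * borel W => (\1_A z)%:E : \bar R).
  by apply/measurable_EFinP; exact: measurable_indic.
have mQ := measurable_evidence muX r.
transitivity (\int[PXY]_z (\1_A z)%:E)%E; first by rewrite integral_indic// setIT.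
rewrite (ge0_integral_distribution _ mI); last by move=> z; rewrite lee_fin.
transitivity (\int[P]_z ((\1_A z)%:E * (lik r z)%:E))%E.
  by apply: (channel_transfer x_dual r mI) => z; rewrite lee_fin.
apply: esym; rewrite [LHS]integral_mkcond epatch_indic.
have D0 z : (0 <= (joint_density z)%:E * (\1_A z)%:E)%E.
  by rewrite mule_ge0 ?lee_fin// joint_density_ge0.
apply: etrans (integral_product_laws (emeasurable_funM mDE mI) D0) _; apply: esym.
apply: ge0_ae_eq_integralT.
- apply: emeasurable_funM => //; apply/measurable_EFinP; exact: measurable_likelihood.
- apply: emeasurable_funM; first exact: emeasurable_funM.
  exact: (measurableT_comp mQ measurable_snd).
- by move=> z; rewrite mule_ge0 ?lee_fin// likelihood_ge0.
- by move=> z; rewrite !mule_ge0 ?lee_fin ?joint_density_ge0// evidence_ge0.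
apply: (ae_impl (ae_snd muX (rev_evidence_ae x_dual r))) => z [-> q0].
rewrite -!EFinM; congr EFin; rewrite /joint_density; field; by rewrite gt_eqF.
Qed.

Lemma joint_law_integral (F : borel H * borel W -> \bar R) : measurable_fun setT F ->
  P.-integrable setT (fun z => F (z.1, output S r z)) ->
  (\int[PXY]_z F z = \int[P]_z F (z.1, output S r z))%E.
Proof. by move=> mF iF; exact: integral_distribution. Qed.

Lemma joint_law_ae (G : borel H * borel W -> Prop) :
  {ae PXY, forall z, G z} -> {ae P, forall z, G (z.1, output S r z)}.
Proof.
move=> [N [mN N0 hN]].
exists ((fun z => (z.1, output S r z)) @^-1` N); split.
- rewrite -[X in measurable X]setTI; exact: (@measurable_channel _ S r).
- exact: N0.
- by move=> z /= nG; apply: hN.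
Qed.

(** Typed as probabilities, as in [mutual_information], so that [RN] is the derivative occurring
    there. *)
Let PXYp : probability (borel H * borel W)%type R := PXY.
Let PX_PYp : probability (borel H * borel W)%type R := PX_PY.

Local Notation RN := (Radon_Nikodym (charge_of_finite_measure PXYp) PX_PYp).

Lemma joint_law_dominated : charge_of_finite_measure PXYp `<< PX_PYp.
Proof. by apply: (density_dominated measurable_joint_density); exact: joint_lawE. Qed.

Lemma Radon_Nikodym_joint_ae :
  {ae P, forall z, RN (z.1, output S r z) = (joint_density (z.1, output S r z))%:E}.
Proof.
apply: (joint_law_ae (G := fun z => RN z = (joint_density z)%:E)).
by apply: (density_Radon_Nikodym measurable_joint_density); exact: joint_lawE.
Qed.

(** At y = r x + w the term r <y, x> contributes r^2 |x|^2 beyond r <w, x>, which turns the - r^2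
    |x|^2 / 2 of the likelihood into + r^2 |x|^2 / 2. *)
Lemma lne_joint_density_ae : {ae P, forall z,
  lne (RN (z.1, output S r z)) =
  (r * pairing z + r ^+ 2 / 2 * `|z.1 : H| ^+ 2 - ln (q r (output S r z)))%:E}.
Proof.
apply: (ae_impl (ae_and (ae_and Radon_Nikodym_joint_ae (rev_evidence_output_ae x_dual r r))
  (ae_fst gamma x_dual))) => z [[-> [_ q0]] hz].
have l0 := likelihood_gt0 r (z.1, output S r z).
have -> : joint_density (z.1, output S r z) = lik r (z.1, output S r z) / q r (output S r z) by [].
rewrite lne_EFin ?divr_gt0// ln_div ?posrE//; congr (_ - _)%:E.
case: z hz {q0 l0} => h w /= [e _ <-].
have -> : pairing (dual_embed S e, w) = e w by exact: pairing_dual_embed.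
rewrite /likelihood expRK pairing_dual_embed /output /= linearD linearZ /= -(@dual_embedE _ S).
by rewrite -normE /GRing.scale/=; field.
Qed.

Lemma mutual_informationE :
  mutual_information P (input S) (output S r) = (r ^+ 2 / 2 * E0 - output_entropy muX r)%:E.
Proof.
have dom := joint_law_dominated.
have mRN : measurable_fun setT RN by exact: measurable_int (Radon_Nikodym_integrable dom).
have mL := measurable_lne_fin mRN (fun z => Radon_Nikodym_fin_num z dom).
have D_is := output_entropy_is x_dual x_energy r.
have L_is := integral_isB (integral_isD (integral_isZ r pairing_is)
  (integral_isZ (r ^+ 2 / 2) input_energy_is)) D_is.
have mLo : measurable_fun setT (fun z => lne (RN (z.1, output S r z))).
  exact: (measurableT_comp mL (@measurable_channel _ S r)).
have [iL LE] := integral_is_ereal_ae mLo lne_joint_density_ae L_is.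
rewrite mulr0 add0r in LE; rewrite -LE.
exact: (joint_law_integral mL iL).
Qed.

End rate.
End information.

(** The lower bound at r, and the one at r + h used backwards, trap the difference quotient between
    G r and G (r + h). *)
Lemma is_derive_subgradient (R : realType) (D G : R -> R) (r : R) :
  (forall a b, D a + G a * (b - a) <= D b) -> {for r, continuous G} ->
  is_derive r 1 D (G r).
Proof.
move=> sub cG.
have key : (fun h : R => h^-1 *: (D (h *: 1 + r) - D r)) x @[x --> 0^'] --> G r.
  apply/cvgrPdist_le => e e0.
  have : \forall h \near (0 : R), `|G r - G (h + r)| <= e.
    move/cvgrPdist_le : cG => /(_ e e0) /nbhs_ballP[d /= d0 hd].
    apply/nbhs_ballP; exists d => //= h; rewrite /ball/= => hh; apply: hd.
    by rewrite /ball/= opprD addrCA subrr addr0 -sub0r.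
  move=> near_G; near=> h.
  have h0 : h != 0 by near: h; exact: nbhs_dnbhs_neq.
  have hG : `|G r - G (h + r)| <= e by near: h; exact: nbhs_dnbhs.
  apply: le_trans hG; rewrite /GRing.scale/= mulr1.
  have s1 := sub r (h + r); have s2 := sub (h + r) r.
  (* Multiplying by h first avoids a case distinction on its sign. *)
  have : `|(G r - h^-1 * (D (h + r) - D r)) * h| <= `|(G r - G (h + r)) * h|.
    rewrite mulrBl mulrAC mulVf// mul1r.
    move: s1 s2; rewrite addrK opprD addrCA subrr addr0 => s1 s2.
    rewrite (ler0_norm (x := (G r - G (h + r)) * h)); last by move: s1 s2; lra.
    by rewrite ler_norml; apply/andP; split; move: s1 s2; lra.
  by rewrite !normrM ler_pM2r// normr_gt0.
apply: DeriveDef; first by apply/cvg_ex; exists (G r).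
exact: (cvg_lim (@Rhausdorff R) key).
Unshelve. all: by end_near. Qed.

Section rate_derivative.
Context {R : realType} (S : abstract_wiener_space R).
Local Notation H := (cameron_martin S).
Variable muX : probability (borel H) R.
Local Notation P := (channel_prob muX).
Local Notation E0 := (@input_energy R S muX).
Hypothesis x_dual : {ae muX, forall h, range (dual_embed S) h}.
Hypothesis x_energy : muX.-integrable setT (fun h : H => (`|h| ^+ 2)%:E).

Lemma mutual_information_is_derive (r : R) :
  is_derive r 1 (fine \o fun rho => mutual_information P (input S) (output S rho))
    (r * (E0 - overlap muX r)).
Proof.
rewrite (_ : _ \o _ = (fun rho : R => rho ^+ 2 / 2 * E0 - output_entropy muX rho)); last first.
  by apply/funext => rho /=; rewrite mutual_informationE.
have dD : is_derive r 1 (output_entropy muX) (r * overlap muX r).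
  apply: (is_derive_subgradient (G := fun a => a * overlap muX a)).
    move=> a b; rewrite mulrAC; exact: output_entropy_subgradient.
  by apply: cvgM; [exact: cvg_id|exact: overlap_continuous].
move: (output_entropy muX) (overlap muX r) E0 dD => D o E dD.
by apply: is_derive_eq; rewrite /GRing.scale/=; field.
Qed.

End rate_derivative.

(** * Conditional expectation *)

Lemma norm_mul_le_sqr (R : realType) (x y : R) : `|x * y| <= 1 / 2 * (x ^+ 2 + y ^+ 2).
Proof.
have := sqr_ge0 (x - y); have := sqr_ge0 (x + y); rewrite sqrrB sqrrD ler_norml.
by move: (x * y) (x ^+ 2) (y ^+ 2) => p a b h1 h2; apply/andP; split; lra.
Qed.

Section conditional_mean.
Context {R : realType} (S : abstract_wiener_space R).
Local Notation W := (wiener S).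
Local Notation H := (cameron_martin S).
Local Notation ip := (inner S).
Local Notation normE := (@norm_innerE _ S).
Variable muX : probability (borel H) R.
Local Notation gamma := (wiener_measure S).
Local Notation P := (channel_prob muX).
Local Notation lik := (@likelihood R S).
Local Notation Q := (@evidence R S muX).
Local Notation q := (@rev_evidence R S muX).
Local Notation M := (muX \x P)%E.
Local Notation rep := (@replica_weight R S muX).
Local Notation E0 := (@input_energy R S muX).
Hypothesis x_dual : {ae muX, forall h, range (dual_embed S) h}.
Hypothesis x_energy : muX.-integrable setT (fun h : H => (`|h| ^+ 2)%:E).
Variable r : R.

Local Notation triple := (borel H * (borel H * borel W))%type.

Lemma output_transfer_is (F : borel W -> R) a : measurable_fun setT F ->
  integral_is gamma (fun w => F w * q r w) a -> integral_is P (fun z => F (output S r z)) a.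
Proof.
apply: transfer_is; first exact: (@measurable_output _ S r).
  by move=> w; exact: rev_evidence_ge0.
move=> G mG G0; rewrite (integral_output x_dual r mG G0); apply: ge0_ae_eq_integralT.
- apply: emeasurable_funM; [exact: mG|exact: measurable_evidence].
- apply: emeasurable_funM; first exact: mG.
  by apply/measurable_EFinP; exact: measurable_rev_evidence.
- by move=> w; rewrite mule_ge0// evidence_ge0.
- by move=> w; rewrite mule_ge0// lee_fin rev_evidence_ge0.
by apply: (ae_impl (rev_evidence_ae x_dual r)) => w [-> _].
Qed.

(* E ((x, h) | output = w). *)
Definition conditional_mean (h : H) (w : borel W) : R :=
  fine (\int[muX]_x (ip x h * lik r (x, w))%:E)%E / q r w.

Local Notation b := conditional_mean.

Lemma measurable_ip_fst (h : H) :
  measurable_fun setT ((fun z => ip z.1 h) : borel H * borel W -> R).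
Proof. exact: (measurableT_comp (@measurable_ip _ S h) measurable_fst). Qed.

Lemma ip_likelihood_is (h : H) : exists a, integral_is P (fun z => ip z.1 h * lik r z) a.
Proof.
pose u := integral_isD (integral_isZ (1 / 2) (likelihood_energy_is x_dual x_energy r))
  (integral_isZ (`|h| ^+ 2 / 2) (likelihood_is x_dual r)).
apply: (integral_is_between _ (integral_isZ (-1) u) u).
  by apply: measurable_funM; [exact: measurable_ip_fst|exact: measurable_likelihood].
apply: aeW => z; have l0 := likelihood_ge0 r z; rewrite mulN1r -ler_norml.
have -> : 1 / 2 * (`|z.1 : H| ^+ 2 * lik r z) + `|h| ^+ 2 / 2 * lik r z =
    (`|z.1 : H| ^+ 2 + `|h| ^+ 2) / 2 * lik r z by ring.
by rewrite normrM (ger0_norm l0) ler_wpM2r//; exact: ip_le_sqr_norm normE _ _.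
Qed.

Lemma measurable_conditional_mean h : measurable_fun setT (b h).
Proof.
apply: measurable_funM; last exact: measurable_evidence_inv.
apply: (measurableT_comp (@fine_measurable R setT measurableT)).
have [a [ia _]] := ip_likelihood_is h.
exact: (measurable_fubini_G ia).
Qed.

Lemma conditional_mean_ae h : {ae gamma, forall w,
  [/\ Q r w = (q r w)%:E, 0 < q r w &
      integral_is muX (fun x => ip x h * lik r (x, w)) (b h w * q r w)]}.
Proof.
have [a [ia _]] := ip_likelihood_is h.
apply: (ae_impl (ae_and (ae_integrable2 ia) (rev_evidence_ae x_dual r))).
move=> w [iw [Qq q0]]; split=> //; split; first exact: iw.
by rewrite /b divfK ?gt_eqF// fineK//; exact: (integrable_fin_num _ iw).
Qed.

(** The defining property of conditional expectation: through [channel_transfer_is], the hypothesis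
    says that (x, h) F(y) has mean a. *)
Lemma conditional_mean_is h (F : borel W -> R) a : measurable_fun setT F ->
  integral_is P (fun z => ip z.1 h * F z.2 * lik r z) a ->
  integral_is P (fun z => b h (output S r z) * F (output S r z)) a.
Proof.
move=> mF [ia aE]; have mb := measurable_conditional_mean h.
apply: (output_transfer_is (F := fun w => b h w * F w)); first exact: measurable_funM.
have GE : (\int[gamma]_w \int[muX]_x (ip x h * F w * lik r (x, w))%:E = a%:E)%E.
  by rewrite -aE (integral21_prod_meas1 ia).
apply: integral_is_ae (integral_is_fine (integrable_partial_snd ia) GE).
  by apply: measurable_funM; [exact: measurable_funM|exact: measurable_rev_evidence].
apply: (ae_impl (conditional_mean_ae h)) => w [_ _ hw] /=.
have [_ e] := integral_isZ (F w) hw.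
under eq_integral do rewrite (mulrC (ip _ _)) -mulrA.
by rewrite e /=; ring.
Qed.

Lemma sqr_ip_le (x h : H) : ip x h ^+ 2 <= `|x| ^+ 2 * `|h| ^+ 2.
Proof.
have [->|h0] := eqVneq h 0; first by rewrite ipC ip0l normr0 !expr2 !mul0r mulr0.
have n0 : 0 < `|h| ^+ 2 by rewrite exprn_gt0// normr_gt0.
have := sqr_ge0 `|x - (ip x h / `|h| ^+ 2) *: h|.
rewrite (sqr_normB normE) normrZ exprMn real_normK ?num_real// ipZr.
move: (`|x| ^+ 2) (`|h| ^+ 2) (ip x h) n0 => a n p n0.
have -> : a + (p / n) ^+ 2 * n - 2 * (p / n * p) = a - p ^+ 2 / n by field; rewrite gt_eqF.
by rewrite subr_ge0 ler_pdivrMr.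
Qed.

Lemma ip_sqr_is h : exists e, [/\ integral_is P (fun z => ip z.1 h ^+ 2) e,
  (\int[muX]_x (ip x h ^+ 2)%:E = e%:E)%E &
  integral_is P (fun z => ip z.1 h ^+ 2 * lik r z) e].
Proof.
have mI : measurable_fun setT ((fun x => ip x h ^+ 2) : borel H -> R).
  by apply: measurable_funX; exact: measurable_ip.
have mIE : measurable_fun setT ((fun x => (ip x h ^+ 2)%:E) : borel H -> \bar R).
  exact/measurable_EFinP.
have mI1 : measurable_fun setT ((fun z => ip z.1 h ^+ 2) : borel H * borel W -> R).
  by apply: measurable_funX; exact: measurable_ip_fst.
have I0 (x : borel H) : (0 <= (ip x h ^+ 2)%:E)%E by rewrite lee_fin sqr_ge0.
have [e he] : exists e, integral_is P (fun z => ip z.1 h ^+ 2) e.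
  have zero_is : integral_is P (fun=> 0) 0 by apply: integral_is_ge0 => //; rewrite integral0.
  apply: (integral_is_between mI1 zero_is (integral_isZ (`|h| ^+ 2) (input_energy_is x_energy))).
  by apply: aeW => z; rewrite sqr_ge0 mulrC sqr_ip_le.
have eE : (\int[muX]_x (ip x h ^+ 2)%:E = e%:E)%E.
  by rewrite -he.2 -(integral_fst muX mIE I0).
exists e; split=> //; apply: integral_is_ge0.
- by apply: measurable_funM => //; exact: measurable_likelihood.
- by move=> z; rewrite mulr_ge0 ?sqr_ge0 ?likelihood_ge0.
by rewrite -eE -(integral_likelihood x_dual r mIE I0).
Qed.

(** Conditional Jensen for the square: integrate 2 b (x, h) - b^2 <= (x, h)^2 against the posterior,
    where b is constant. *)
Lemma conditional_mean_sqr_le h e :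
  integral_is P (fun z => ip z.1 h ^+ 2 * lik r z) e ->
  exists c, integral_is gamma (fun w => b h w ^+ 2 * q r w) c.
Proof.
move=> [ie eE]; have mb := measurable_conditional_mean h.
have GE : (\int[gamma]_w \int[muX]_x (ip x h ^+ 2 * lik r (x, w))%:E = e%:E)%E.
  by rewrite -eE (integral21_prod_meas1 ie).
have up := integral_is_fine (integrable_partial_snd ie) GE.
have zero_is : integral_is gamma (fun=> 0) 0 by apply: integral_is_ge0 => //; rewrite integral0.
apply: (integral_is_between _ zero_is up).
  apply: measurable_funM; last exact: measurable_rev_evidence.
  exact: measurable_funX.
apply: (ae_impl (ae_and (conditional_mean_ae h) (ae_integrable2 ie))) => w [[Qq q0 hw] iw] /=.
apply/andP; split; first by rewrite mulr_ge0 ?sqr_ge0 ?(ltW q0).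
have sq_is : integral_is muX (fun x => ip x h ^+ 2 * lik r (x, w))
    (fine (\int[muX]_x (ip x h ^+ 2 * lik r (x, w))%:E)).
  by split=> //; rewrite fineK//; exact: (integrable_fin_num _ iw).
have low := integral_isB (integral_isZ (2 * b h w) hw)
  (integral_isZ (b h w ^+ 2) (likelihood_evidence_is Qq)).
have -> : b h w ^+ 2 * q r w = 2 * b h w * (b h w * q r w) - b h w ^+ 2 * q r w by ring.
apply: (integral_is_le low sq_is); apply: aeW => x.
have l0 := likelihood_ge0 r (x, w).
rewrite mulrA -mulrBl ler_wpM2r//.
by have := sqr_ge0 (ip x h - b h w); move: (ip x h) (b h w) => s t; nra.
Qed.

Definition conditional_energy (h : H) : R :=
  fine (\int[P]_z (b h (output S r z) ^+ 2)%:E)%E.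

Local Notation c := conditional_energy.

Lemma conditional_energy_is h : integral_is P (fun z => b h (output S r z) ^+ 2) (c h) /\
  integral_is gamma (fun w => b h w ^+ 2 * q r w) (c h).
Proof.
have [e [_ _ eE]] := ip_sqr_is h; have [c' hc] := conditional_mean_sqr_le eE.
have mb := measurable_conditional_mean h.
have h1 : integral_is P (fun z => b h (output S r z) ^+ 2) c'.
  by apply: (output_transfer_is (F := fun w => b h w ^+ 2)) => //; exact: measurable_funX.
by rewrite /c h1.2.
Qed.

(** The conditional mean is tested against itself, F = b_h in [conditional_mean_is]; AM-GM provides
    the integrability needed for that. *)
Lemma conditional_mean_cross_is h :
  integral_is P (fun z => ip z.1 h * b h z.2 * lik r z) (c h) /\
  integral_is P (fun z => ip z.1 h * b h (output S r z)) (c h).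
Proof.
have [c1 c2] := conditional_energy_is h; have [e [_ _ eE]] := ip_sqr_is h.
have mb := measurable_conditional_mean h.
have mb2 : measurable_fun setT (fun z : borel H * borel W => b h z.2).
  exact: (measurableT_comp mb measurable_snd).
have mI := measurable_ip_fst h; have mL := @measurable_likelihood _ S r.
have c3 : integral_is P (fun z => b h z.2 ^+ 2 * lik r z) (c h).
  apply: integral_is_ge0.
  - by apply: measurable_funM => //; exact: measurable_funX.
  - by move=> z; rewrite mulr_ge0 ?sqr_ge0 ?likelihood_ge0.
  have mb2E : measurable_fun setT (fun w : borel W => (b h w ^+ 2)%:E).
    by apply/measurable_EFinP; exact: (measurable_funX 2 mb).
  transitivity (\int[gamma]_w ((b h w ^+ 2)%:E * Q r w))%E.
    by rewrite -integral_evidence// => w; rewrite lee_fin sqr_ge0.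
  rewrite -c2.2; apply: ge0_ae_eq_integralT.
  - by apply: emeasurable_funM => //; exact: measurable_evidence.
  - apply/measurable_EFinP; apply: measurable_funM; first exact: (measurable_funX 2 mb).
    exact: measurable_rev_evidence.
  - by move=> w; rewrite mule_ge0 ?lee_fin ?sqr_ge0// evidence_ge0.
  - by move=> w; rewrite lee_fin mulr_ge0 ?sqr_ge0// rev_evidence_ge0.
  by apply: (ae_impl (rev_evidence_ae x_dual r)) => w [-> _].
have [a ha] : exists a, integral_is P (fun z => ip z.1 h * b h z.2 * lik r z) a.
  pose u := integral_isZ (1 / 2) (integral_isD eE c3).
  apply: (integral_is_between _ (integral_isZ (-1) u) u).
    by apply: measurable_funM => //; exact: measurable_funM.
  apply: aeW => z; have l0 := likelihood_ge0 r z.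
  rewrite mulN1r -ler_norml normrM (ger0_norm l0) -mulrDl mulrA ler_wpM2r//.
  exact: norm_mul_le_sqr.
have ac : a = c h.
  apply: (integral_is_unique (conditional_mean_is mb ha)).
  by apply: integral_is_eq c1 => z; rewrite expr2.
rewrite -ac; split=> //.
apply: (channel_transfer_is x_dual (F := fun z => ip z.1 h * b h z.2)) => //.
exact: measurable_funM.
Qed.

End conditional_mean.

Lemma eseries_EFin (R : realType) (u : nat -> R) (l : R) :
  \sum_(i < n) u i @[n --> \oo] --> l -> (\sum_(0 <= i <oo) (u i)%:E = l%:E)%E.
Proof.
move=> ul; apply: cvg_lim => //.
rewrite (_ : (fun _ => _) = (fun n => (\sum_(i < n) u i)%:E)).
  by apply: cvg_EFin; [exact: nearW|exact: ul].
by apply/funext => n; rewrite big_mkord sumEFin.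
Qed.

Lemma integral_is_sum (R : realType) d (T : measurableType d) (mu : {measure set T -> \bar R})
    (f : nat -> T -> R) (a : nat -> R) : (forall i, integral_is mu (f i) (a i)) ->
  forall n, integral_is mu (fun x => \sum_(i < n) f i x) (\sum_(i < n) a i).
Proof.
move=> fa; elim=> [|n IH].
  rewrite big_ord0; apply: (integral_is_eq (f := fun=> 0)) => [x|]; first by rewrite big_ord0.
  by apply: integral_is_ge0 => //; rewrite integral0.
rewrite big_ord_recr; apply: integral_is_eq (integral_isD IH (fa n)) => x.
by rewrite big_ord_recr.
Qed.

Lemma integral_is_nneseries (R : realType) d (T : measurableType d)
    (mu : {measure set T -> \bar R}) (f : nat -> T -> R) (F : T -> R) (a : nat -> R) (l : R) :
  measurable_fun setT F -> (forall i x, 0 <= f i x) -> (forall i, integral_is mu (f i) (a i)) ->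
  (forall x, \sum_(i < n) f i x @[n --> \oo] --> F x) ->
  \sum_(i < n) a i @[n --> \oo] --> l ->
  integral_is mu F l.
Proof.
move=> mF f0 fa fF al; apply: integral_is_ge0 => // [x|].
  rewrite -(cvg_lim (@Rhausdorff R) (fF x)); apply: limr_ge; first exact: cvgP (fF x).
  by apply: nearW => n; apply: sumr_ge0.
rewrite -(eseries_EFin al).
transitivity (\int[mu]_x \sum_(0 <= i <oo) (f i x)%:E)%E.
  by apply: eq_integral => x _; rewrite (eseries_EFin (fF x)).
rewrite integral_nneseries//; last 2 first.
- by move=> n; have [/measurable_int] := fa n.
- by move=> n x _; rewrite lee_fin.
by apply: eq_eseriesr => n _; rewrite (fa n).2.
Qed.

(** On the set where u < v, the positive function v - u has integral 0, so the set is null. Only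
    this one set is tested, and it belongs to the sigma-algebra of the output when u and v are
    measurable for it. *)
Lemma ae_le_of_integral_eq (R : realType) d (T : measurableType d)
    (mu : {measure set T -> \bar R}) (u v : T -> R) a b :
  integral_is mu u a -> integral_is mu v b -> measurable [set x | u x < v x] ->
  (\int[mu]_(x in [set x | (u x < v x)%R]) (u x)%:E = \int[mu]_(x in [set x | (u x < v x)%R]) (v x)%:E)%E ->
  {ae mu, forall x, v x <= u x}.
Proof.
set A := [set x | _]; move=> [iu _] [iv _] mA uv.
have iuA : mu.-integrable A (EFin \o u) by exact: integrableS iu.
have ivA : mu.-integrable A (EFin \o v) by exact: integrableS iv.
have iB := integrableB mA ivA iuA.
have z : (\int[mu]_(x in A) `|((EFin \o v) \- (EFin \o u)) x| = 0)%E.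
  transitivity (\int[mu]_(x in A) ((EFin \o v) \- (EFin \o u)) x)%E.
    apply: eq_integral => x; rewrite inE/= => xA.
    by rewrite /= ger0_norm// subr_ge0 ltW.
  rewrite integralB//= uv subee//; exact: (integrable_fin_num mA ivA).
have z_ae := (ae_eq_integral_abs mu mA (measurable_int _ iB)).1 z.
apply: (ae_impl z_ae) => x h; rewrite leNgt; apply/negP => xA.
have := h xA => /= -[] /eqP; rewrite subr_eq0 => /eqP e.
by move: xA; rewrite e ltxx.
Qed.

Lemma parseval_integral (R : realType) (S : abstract_wiener_space R) d (T : measurableType d)
    (mu : {measure set T -> \bar R}) (X Y : T -> cameron_martin S) (D : T -> R)
    (g : nat -> cameron_martin S) (a : nat -> R) (K l : R) :
  (forall h k : cameron_martin S,
    (forall n, `|\sum_(i < n) inner S h (g i) * inner S k (g i)| <= (`|h| ^+ 2 + `|k| ^+ 2) / 2) /\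
    \sum_(i < n) inner S h (g i) * inner S k (g i) @[n --> \oo] --> inner S h k) ->
  (forall x, 0 <= D x) ->
  (forall i, integral_is mu (fun x => inner S (X x) (g i) * inner S (Y x) (g i) * D x) (a i)) ->
  integral_is mu (fun x => 1 / 2 * ((`|X x| ^+ 2 + `|Y x| ^+ 2) * D x)) K ->
  integral_is mu (fun x => inner S (X x) (Y x) * D x) l ->
  \sum_(i < n) a i @[n --> \oo] --> l.
Proof.
move=> gP D0 ha hK hl.
have hs n := integral_is_sum ha n.
have cv : (\int[mu]_x (\sum_(i < n) inner S (X x) (g i) * inner S (Y x) (g i) * D x)%:E
    @[n --> \oo] --> \int[mu]_x (inner S (X x) (Y x) * D x)%:E)%E.
  apply: (dominated_cvg measurableT
    (g := fun x => (1 / 2 * ((`|X x| ^+ 2 + `|Y x| ^+ 2) * D x))%:E)) => //.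
  - by move=> n; have [/measurable_int] := hs n.
  - move=> x _; apply: cvg_EFin; first exact: nearW.
    have -> : fine \o (fun n => (\sum_(i < n) inner S (X x) (g i) * inner S (Y x) (g i) * D x)%:E) =
      (fun n : nat => (\sum_(i < n) inner S (X x) (g i) * inner S (Y x) (g i)) * D x).
      by apply/funext => n /=; rewrite mulr_suml.
    by apply: cvgMr_tmp; exact: (gP _ _).2.
  - exact: hK.1.
  - move=> n x _; rewrite lee_fin -mulr_suml normrM (ger0_norm (D0 x)) mulrA ler_wpM2r//.
    by rewrite mul1r mulrC; exact: (gP _ _).1.
move: cv; rewrite hl.2; under eq_fun do rewrite (hs _).2.
by move/fine_cvg.
Qed.

Lemma measurable_lt_set (R : realType) d (T : measurableType d) (u v : T -> R) :
  measurable_fun setT u -> measurable_fun setT v -> measurable [set x | u x < v x].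
Proof.
move=> mu mv; have mlt := measurable_fun_ltr mu mv.
by have := mlt measurableT [set true] I; rewrite setTI.
Qed.

(** * Coordinates of the conditional expectation and its energy *)

Section conditional_expectation.
Context {R : realType} (S : abstract_wiener_space R).
Local Notation W := (wiener S).
Local Notation H := (cameron_martin S).
Local Notation ip := (inner S).
Local Notation normE := (@norm_innerE _ S).
Variable muX : probability (borel H) R.
Local Notation gamma := (wiener_measure S).
Local Notation P := (channel_prob muX).
Local Notation lik := (@likelihood R S).
Local Notation q := (@rev_evidence R S muX).
Local Notation M := (muX \x P)%E.
Local Notation rep := (@replica_weight R S muX).
Local Notation E0 := (@input_energy R S muX).
Hypothesis x_dual : {ae muX, forall h, range (dual_embed S) h}.
Hypothesis x_energy : muX.-integrable setT (fun h : H => (`|h| ^+ 2)%:E).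
Variable r : R.

Local Notation triple := (borel H * (borel H * borel W))%type.
Local Notation b := (@conditional_mean R S muX r).
Local Notation c := (@conditional_energy R S muX r).

(** Given the output, input and replica are independent with the same posterior, so (x, h) (x', h)
    has conditional mean b_h(y)^2. *)
Lemma replica_coordinate_is h :
  integral_is M (fun t => ip t.1 h * ip t.2.1 h * rep r t) (c h).
Proof.
have [e [_ eX _]] := ip_sqr_is x_dual x_energy r h.
have mI : measurable_fun setT ((fun x => ip x h) : borel H -> R) by exact: measurable_ip.
have mI2 : measurable_fun setT ((fun x => ip x h ^+ 2) : borel H -> R).
  exact: (measurable_funX 2 mI).
have I0 (x : borel H) : 0 <= ip x h ^+ 2 by exact: sqr_ge0.
have mF : measurable_fun setT (fun t : triple => ip t.1 h * ip t.2.1 h * rep r t).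
  apply: measurable_funM; last exact: measurable_replica_weight.
  apply: measurable_funM; first exact: (measurableT_comp mI measurable_fst).
  exact: (measurableT_comp mI (measurableT_comp measurable_fst measurable_snd)).
have [a ha] : exists a, integral_is M (fun t => ip t.1 h * ip t.2.1 h * rep r t) a.
  pose u := integral_isZ (1 / 2) (integral_isD (replica_replica_is x_dual r mI2 I0 eX)
    (replica_input_is x_dual r mI2 I0 eX)).
  apply: (integral_is_between mF (integral_isZ (-1) u) u).
  apply: aeW => t; have l0 := replica_weight_ge0 muX r t.
  rewrite mulN1r -ler_norml normrM (ger0_norm l0) -mulrDl mulrA ler_wpM2r//.
  exact: norm_mul_le_sqr.
suff <- : a = c h by [].
have [ia aE] := ha; have [c1 _] := conditional_mean_cross_is x_dual x_energy r h.
have GE : (\int[P]_z \int[muX]_x (ip x h * ip z.1 h * rep r (x, z))%:E = a%:E)%E.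
  by rewrite -aE (integral21_prod_meas1 ia).
apply: (integral_is_unique _ c1).
apply: integral_is_ae (integral_is_fine (integrable_partial_snd ia) GE).
  by apply/measurable_EFinP; exact: (measurable_int _ c1.1).
apply: (ae_impl (ae_snd muX (conditional_mean_ae x_dual x_energy r h))) => z [_ q0 hz].
have [_ e'] := integral_isZ (ip z.1 h * (lik r z / q r z.2)) hz.
rewrite /= (_ : (\int[muX]_x _)%E = (ip z.1 h * b h z.2 * lik r z)%:E)//.
rewrite (_ : ip z.1 h * b h z.2 * lik r z = ip z.1 h * (lik r z / q r z.2) * (b h z.2 * q r z.2)).
  by rewrite -e'; apply: eq_integral => x _; congr EFin; rewrite /replica_weight /=; ring.
by field; rewrite gt_eqF.
Qed.

Lemma ip_indic_likelihood_is h (B : set (borel W)) : measurable B ->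
  exists a, integral_is P (fun z => ip z.1 h * \1_B z.2 * lik r z) a.
Proof.
move=> mB; have [a [ia _]] := ip_likelihood_is x_dual x_energy r h.
have mI : measurable_fun setT (fun z : borel H * borel W => \1_B z.2 : R).
  have mB1 : measurable_fun setT (\1_B : borel W -> R) by exact: measurable_indic.
  exact: (measurableT_comp mB1 measurable_snd).
have mL := @measurable_likelihood _ S r.
have u : integral_is P (fun z => `|ip z.1 h * lik r z|) (fine (\int[P]_z (`|ip z.1 h * lik r z|)%:E)).
  have iu : P.-integrable setT (EFin \o (fun z => `|ip z.1 h * lik r z|)).
    exact: (integrable_norm ia).
  by split=> //; rewrite fineK//; exact: (integrable_fin_num _ iu).
apply: (integral_is_between _ (integral_isZ (-1) u) u).
  by apply: measurable_funM => //; apply: measurable_funM => //; exact: measurable_ip_fst.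
apply: aeW => z; rewrite mulN1r -ler_norml mulrAC normrM ler_piMr//.
by rewrite indicE; case: (_ \in _); rewrite ?normr1 ?normr0.
Qed.

Lemma conditional_mean_cond h (B : set (borel W)) : measurable B ->
  (\int[P]_(z in output S r @^-1` B) (ip z.1 h)%:E =
   \int[P]_(z in output S r @^-1` B) (b h (output S r z))%:E)%E.
Proof.
move=> mB; have [a ha] := ip_indic_likelihood_is h mB.
have mI : measurable_fun setT (\1_B : borel W -> R) by exact: measurable_indic.
have [_ e1] := conditional_mean_is x_dual x_energy mI ha.
have mF : measurable_fun setT (fun z : borel H * borel W => ip z.1 h * \1_B z.2).
  by apply: measurable_funM; [exact: measurable_ip_fst|exact: (measurableT_comp mI measurable_snd)].
have [_ e2] := channel_transfer_is x_dual mF ha.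
rewrite integral_mkcond [RHS]integral_mkcond !epatch_indic.
transitivity (a%:E); first by rewrite -e2; apply: eq_integral => z _; rewrite EFinM.
by rewrite -e1; apply: eq_integral => z _; rewrite EFinM.
Qed.

Section version.
Variable xhat : borel H * borel W -> H.
Hypothesis xhatP : is_cond_expectation ip P (input S) (output S r) xhat.

Local Notation sY := (g_sigma_algebra_preimageType (output S r)).

Lemma measurable_xhat_coordinate h : measurable_fun setT ((fun z => ip (xhat z) h) : sY -> R).
Proof.
have [mx _ _] := xhatP.
apply: (measurableT_comp (@measurable_ip _ S h) (_ : measurable_fun setT (xhat : sY -> borel H))).
by move=> _ B mB; rewrite setTI; exact: mx.
Qed.

Lemma measurable_conditional_mean_output h :
  measurable_fun setT ((fun z => b h (output S r z)) : sY -> R).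
Proof.
apply: (measurableT_comp (measurable_conditional_mean x_dual x_energy r h)
  (_ : measurable_fun setT (output S r : sY -> borel W))).
by move=> _ B mB; exists B.
Qed.

Lemma sub_output_measurable (A : set (borel H * borel W)) :
  g_sigma_algebra_preimage (output S r) A -> measurable A.
Proof. by case=> B mB <-; exact: (@measurable_output _ S r). Qed.

(** Both sides are measurable for the output and have equal integrals over its events. The null set
    depends on h, which is harmless because only the countably many g_i are used. *)
Lemma xhat_coordinate_ae h : {ae P, forall z, ip (xhat z) h = b h (output S r z)}.
Proof.
have [mx ix hx] := xhatP.
have mu := measurable_xhat_coordinate h; have mv := measurable_conditional_mean_output h.
have same (A : set (borel H * borel W)) : g_sigma_algebra_preimage (output S r) A ->
    (\int[P]_(z in A) (ip (xhat z) h)%:E = \int[P]_(z in A) (b h (output S r z))%:E)%E.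
  move=> sA; rewrite hx//; case: sA => B mB <-; rewrite setTI; exact: conditional_mean_cond.
have mu' : measurable_fun setT (fun z : borel H * borel W => ip (xhat z) h).
  by move=> _ B mB; rewrite setTI; apply: sub_output_measurable; rewrite -[_ @^-1` _]setTI; exact: mu.
have mv' : measurable_fun setT (fun z : borel H * borel W => b h (output S r z)).
  exact: (measurableT_comp (measurable_conditional_mean x_dual x_energy r h) (@measurable_output _ S r)).
have [a ha] : exists a, integral_is P (fun z => ip (xhat z) h) a.
  pose u := integral_is_fine ix (esym (fineK (integrable_fin_num measurableT ix))).
  apply: (integral_is_between mu' (integral_isZ (- `|h|) u) (integral_isZ `|h| u)).
  apply: aeW => z /=; rewrite mulNr -ler_norml -(@ler_pXn2r _ 2)// ?nnegrE ?mulr_ge0//.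
  by rewrite real_normK ?num_real// exprMn mulrC; exact: sqr_ip_le.
have [a' ha'] : exists a, integral_is P (fun z => b h (output S r z)) a.
  have one_is : integral_is P (fun=> 1) 1.
    apply: integral_is_ge0 => //; rewrite integral_cst//= mul1e; exact: probability_setT.
  pose u := integral_isD one_is (conditional_energy_is x_dual x_energy r h).1.
  apply: (integral_is_between mv' (integral_isZ (-1) u) u).
  apply: aeW => z; move: (b h (output S r z)) => s.
  by have := norm_mul_le_sqr s 1; have := sqr_ge0 s; rewrite mulr1 ler_norml; lra.
have lt1 : g_sigma_algebra_preimage (output S r) [set z | ip (xhat z) h < b h (output S r z)].
  exact: (measurable_lt_set mu mv).
have lt2 : g_sigma_algebra_preimage (output S r) [set z | b h (output S r z) < ip (xhat z) h].
  exact: (measurable_lt_set mv mu).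
have h1 := ae_le_of_integral_eq ha ha' (sub_output_measurable lt1) (same _ lt1).
have h2 := ae_le_of_integral_eq ha' ha (sub_output_measurable lt2) (esym (same _ lt2)).
by apply: (ae_impl (ae_and h1 h2)) => z [le1 le2]; apply/eqP; rewrite eq_le le1 le2.
Qed.

Lemma measurable_xhat : measurable_fun setT (xhat : borel H * borel W -> borel H).
Proof.
have [mx _ _] := xhatP.
by move=> _ B mB; rewrite setTI; apply: sub_output_measurable; exact: mx.
Qed.

(** Both energies are sums over a Parseval sequence. In each coordinate the cross term equals the
    conditional energy, so the error contributes e_i - c(g_i). Summing c(g_i) gives the overlap, and
    monotone convergence supplies the square integrability that [is_cond_expectation] does not
    include. *)
Lemma xhat_energy_is : integral_is P (fun z => `|xhat z| ^+ 2) (overlap muX r) /\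
  integral_is P (fun z => `|input S z - xhat z| ^+ 2) (E0 - overlap muX r).
Proof.
have [g gP] := exists_wiener_parseval_sequence S.
have c_cvg : \sum_(i < n) c (g i) @[n --> \oo] --> overlap muX r.
  apply: (parseval_integral gP (replica_weight_ge0 muX r)
    (fun i => replica_coordinate_is (g i)) (replica_energy_is x_dual x_energy r (1 / 2))).
  exact: overlap_is.
pose e i := fine (\int[P]_z (ip z.1 (g i) ^+ 2)%:E).
have e_is i : integral_is P (fun z => ip z.1 (g i) ^+ 2) (e i).
  by have [e' [he' _ _]] := ip_sqr_is x_dual x_energy r (g i); rewrite /e he'.2.
have e_cvg : \sum_(i < n) e i @[n --> \oo] --> E0.
  apply: (parseval_integral (mu := P) (X := fst) (Y := fst) (D := fun=> 1) (K := E0) gP).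
  - by [].
  - by move=> i; apply: integral_is_eq (e_is i) => z; rewrite mulr1 expr2.
  - by apply: integral_is_eq (input_energy_is x_energy) => z; rewrite mulr1; field.
  - by apply: integral_is_eq (input_energy_is x_energy) => z; rewrite mulr1 normE.
have mX : measurable_fun setT ((fun z => z.1) : borel H * borel W -> borel H).
  exact: measurable_fst.
have mxh h : measurable_fun setT (fun z : borel H * borel W => ip (xhat z) h).
  exact: (measurableT_comp (@measurable_ip _ S h) measurable_xhat).
have sq_cvg h : \sum_(i < n) ip h (g i) ^+ 2 @[n --> \oo] --> `|h| ^+ 2.
  have [_] := gP h h; rewrite normE.
  by under eq_fun do under eq_bigr do rewrite -expr2.
split.
  apply: (integral_is_nneseries _ (fun i z => sqr_ge0 (ip (xhat z) (g i))) _ _ c_cvg).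
  - exact: (measurableT_comp (@measurable_sqr_norm _ S) measurable_xhat).
  - move=> i; apply: integral_is_ae (conditional_energy_is x_dual x_energy r (g i)).1.
      by apply: measurable_funX.
    by apply: (ae_impl (xhat_coordinate_ae (g i))) => z ->.
  - by move=> z; exact: sq_cvg.
have d_cvg : \sum_(i < n) (e i - c (g i)) @[n --> \oo] --> E0 - overlap muX r.
  by under eq_fun do rewrite sumrB; exact: cvgB.
have mXh : measurable_fun setT ((fun z => (z.1, xhat z)) : borel H * borel W -> borel H * borel H).
  by apply: measurable_fun_pair; [exact: mX|exact: measurable_xhat].
have mip : measurable_fun setT (fun z : borel H * borel W => ip z.1 (xhat z)).
  exact: (measurableT_comp (@measurable_ip2 _ S) mXh).
apply: (integral_is_nneseries _ (fun i z => sqr_ge0 (ip (input S z - xhat z) (g i))) _ _ d_cvg).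
- under eq_fun do rewrite (sqr_normB normE).
  apply: measurable_funB.
    apply: measurable_funD; first exact: (measurableT_comp (@measurable_sqr_norm _ S) mX).
    exact: (measurableT_comp (@measurable_sqr_norm _ S) measurable_xhat).
  by apply: measurable_funM.
- move=> i; have h1 := (conditional_energy_is x_dual x_energy r (g i)).1.
  have h2 := (conditional_mean_cross_is x_dual x_energy r (g i)).2.
  have := integral_isD (integral_isB (e_is i) (integral_isZ 2 h2)) h1.
  rewrite (_ : e i - 2 * c (g i) + c (g i) = e i - c (g i)); last by ring.
  apply: integral_is_ae.
    under eq_fun do rewrite (ipBl).
    by apply: measurable_funX; apply: measurable_funB => //; exact: measurable_ip_fst.
  by apply: (ae_impl (xhat_coordinate_ae (g i))) => z <-; rewrite ipBl sqrrB /input; ring.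
- by move=> z; exact: sq_cvg.
Qed.

End version.
End conditional_expectation.

Theorem proposition5p1 (R : realType) (S : abstract_wiener_space R)
    (muX : probability (borel (cameron_martin S)) R)
    (x_dual : {ae muX, forall h, range (dual_embed S) h})
    (x_exp : forall (alpha : R) (e : dual (wiener S)),
      muX.-integrable setT
        (fun h => (expR (alpha * inner S h (dual_embed S e)))%:E))
    (x_energy : muX.-integrable setT
      (fun h : cameron_martin S => (`|h| ^+ 2)%:E)) :
  let P := channel_prob muX in
  let I (rho : R) := mutual_information P (input S) (output S rho) in
  let x : _ -> cameron_martin S := input S in
  (forall rho : R, I rho \is a fin_num /\ derivable (fine \o I) rho 1) /\
  forall (rho : R) (xhat : _ -> cameron_martin S),
    is_cond_expectation (inner S) P x (output S rho) xhat ->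
    ((derive1 (fine \o I) rho)%:E =
       rho%:E * 'E_P[fun z => (`|x z| ^+ 2 - `|xhat z| ^+ 2)%R])%E /\
    (rho%:E * 'E_P[fun z => (`|x z| ^+ 2 - `|xhat z| ^+ 2)%R] =
       rho%:E * 'E_P[fun z => (`|x z - xhat z| ^+ 2)%R])%E.
Proof.
move=> P I x; have dI (rho : R) := mutual_information_is_derive x_dual x_energy rho.
split=> [rho|rho xhat xhatP].
  by split; [rewrite /I mutual_informationE|case: (dI rho)].
have [xh_is d_is] := xhat_energy_is x_dual x_energy xhatP.
have gap_is := integral_isB (input_energy_is x_energy) xh_is.
have E1 : ('E_P[fun z => (`|x z| ^+ 2 - `|xhat z| ^+ 2)%R] =
    (input_energy muX - overlap muX rho)%:E)%E.
  by rewrite unlock -gap_is.2.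
have E2 : ('E_P[fun z => (`|x z - xhat z| ^+ 2)%R] =
    (input_energy muX - overlap muX rho)%:E)%E.
  by rewrite unlock -d_is.2.
by rewrite E1 E2 derive1E; case: (dI rho) => _ ->.
Qed.
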